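(* Let $n\ge 4$. Any conformally flat hypersurface $M$ ($\dim M=n$) in the Euclidean space $\mathbb{R}^{n+1}$ is locally a part of one of the following hypersurfaces: (i) hyperplane ($\alpha=\beta=0$); (ii) hypersphere ($\alpha\neq 0$, $\beta=0$); (iii) developable hypersurface ($\alpha=0$, $\beta\neq 0$); (iv) canal hypersurface ($\alpha\neq 0$, $\beta\neq 0$). Here $\alpha,\beta$ are the functions in the expression $h=\alpha\,g+\beta\,\eta\otimes\eta$ of the second fundamental form.
   Context: A hypersurface is conformally flat if its induced Riemannian metric $g$ is (locally) conformally flat. $h$ denotes the second fundamental form of the hypersurface; for the hypersurfaces listed it has the form $h=\alpha\,g+\beta\,\eta\otimes\eta$ with functions $\alpha,\beta$ and a unit 1-form $\eta$. A developable hypersurface here corresponds to $h=\beta\,\eta\otimes\eta$ with $\beta\neq0$. A canal hypersurface in $\mathbb{R}^{n+1}$ is a hypersurface which is a one-parameter family of $(n-1)$-dimensional spheres $S^{n-1}(s)$ (spherical generators) such that the normals to the hypersurface at the points of any fixed generator pass through a fixed point; equivalently, it is the envelope of a one-parameter family of hyperspheres.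
   Formalization: The classification (i)–(iv) is stated at the points of M near which the vanishing of α and of β does not change, and these are proved dense in M; near other points, such as an inflection line of a cylinder, none of (i)–(iv) can hold. *)

(* Defs.v *)
From mathcomp Require Import all_boot all_order all_algebra.
From mathcomp Require Import all_classical all_reals all_analysis.
Set Implicit Arguments.
Unset Strict Implicit.
Unset Printing Implicit Defensive.
Import Order.TTheory GRing.Theory Num.Theory.
Import numFieldNormedType.Exports.
Local Open Scope classical_set_scope.
Local Open Scope ring_scope.

(* Iterated derivatives along arbitrary constant directions; in finite
   dimension [smooth_on U f] for open [U] is the usual C^oo condition. *)
Definition smooth_on (R : realType) (V W : normedModType R)
    (U : set V) (f : V -> W) : Prop :=
  forall (s : seq V) (x : V), U x ->
    differentiable (foldr (fun (v : V) (g : V -> W) => 'D_v g) f s) x.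

Definition dotp (R : realType) (m : nat) (x y : 'rV[R]_m) : R :=
  \sum_(k < m) x 0 k * y 0 k.

Definition partial (R : realType) (n m : nat) (i : 'I_n)
    (f : 'rV[R]_n -> 'rV[R]_m) : 'rV[R]_n -> 'rV[R]_m :=
  'D_(delta_mx 0 i) f.

(* A C^oo regular parametrization of a relatively open piece of [M]: the last
   clause says that [f] is open onto its image for the topology induced on
   [M], i.e. a homeomorphism onto a relatively open subset of [M]. *)
Definition local_param (R : realType) (n : nat) (M : set 'rV[R]_n.+1)
    (U : set 'rV[R]_n) (f : 'rV[R]_n -> 'rV[R]_n.+1) : Prop :=
  [/\ open U, smooth_on U f, {in U &, injective f},
      forall u, U u -> row_free (\matrix_(i < n) partial i f u)
    & forall V, open V -> V `<=` U -> exists2 W, open W & f @` V = M `&` W].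

Definition hypersurface (R : realType) (n : nat) (M : set 'rV[R]_n.+1) : Prop :=
  forall p, M p -> exists U f, local_param M U f /\ (f @` U) p.

Definition metric (R : realType) (n : nat)
    (f : 'rV[R]_n -> 'rV[R]_n.+1) (u : 'rV[R]_n) : 'M[R]_n :=
  \matrix_(i, j) dotp (partial i f u) (partial j f u).

Definition conformally_flat (R : realType) (n : nat)
    (M : set 'rV[R]_n.+1) : Prop :=
  forall p, M p -> exists U f (phi : 'rV[R]_n -> R),
    [/\ local_param M U f, (f @` U) p, smooth_on U phi
      & forall u, U u -> metric f u = (expR (2 * phi u))%:M].

Definition unit_normal (R : realType) (n : nat)
    (f : 'rV[R]_n -> 'rV[R]_n.+1) (u : 'rV[R]_n) (nu : 'rV[R]_n.+1) : Prop :=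
  dotp nu nu = 1 /\ forall i, dotp (partial i f u) nu = 0.

Definition second_form (R : realType) (n : nat)
    (f : 'rV[R]_n -> 'rV[R]_n.+1) (u : 'rV[R]_n) (nu : 'rV[R]_n.+1) : 'M[R]_n :=
  \matrix_(i, j) dotp (partial i (partial j f) u) nu.

(* [eta] lists the components of a covector in the coordinates of [f]; its
   norm is computed with the inverse metric. *)
Definition unit_covector (R : realType) (n : nat)
    (f : 'rV[R]_n -> 'rV[R]_n.+1) (u : 'rV[R]_n) (eta : 'rV[R]_n) : Prop :=
  eta *m invmx (metric f u) *m eta^T = 1%:M.

(* h = a g + b eta (x) eta at the point of parameter [u]. *)
Definition quasi_umbilic (R : realType) (n : nat)
    (f : 'rV[R]_n -> 'rV[R]_n.+1) (u : 'rV[R]_n)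
    (nu : 'rV[R]_n.+1) (a b : R) (eta : 'rV[R]_n) : Prop :=
  [/\ unit_normal f u nu, unit_covector f u eta
    & second_form f u nu = a *: metric f u + b *: (eta^T *m eta)].

Definition quasi_umbilic_at (R : realType) (n : nat) (M : set 'rV[R]_n.+1)
    (p : 'rV[R]_n.+1) (a b : R) : Prop :=
  exists U f u nu eta,
    [/\ local_param M U f, U u, f u = p & quasi_umbilic f u nu a b eta].

Definition quasi_umbilic_on (R : realType) (n : nat)
    (U : set 'rV[R]_n) (f nu : 'rV[R]_n -> 'rV[R]_n.+1)
    (a b : 'rV[R]_n -> R) (eta : 'rV[R]_n -> 'rV[R]_n) : Prop :=
  [/\ smooth_on U nu, smooth_on U a, smooth_on U b, smooth_on U eta
    & forall u, U u -> quasi_umbilic f u (nu u) (a u) (b u) (eta u)].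

(* The points of [M] near which the vanishing or non-vanishing of alpha and of
   beta does not change. For n >= 3 the pair (alpha, beta) is determined at
   each point up to a common sign, that of the unit normal. *)
Definition constant_type (R : realType) (n : nat) (M : set 'rV[R]_n.+1)
    : set 'rV[R]_n.+1 :=
  [set p | M p /\ exists W (za zb : bool), [/\ open W, W p
    & forall q, (M `&` W) q -> exists a b,
        [/\ quasi_umbilic_at M q a b, (a == 0) = za & (b == 0) = zb]]].

Definition open_part (R : realType) (m : nat) (N S : set 'rV[R]_m) : Prop :=
  exists2 W, open W & N = W `&` S.

Definition hyperplane (R : realType) (m : nat) (S : set 'rV[R]_m) : Prop :=
  exists (v : 'rV[R]_m) (d : R), v != 0 /\ S = [set x | dotp x v = d].

Definition hypersphere (R : realType) (m : nat) (S : set 'rV[R]_m) : Prop :=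
  exists (c : 'rV[R]_m) (r : R),
    0 < r /\ S = [set x | dotp (x - c) (x - c) = r ^+ 2].

Definition developable (R : realType) (n : nat) (N : set 'rV[R]_n.+1) : Prop :=
  forall p, N p -> exists U f nu b eta,
    [/\ local_param N U f, (f @` U) p,
        quasi_umbilic_on U f nu (fun _ => 0) b eta
      & forall u, U u -> b u != 0].

Definition normal_to (R : realType) (n : nat) (N : set 'rV[R]_n.+1)
    (p v : 'rV[R]_n.+1) : Prop :=
  exists U f u, [/\ local_param N U f, U u, f u = p
    & forall i, dotp (partial i f u) v = 0].

(* The sphere of codimension two with centre [c] and radius [r] in the
   hyperplane through [c] orthogonal to [e]. *)
Definition subsphere (R : realType) (m : nat) (c e : 'rV[R]_m) (r : R)
    : set 'rV[R]_m :=
  [set x | dotp (x - c) (x - c) = r ^+ 2 /\ dotp (x - c) e = 0].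

(* [N] is an open part of a canal hypersurface: an open part of the union of a
   smooth one-parameter family of spheres of codimension two, the normal line
   of [N] at each point of the generator of parameter [s] passing through the
   point [o s]. The normality condition is put on [N] only, because complete
   generators may contain singular points of the union. *)
Definition canal_part (R : realType) (n : nat) (N : set 'rV[R]_n.+1) : Prop :=
  exists (t0 t1 : R) (c e o : R -> 'rV[R]_n.+1) (r : R -> R),
    let I := [set s : R | t0 < s < t1] in
    [/\ [/\ t0 < t1, smooth_on I c, smooth_on I e & smooth_on I r],
        forall s, I s -> 0 < r s /\ dotp (e s) (e s) = 1,
        open_part N (\bigcup_(s in I) subsphere (c s) (e s) (r s))
      & forall s x, I s -> (N `&` subsphere (c s) (e s) (r s)) x ->
          normal_to N x (o s - x)].

(* Main.v *)
Require Import Defs.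
From HB Require Import structures.
From mathcomp Require Import all_boot all_order all_algebra.
From mathcomp Require Import all_classical all_reals all_analysis.
From mathcomp Require Import ring lra zify.
Set Implicit Arguments.
Unset Strict Implicit.
Unset Printing Implicit Defensive.
Import Order.TTheory GRing.Theory Num.Theory.
Import numFieldNormedType.Exports.
Local Open Scope classical_set_scope.
Local Open Scope ring_scope.

(** Near a point of [M] take conformal coordinates [f] and a smooth unit normal.
    A conformally flat metric has no curvature on quadruples of orthogonal
    directions, so the Gauss equation gives [h12 h34 = h13 h24] for such
    quadruples ([gauss_quadruple]). In dimension at least four this forces all
    eigenvalues of [h] but one to coincide ([quasi_umbilic_form]), whence
    [h = alpha g + beta eta (x) eta] at every point. The two coefficients are
    rational in the traces of the powers of [h] ([invariant_parts]); this makes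
    them smooth where [beta] does not vanish, and the points of constant type
    dense ([constant_type_dense]). A second chart at the same point changes
    the coefficients at most by a common sign ([umbilic_type_independent]).

    The classification rests on the equation
    [d nu = - alpha df - beta eta dual_vec], where [dual_vec] is the tangent vector
    dual to [eta], and on the symmetry of second derivatives. If [beta = 0], then
    [alpha] is constant ([umbilic_coeff_constant]), and either [nu] or
    [f + nu / alpha] is constant: a hyperplane or a hypersphere. If [beta] does not
    vanish and [alpha = 0], the hypersurface is developable by definition. If
    neither vanishes, [alpha] is constant along the kernel of [eta], this kernel is
    integrable, and along its leaves [d dual_vec = kappa df] with [kappa] constant
    as well ([umbilic_coeff_leafwise], [curl_eta_leafwise], [dual_vec_leafwise],
    [leaf_curvature_leafwise]). Hence each leaf lies on a sphere of codimension
    two, and the normals along it meet in the focal point [f + nu / alpha]. This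
    point moves when the leaf changes ([focal_point_transverse]), so that the
    leaves are the level sets of a coordinate of it.

    It remains to see that the pieces are open in the union of these spheres, or
    in the hyperplane or hypersphere. Nearest points show this: a point
    of the model that is close to the piece has a nearest point on it
    ([near_minimum]), at which the displacement is normal, and in each model a
    normal displacement between nearby points is zero ([open_piece],
    [canal_piece]). *)

(** * Directional derivatives and smoothness of finite order *)

Section FirstOrder.
Context {R : realType} {V W : normedModType R}.
Implicit Types (f g : V -> W) (x : V).

(** The derivative is characterised by its first order estimate, in a form in
    which nothing but values of [f] near [x] enters. *)
Lemma differentiable_approx f x (L : {linear V -> W}) :
  continuous L ->
  (forall e, 0 < e -> \forall h \near 0, `|f (h + x) - f x - L h| <= e * `|h|) ->
  differentiable f x.
Proof.
move=> cL fL.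
have H : f \o shift x = cst (f x) + L +o_ 0 id.
  apply/eqaddoP => e e0; near=> h.
  rewrite [X in `|X|](_ : _ = f (h + x) - f x - L h); last by rewrite opprD addrA.
  by near: h; exact: fL.
by apply/diff_locallyP; rewrite (diff_unique cL H).
Unshelve. all: by end_near. Qed.

Lemma differentiable_approxE f x : differentiable f x ->
  forall e, 0 < e ->
    \forall h \near 0, `|f (h + x) - f x - 'D_h f x| <= e * `|h|.
Proof.
move=> df e e0; have /eqaddoP/(_ e e0) H := diff_locally df.
near=> h; rewrite deriveE//.
rewrite [X in `|X|](_ : _ = (f \o shift x - (cst (f x) + 'd f x)) h); last first.
  by rewrite /= opprD addrA.
by near: h; exact: H.
Unshelve. all: by end_near. Qed.

Lemma near_eq_differentiable f g x :
  {near x, f =1 g} -> differentiable f x -> differentiable g x.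
Proof.
move=> fg df; have fgx : f x = g x by exact: nbhs_singleton fg.
have cdf : continuous ('d f x) by exact: (diff_continuous df).
apply: (differentiable_approx cdf).
move=> e e0; have H := differentiable_approxE df e0.
have H2 : \forall h \near 0, f (x + h) = g (x + h) by exact: (nbhs0P (fun y => f y = g y) x).1.
near=> h; rewrite -deriveE// -fgx.
have <- : f (h + x) = g (h + x) by rewrite [h + x]addrC; near: h.
by near: h.
Unshelve. all: by end_near. Qed.

Lemma deriveDl f x u v : differentiable f x ->
  'D_(u + v) f x = 'D_u f x + 'D_v f x.
Proof. by move=> df; rewrite !deriveE// linearD. Qed.

Lemma deriveZl f x a v : differentiable f x -> 'D_(a *: v) f x = a *: 'D_v f x.
Proof. by move=> df; rewrite !deriveE// linearZ. Qed.

Lemma deriveNl f x v : differentiable f x -> 'D_(- v) f x = - 'D_v f x.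
Proof. by move=> df; rewrite !deriveE// linearN. Qed.

Lemma derive_suml f x I (r : seq I) (P : pred I) (v : I -> V) :
  differentiable f x ->
  'D_(\sum_(i <- r | P i) v i) f x = \sum_(i <- r | P i) 'D_(v i) f x.
Proof.
move=> df; rewrite !deriveE// linear_sum.
by apply: eq_bigr => i _; rewrite deriveE.
Qed.

End FirstOrder.

Section Ck.
Context {R : realType} {V : normedModType R}.
Implicit Types (U : set V) (k : nat).

(** The derivatives up to order [k + 1] exist on [U]. Finite order makes
    induction possible: the derivative of a product or of an inverse again
    contains the functions themselves, so that a direct recursion on lists of
    directions would not close. *)
Fixpoint Ck (W : normedModType R) k U (f : V -> W) : Prop :=
  if k is k'.+1 then
    (forall x, U x -> differentiable f x) /\ forall v, Ck k' U ('D_v f)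
  else forall x, U x -> differentiable f x.

(** [Ck] takes the innermost derivative first, and this is the one in the last
    direction of the list, hence the induction from the right. *)
Lemma smooth_onP (W : normedModType R) U (f : V -> W) :
  smooth_on U f <-> forall k, Ck k U f.
Proof.
split=> [+ k|].
  elim: k f => [|k IH] f sf; first by move=> x Ux; exact: (sf [::]).
  split=> [x Ux|v]; first exact: (sf [::]).
  by apply: IH => s x Ux; have := sf (rcons s v) x Ux; rewrite foldr_rcons.
move=> + s; elim/last_ind: s f => [|s v IH] f Cf x Ux.
  by have := Cf 0 => /(_ x Ux).
rewrite foldr_rcons; apply: IH => // k.
by have [_ /(_ v)] := Cf k.+1.
Qed.

Lemma smooth_differentiable (W : normedModType R) U (f : V -> W) x :
  smooth_on U f -> U x -> differentiable f x.
Proof. by move=> sf Ux; exact: (sf [::] x Ux). Qed.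

Lemma smooth_derive (W : normedModType R) U (f : V -> W) v :
  smooth_on U f -> smooth_on U ('D_v f).
Proof. by move=> sf s x Ux; have := sf (rcons s v) x Ux; rewrite foldr_rcons. Qed.

Lemma smooth_sub (W : normedModType R) U U' (f : V -> W) :
  U' `<=` U -> smooth_on U f -> smooth_on U' f.
Proof. by move=> UU' sf s x /UU'; exact: sf. Qed.

Lemma derive_ext_on (W : normedModType R) U (f g : V -> W) v x :
  open U -> (forall y, U y -> f y = g y) -> U x -> 'D_v f x = 'D_v g x.
Proof.
move=> oU fg Ux; apply: near_eq_derive.
by near=> y; apply: fg; near: y; exact: open_nbhs_nbhs.
Unshelve. all: by end_near. Qed.

Lemma differentiable_ext_on (W : normedModType R) U (f g : V -> W) x :
  open U -> (forall y, U y -> f y = g y) -> U x ->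
  differentiable f x -> differentiable g x.
Proof.
move=> oU fg Ux; apply: near_eq_differentiable.
by near=> y; apply: fg; near: y; exact: open_nbhs_nbhs.
Unshelve. all: by end_near. Qed.

Lemma Ck_ext (W : normedModType R) k U (f g : V -> W) :
  open U -> (forall x, U x -> f x = g x) -> Ck k U f -> Ck k U g.
Proof.
move=> oU; elim: k f g => [|k IH] f g fg /=.
  by move=> df x Ux; exact: (differentiable_ext_on oU fg Ux (df x Ux)).
move=> [df Df]; split=> [x Ux|v].
  exact: (differentiable_ext_on oU fg Ux (df x Ux)).
by apply: IH (Df v) => x Ux; exact: derive_ext_on Ux.
Qed.

Lemma smooth_ext (W : normedModType R) U (f g : V -> W) :
  open U -> (forall x, U x -> f x = g x) -> smooth_on U f -> smooth_on U g.
Proof. by move=> oU fg /smooth_onP sf; apply/smooth_onP => k; exact: Ck_ext (sf k). Qed.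

Lemma Ck_le (W : normedModType R) k U (f : V -> W) : Ck k.+1 U f -> Ck k U f.
Proof.
elim: k f => [|k IH] f /= [df Df] //; split=> // v.
by apply: IH; exact: Df.
Qed.

Lemma Ck_cst (W : normedModType R) k U (w : W) : Ck k U (fun=> w).
Proof.
elim: k w => [|k IH] w /=; first by move=> x _; exact: differentiable_cst.
split=> [x _|v]; first exact: differentiable_cst.
by rewrite (_ : 'D_v (fun=> w) = fun=> 0)//; apply/funext => x; exact: derive_cst.
Qed.

Lemma Ck_add (W : normedModType R) k U (f g : V -> W) :
  open U -> Ck k U f -> Ck k U g -> Ck k U (fun x => f x + g x).
Proof.
move=> oU; elim: k f g => [|k IH] f g /=.
  by move=> df dg x Ux; apply: differentiableD; [exact: df|exact: dg].
move=> [df Df] [dg Dg]; split=> [x Ux|v].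
  by apply: differentiableD; [exact: df|exact: dg].
apply: (Ck_ext oU _ (IH _ _ (Df v) (Dg v))) => x Ux.
by rewrite deriveD//; apply: diff_derivable; [exact: df|exact: dg].
Qed.

Lemma Ck_mul k U (f g : V -> R) :
  open U -> Ck k U f -> Ck k U g -> Ck k U (fun x => f x * g x).
Proof.
move=> oU; elim: k f g => [|k IH] f g.
  by move=> df dg x Ux; apply: differentiableM; [exact: df|exact: dg].
move=> Cf Cg; have [df Df] := Cf; have [dg Dg] := Cg; split=> [x Ux|v].
  by apply: differentiableM; [exact: df|exact: dg].
apply: (Ck_ext oU _ (Ck_add oU (IH _ _ (Ck_le Cf) (Dg v)) (IH _ _ (Ck_le Cg) (Df v)))).
by move=> x Ux; rewrite deriveM//; apply: diff_derivable; [exact: df|exact: dg].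
Qed.

Lemma Ck_inv k U (f : V -> R) : open U -> (forall x, U x -> f x != 0) ->
  Ck k U f -> Ck k U (fun x => (f x)^-1).
Proof.
move=> oU f0; elim: k => [|k IH].
  by move=> df x Ux; apply: differentiableV; [exact: df|exact: f0].
move=> Cf; have [df Df] := Cf; split=> [x Ux|v].
  by apply: differentiableV; [exact: df|exact: f0].
have Cv := IH (Ck_le Cf).
apply: (Ck_ext oU _ (Ck_mul oU (Ck_cst k U (-1 : R)) (Ck_mul oU (Df v) (Ck_mul oU Cv Cv)))).
move=> x Ux; rewrite deriveV ?f0//; last exact/diff_derivable/df.
by rewrite -exprVn expr2 scaleNr mulN1r [_ *: _]mulrC.
Qed.

Lemma Ck_sqrt k U (f : V -> R) : open U -> (forall x, U x -> 0 < f x) ->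
  Ck k U f -> Ck k U (fun x => Num.sqrt (f x)).
Proof.
move=> oU f0.
have ds x : U x -> differentiable f x -> differentiable (fun x => Num.sqrt (f x)) x.
  move=> Ux df; apply: (@differentiable_comp _ _ _ _ f Num.sqrt) => //.
  by apply/derivable1_diffP; have [] := is_derive1_sqrt (f0 _ Ux).
elim: k => [|k IH]; first by move=> df x Ux; apply: ds => //; exact: df.
move=> Cf; have [df Df] := Cf; split=> [x Ux|v].
  by apply: ds => //; exact: df.
have Cs := IH (Ck_le Cf).
have Cv : Ck k U (fun x => (2 * Num.sqrt (f x))^-1).
  apply: Ck_inv => // [x Ux|]; first by rewrite mulf_neq0// gt_eqF// sqrtr_gt0 f0.
  exact: (Ck_mul oU (Ck_cst k U (2 : R)) Cs).
apply: (Ck_ext oU _ (Ck_mul oU Cv (Df v))).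
move=> x Ux; have dsx : differentiable Num.sqrt (f x).
  by apply/derivable1_diffP; have [] := is_derive1_sqrt (f0 _ Ux).
rewrite [RHS]deriveE; last exact/ds/df.
rewrite (@diff_comp _ _ _ _ f Num.sqrt)//; last exact: df.
rewrite /= -(deriveE v (df x Ux)).
rewrite -[X in 'd _ _ X]mulr1 -[_ * 1]/(_ *: 1) linearZ/= -deriveE//.
by rewrite derive_sqrt ?f0// mulrC.
Qed.

End Ck.

(** * The scalar product and the algebra of smooth functions *)

Section DotProduct.
Context {R : realType} {m : nat}.
Implicit Types (x y z : 'rV[R]_m) (a : R).

Lemma dotpC x y : dotp x y = dotp y x.
Proof. by apply: eq_bigr => k _; rewrite mulrC. Qed.

Lemma dotpDl x y z : dotp (x + y) z = dotp x z + dotp y z.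
Proof. by rewrite -big_split/=; apply: eq_bigr => k _; rewrite mxE mulrDl. Qed.

Lemma dotpDr x y z : dotp z (x + y) = dotp z x + dotp z y.
Proof. by rewrite dotpC dotpDl !(dotpC z). Qed.

Lemma dotpZl a x y : dotp (a *: x) y = a * dotp x y.
Proof. by rewrite mulr_sumr; apply: eq_bigr => k _; rewrite mxE mulrA. Qed.

Lemma dotpZr a x y : dotp x (a *: y) = a * dotp x y.
Proof. by rewrite dotpC dotpZl dotpC. Qed.

Lemma dotpNl x y : dotp (- x) y = - dotp x y.
Proof. by rewrite -scaleN1r dotpZl mulN1r. Qed.

Lemma dotpNr x y : dotp x (- y) = - dotp x y.
Proof. by rewrite dotpC dotpNl dotpC. Qed.

Lemma dotpBl x y z : dotp (x - y) z = dotp x z - dotp y z.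
Proof. by rewrite dotpDl dotpNl. Qed.

Lemma dotpBr x y z : dotp z (x - y) = dotp z x - dotp z y.
Proof. by rewrite dotpDr dotpNr. Qed.

Lemma dotp0l x : dotp 0 x = 0.
Proof. by rewrite -(scale0r (0 : 'rV_m)) dotpZl mul0r. Qed.

Lemma dotp0r x : dotp x 0 = 0.
Proof. by rewrite dotpC dotp0l. Qed.

Lemma dotp_suml I (r : seq I) (P : pred I) (F : I -> 'rV_m) y :
  dotp (\sum_(i <- r | P i) F i) y = \sum_(i <- r | P i) dotp (F i) y.
Proof.
by elim/big_ind2 : _ => [|? ? ? ? <- <-|//]; rewrite ?dotp0l ?dotpDl.
Qed.

Lemma dotp_sumr I (r : seq I) (P : pred I) (F : I -> 'rV_m) y :
  dotp y (\sum_(i <- r | P i) F i) = \sum_(i <- r | P i) dotp y (F i).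
Proof. by rewrite dotpC dotp_suml; apply: eq_bigr => i _; rewrite dotpC. Qed.

Lemma dotp_deltal x (k : 'I_m) : dotp (delta_mx 0 k) x = x 0 k.
Proof.
rewrite /dotp (bigD1 k)//= big1 => [|j jk]; rewrite mxE eqxx /= ?eqxx ?mul1r ?addr0//.
by rewrite (negbTE jk) mul0r.
Qed.

Lemma dotp_deltar x (k : 'I_m) : dotp x (delta_mx 0 k) = x 0 k.
Proof. by rewrite dotpC dotp_deltal. Qed.

Lemma dotp_ge0 x : 0 <= dotp x x.
Proof. by apply: sumr_ge0 => k _; rewrite -expr2 sqr_ge0. Qed.

Lemma dotp_eq0 x : (dotp x x == 0) = (x == 0).
Proof.
apply/eqP/eqP => [|->]; last exact: dotp0l.
move=> /eqP; rewrite psumr_eq0 => [/allP x0|k _]; last by rewrite -expr2 sqr_ge0.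
apply/rowP => k; have := x0 k (mem_index_enum _).
by rewrite /= -expr2 sqrf_eq0 mxE => /eqP.
Qed.

Lemma dotp_gt0 x : x != 0 -> 0 < dotp x x.
Proof. by move=> x0; rewrite lt_neqAle dotp_ge0 eq_sym dotp_eq0 x0. Qed.

Lemma dotp_mx x y : x *m y^T = (dotp x y)%:M.
Proof.
by apply/matrixP => i j; rewrite !ord1 !mxE eqxx; apply: eq_bigr => k _; rewrite !mxE.
Qed.

Lemma row_sum_deltaE x : x = \sum_k x 0 k *: delta_mx 0 k.
Proof. exact: row_sum_delta. Qed.

Lemma dotp_inj x y : (forall z, dotp x z = dotp y z) -> x = y.
Proof. by move=> xy; apply/rowP => k; rewrite -!dotp_deltar xy. Qed.

End DotProduct.

Definition dotpE := (@dotpDl, @dotpDr, @dotpNl, @dotpNr, @dotpZl, @dotpZr, @dotp0l, @dotp0r).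

Section SmoothAlgebra.
Context {R : realType} {V : normedModType R}.
Implicit Types (U : set V).

Lemma smooth_cst (W : normedModType R) U (w : W) : smooth_on U (fun=> w).
Proof. by apply/smooth_onP => k; exact: Ck_cst. Qed.
Arguments smooth_cst {W} U w.

Lemma smoothD (W : normedModType R) U (f g : V -> W) : open U ->
  smooth_on U f -> smooth_on U g -> smooth_on U (fun x => f x + g x).
Proof.
by move=> oU /smooth_onP sf /smooth_onP sg; apply/smooth_onP => k; exact: Ck_add.
Qed.

Lemma smooth_sum (W : normedModType R) U (I : Type) (r : seq I) (f : I -> V -> W) :
  open U -> (forall i, smooth_on U (f i)) ->
  smooth_on U (fun x => \sum_(i <- r) f i x).
Proof.
move=> oU sf; elim: r => [|i r IH].
  by under eq_fun do rewrite big_nil; exact: smooth_cst.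
by under eq_fun do rewrite big_cons; exact: smoothD.
Qed.

Lemma smoothM U (f g : V -> R) : open U ->
  smooth_on U f -> smooth_on U g -> smooth_on U (fun x => f x * g x).
Proof.
by move=> oU /smooth_onP sf /smooth_onP sg; apply/smooth_onP => k; exact: Ck_mul.
Qed.

Lemma smoothV U (f : V -> R) : open U -> (forall x, U x -> f x != 0) ->
  smooth_on U f -> smooth_on U (fun x => (f x)^-1).
Proof. by move=> oU f0 /smooth_onP sf; apply/smooth_onP => k; exact: Ck_inv. Qed.

Lemma smooth_sqrt U (f : V -> R) : open U -> (forall x, U x -> 0 < f x) ->
  smooth_on U f -> smooth_on U (fun x => Num.sqrt (f x)).
Proof. by move=> oU f0 /smooth_onP sf; apply/smooth_onP => k; exact: Ck_sqrt. Qed.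

Lemma smooth_div U (f g : V -> R) : open U -> (forall x, U x -> g x != 0) ->
  smooth_on U f -> smooth_on U g -> smooth_on U (fun x => f x / g x).
Proof. by move=> oU g0 sf sg; apply: smoothM => //; exact: smoothV. Qed.

Lemma smoothN U (f : V -> R) : open U -> smooth_on U f -> smooth_on U (fun x => - f x).
Proof.
move=> oU sf; have H := smoothM oU (smooth_cst U (-1 : R)) sf.
by apply: (smooth_ext oU _ H) => x _; rewrite mulN1r.
Qed.

Lemma smoothB U (f g : V -> R) : open U ->
  smooth_on U f -> smooth_on U g -> smooth_on U (fun x => f x - g x).
Proof. by move=> oU sf sg; apply: smoothD => //; exact: smoothN. Qed.

End SmoothAlgebra.

Section Components.
Context {R : realType} {V : normedModType R} {m : nat}.
Implicit Types (U : set V) (F G : V -> 'rV[R]_m).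

Lemma differentiable_coordP F x :
  differentiable F x <-> forall k, differentiable (fun y => F y 0 k) x.
Proof.
split=> [dF k|dF].
  apply: (@differentiable_comp _ _ _ _ F (fun y : 'rV[R]_m => y 0 k)) => //.
  exact: differentiable_coord.
rewrite (_ : F = \sum_(k < m) (fun y => F y 0 k *: delta_mx 0 k)).
  by apply: differentiable_sum => k; exact: differentiableZl.
by apply/funext => y; rewrite fct_sumE; exact: row_sum_delta.
Qed.

Lemma derive_coord F x v k : differentiable F x ->
  ('D_v F x) 0 k = 'D_v (fun y => F y 0 k) x.
Proof. by move=> /diff_derivable dF; rewrite derive_mx// mxE. Qed.

Lemma smooth_coordP U F : open U ->
  smooth_on U F <-> forall k, smooth_on U (fun y => F y 0 k).
Proof.
move=> oU; split=> [/smooth_onP sF k|sF].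
  apply/smooth_onP => j; move: (sF j) => {sF}; elim: j F => [|j IH] F /=.
    by move=> dF x /dF/differentiable_coordP.
  move=> [dF DF]; split=> [x Ux|v]; first by move: (dF x Ux) => /differentiable_coordP.
  apply: (Ck_ext oU _ (IH _ (DF v))) => x Ux.
  by rewrite derive_coord//; exact: dF.
have {}sF k : forall j, Ck j U (fun y => F y 0 k) by exact/smooth_onP.
apply/smooth_onP => j; have {}sF k := sF k j.
elim: j F sF => [|j IH] F sF.
  by move=> x Ux; apply/differentiable_coordP => k; exact: (sF k x Ux).
have dF x : U x -> differentiable F x.
  by move=> Ux; apply/differentiable_coordP => k; exact: (sF k).1.
split=> // v; apply: IH => k; apply: (Ck_ext oU _ ((sF k).2 v)) => x Ux.
by rewrite derive_coord//; exact: dF.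
Qed.

Lemma smoothZ U (a : V -> R) F : open U ->
  smooth_on U a -> smooth_on U F -> smooth_on U (fun x => a x *: F x).
Proof.
move=> oU sa /(smooth_coordP _ oU) sF; apply/(smooth_coordP _ oU) => k.
by under eq_fun do rewrite mxE; exact: smoothM.
Qed.

Lemma smooth_oppv U F : open U -> smooth_on U F -> smooth_on U (fun x => - F x).
Proof.
move=> oU sF; under eq_fun do rewrite -scaleN1r.
by apply: smoothZ => //; exact: smooth_cst.
Qed.

Lemma smooth_dotp U F G : open U ->
  smooth_on U F -> smooth_on U G -> smooth_on U (fun x => dotp (F x) (G x)).
Proof.
move=> oU /(smooth_coordP _ oU) sF /(smooth_coordP _ oU) sG.
by apply: smooth_sum => // k; exact: smoothM.
Qed.

Lemma differentiable_dotp F G x : differentiable F x -> differentiable G x ->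
  differentiable (fun y => dotp (F y) (G y)) x.
Proof.
move=> /differentiable_coordP dF /differentiable_coordP dG.
rewrite (_ : (fun y => _) = \sum_(k < m) (fun y => F y 0 k * G y 0 k)).
  by apply: differentiable_sum => k; exact: differentiableM.
by apply/funext => y; rewrite fct_sumE /dotp.
Qed.

Lemma derive_dotp F G x v : differentiable F x -> differentiable G x ->
  'D_v (fun y => dotp (F y) (G y)) x = dotp ('D_v F x) (G x) + dotp (F x) ('D_v G x).
Proof.
move=> dF dG.
have /differentiable_coordP dFk := dF; have /differentiable_coordP dGk := dG.
rewrite (_ : (fun y => _) = \sum_(k < m) (fun y => F y 0 k * G y 0 k)); last first.
  by apply/funext => y; rewrite fct_sumE /dotp.
rewrite derive_sum => [|k]; last exact/diff_derivable/differentiableM.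
rewrite -big_split; apply: eq_bigr => k _ /=.
rewrite deriveM; [|exact/diff_derivable/dFk|exact/diff_derivable/dGk].
by rewrite !derive_coord// addrC; congr (_ + _); exact: mulrC.
Qed.

Lemma differentiable_scale (a : V -> R) F x :
  differentiable a x -> differentiable F x ->
  differentiable (fun y => a y *: F y) x.
Proof.
move=> da /differentiable_coordP dF; apply/differentiable_coordP => k.
by under eq_fun do rewrite mxE; exact: differentiableM.
Qed.

Lemma derive_scale (a : V -> R) F x v :
  differentiable a x -> differentiable F x ->
  'D_v (fun y => a y *: F y) x = 'D_v a x *: F x + a x *: 'D_v F x.
Proof.
move=> da dF; have /differentiable_coordP dFk := dF; apply/rowP => k.
rewrite derive_coord; last exact: differentiable_scale.
under [X in 'D_v X x]eq_fun do rewrite mxE.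
rewrite deriveM; [|exact: diff_derivable|exact/diff_derivable/dFk].
by rewrite !mxE derive_coord// addrC; congr (_ + _); exact: mulrC.
Qed.

End Components.

(** * Restriction to lines; symmetry of second derivatives *)

Lemma Ck_scale_cst {R : realType} {V W : normedModType R} k (U : set V)
    (F : V -> W) (a : R) :
  open U -> Ck k U F -> Ck k U (fun x => a *: F x).
Proof.
move=> oU; elim: k F => [|k IH] F.
  by move=> dF x Ux; apply: differentiableZ; exact: dF.
move=> [dF DF]; split=> [x Ux|v]; first by apply: differentiableZ; exact: dF.
apply: (Ck_ext oU _ (IH _ (DF v))) => x Ux.
by rewrite deriveZ//; exact/diff_derivable/dF.
Qed.
Arguments Ck_scale_cst {R V W k U F} a.

Section Lines.
Context {R : realType} {V W : normedModType R}.
Implicit Types (F : V -> W) (u v : V) (s : R).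

Lemma is_diff_line u v s : is_diff s (fun t : R => u + t *: v) ( *:%R^~ v).
Proof.
have : is_diff s (cst u + ( *:%R^~ v)) (0 + *:%R^~ v) by exact: is_diffD.
by rewrite add0r.
Qed.

Lemma differentiable_line F u v s : differentiable F (u + s *: v) ->
  differentiable (fun t : R => F (u + t *: v)) s.
Proof.
move=> dF; have [dl _] := is_diff_line u v s.
exact: (@differentiable_comp _ _ _ _ (fun t : R => u + t *: v) F).
Qed.

Lemma derive_line F u v s w : differentiable F (u + s *: v) ->
  'D_w (fun t : R => F (u + t *: v)) s = w *: 'D_v F (u + s *: v).
Proof.
move=> dF; have [dl El] := is_diff_line u v s.
rewrite deriveE; last exact: differentiable_line.
rewrite (@diff_comp _ _ _ _ (fun t : R => u + t *: v) F)//=.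
by rewrite El linearZ/= deriveE.
Qed.

Lemma is_derive_line F u v s : differentiable F (u + s *: v) ->
  is_derive s 1 (fun t : R => F (u + t *: v)) ('D_v F (u + s *: v)).
Proof.
move=> dF; apply: DeriveDef; first exact/diff_derivable/differentiable_line.
by rewrite derive_line// scale1r.
Qed.

Lemma smooth_line F u v (U : set V) (I : set R) : open I ->
  (forall s, I s -> U (u + s *: v)) ->
  smooth_on U F -> smooth_on I (fun t : R => F (u + t *: v)).
Proof.
move=> oI IU /smooth_onP sF; apply/smooth_onP => k; move: (sF k) => {sF}.
elim: k F => [|k IH] F.
  by move=> dF s /IU Us; apply: differentiable_line; exact: dF.
move=> [dF DF]; split=> [s /IU Us|w]; first by apply: differentiable_line; exact: dF.
apply: (Ck_ext oI _ (Ck_scale_cst w oI (IH _ (DF v)))) => s /IU Us.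
by rewrite derive_line//; exact: dF.
Qed.

Lemma differentiable_shift F u v : differentiable F (u + v) ->
  differentiable (fun y => F (y + v)) u.
Proof.
move=> dF; apply: (@differentiable_comp _ _ _ _ (fun y => y + v) F) => //.
Qed.

Lemma derive_shiftE F u v w : 'D_w (fun y => F (y + v)) u = 'D_w F (u + v).
Proof.
rewrite /derive (_ : (fun h => _) = (fun h => h^-1 *: ((F \o shift (u + v)) (h *: w) - F (u + v))))//.
by apply/funext => h /=; rewrite addrA.
Qed.

Lemma convex_ball_norm u v c (r s : R) : 0 <= s <= 1 ->
  `|u - c| < r -> `|u + v - c| < r -> `|u + s *: v - c| < r.
Proof.
move=> /andP[s0 s1] ur vr.
have -> : u + s *: v - c = (1 - s) *: (u - c) + s *: (u + v - c).
  rewrite -[u + v - c]addrAC (scalerDr s (u - c)) addrA -scalerDl subrK scale1r.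
  by rewrite addrAC.
apply: le_lt_trans (ler_normD _ _) _; rewrite !normrZ (ger0_norm s0) ger0_norm ?subr_ge0//.
have [->|sn0] := eqVneq s 0; first by rewrite mul0r addr0 subr0 mul1r.
apply: (@le_lt_trans _ _ ((1 - s) * r + s * `|u + v - c|)).
  by rewrite lerD2r ler_wpM2l ?subr_ge0// ltW.
suff : (1 - s) * r + s * `|u + v - c| < (1 - s) * r + s * r.
  by rewrite -mulrDl subrK mul1r.
by rewrite ltrD2l ltr_pM2l// lt_neqAle eq_sym sn0.
Qed.

End Lines.

Section LinesScalar.
Context {R : realType} {V : normedModType R}.
Implicit Types (g : V -> R) (u v : V) (s : R).

Lemma line_MVT g u v :
  (forall s, 0 <= s <= 1 -> differentiable g (u + s *: v)) ->
  exists2 s, 0 < s < 1 & g (u + v) - g u = 'D_v g (u + s *: v).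
Proof.
move=> dg.
have [||s] := @MVT R (fun t : R => g (u + t *: v)) (fun t => 'D_v g (u + t *: v)) 0 1 ltr01.
- move=> s; rewrite in_itv/= => /andP[s0 s1]; apply: is_derive_line.
  by apply: dg; rewrite !ltW.
- apply: derivable_within_continuous => s; rewrite in_itv/= => s01.
  by apply/diff_derivable/differentiable_line/dg.
- rewrite in_itv/= => s01; rewrite scale1r scale0r addr0 subr0 mulr1 => E.
  by exists s.
Qed.

Lemma zero_derive_cst g c (r : R) :
  (forall x, `|x - c| < r -> differentiable g x) ->
  (forall x v, `|x - c| < r -> 'D_v g x = 0) ->
  forall x, `|x - c| < r -> g x = g c.
Proof.
move=> dg g0 x xr.
have r0 : 0 < r := le_lt_trans (normr_ge0 _) xr.
have B s : 0 <= s <= 1 -> `|c + s *: (x - c) - c| < r.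
  by move=> s01; apply: convex_ball_norm => //; rewrite ?subrr ?normr0// [c + _]addrC subrK.
have [|s /andP[s0 s1]] := @line_MVT g c (x - c); first by move=> s /B; exact: dg.
rewrite [c + (x - c)]addrC subrK g0; last by apply: B; rewrite !ltW.
by move/eqP; rewrite subr_eq0 => /eqP.
Qed.

(** Young's argument for the symmetry of second derivatives: the second
    difference is symmetric in the two directions, and its leading term is
    either mixed derivative. *)
Lemma second_difference (U : set V) (f : V -> R) x u v (e : R) :
  open U -> U x -> (forall y, U y -> differentiable f y) ->
  differentiable ('D_u f) x -> 0 < e ->
  \forall t \near 0^'+, `|f (x + t *: u + t *: v) - f (x + t *: u)
     - (f (x + t *: v) - f x) - t ^+ 2 * 'D_v ('D_u f) x| <= e * t ^+ 2.
Proof.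
move=> oU Ux df dDf e0.
pose C := `|u| + `|u| + `|v| + 1.
have C0 : 0 < C by rewrite ltr_wpDl// !addr_ge0.
have eC : 0 < e / (2 * C) by rewrite divr_gt0// mulr_gt0.
have /nbhs_norm0P[d d0 /= Hd] := differentiable_approxE dDf eC.
have /(nbhs0P U x).1/nbhs_norm0P[d' d'0 /= Hd'] : \near x, U x.
  exact: open_nbhs_nbhs.
near=> t.
have t0 : 0 < t by near: t; exact: nbhs_right_gt.
have tC : t * C < Num.min d d'.
  rewrite -ltr_pdivlMr//; near: t; apply: nbhs_right_lt.
  by rewrite divr_gt0// lt_min d0.
move: tC; rewrite lt_min => /andP[tCd tCd'].
have B s h : 0 <= s <= 1 -> 0 <= h <= 1 ->
    `|s *: (t *: u) + h *: (t *: v)| < t * C.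
  move=> /andP[s0 s1] /andP[h0 h1]; apply: le_lt_trans (ler_normD _ _) _.
  rewrite !normrZ (ger0_norm s0) (ger0_norm h0) (gtr0_norm t0).
  apply: (@le_lt_trans _ _ (t * `|u| + t * `|v|)).
    by rewrite lerD// ler_piMl// mulr_ge0// ltW.
  by rewrite -mulrDr ltr_pM2l// /C -!addrA ltrD2l ltr_wpDl// ltrDl.
(* The mean value theorem for the increment [G] in the direction [u] turns the
   second difference into a difference of two values of ['D_u f]. *)
pose G y := f (y + t *: v) - f y.
have inU h : `|h| < t * C -> U (x + h).
  by move=> hC; apply: Hd'; exact: lt_trans hC _.
have dG s : 0 <= s <= 1 -> differentiable G (x + s *: (t *: u)).
  move=> s01; apply: differentiableB.
    apply: differentiable_shift; apply: df; rewrite -addrA; apply: inU.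
    by rewrite -[t *: v]scale1r B ?ler01 ?lexx.
  apply: df; apply: inU.
  by have := B s 0 s01; rewrite scale0r addr0; apply; rewrite lexx ler01.
have [s /andP[s0 s1] E] := line_MVT dG.
have s01 : 0 <= s <= 1 by rewrite !ltW.
have z01 : 0 <= (0 : R) <= 1 by rewrite lexx ler01.
have o01 : 0 <= (1 : R) <= 1 by rewrite lexx ler01.
have Bs := B s 0 s01 z01; rewrite scale0r addr0 in Bs.
have Bst := B s 1 s01 o01; rewrite scale1r in Bst.
set h := s *: (t *: u) in E Bs Bst *.
have -> : f (x + t *: u + t *: v) - f (x + t *: u) - (f (x + t *: v) - f x)
    = G (x + t *: u) - G x by [].
have dh1 : differentiable f (x + h + t *: v) by apply: df; rewrite -addrA; exact: inU.
have dh2 : differentiable f (x + h) by apply: df; exact: inU.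
rewrite E deriveB; last 2 first.
- by apply/diff_derivable/differentiable_shift.
- exact: diff_derivable.
rewrite derive_shiftE !deriveZl//.
have H1 := Hd _ (lt_trans Bst tCd); have H2 := Hd _ (lt_trans Bs tCd).
rewrite deriveDl// [h + _ + x]addrC addrA (deriveZl t v dDf) in H1.
rewrite [h + x]addrC in H2.
set a := 'D_u f _ in H1 *; set b := 'D_u f (x + h) in H2 *.
set c := 'D_v _ _ in H1 *; set p := 'D_h _ _ in H1 H2.
set q := 'D_u f x in H1 H2.
have -> : t *: a - t *: b - t ^+ 2 * c
   = t * ((a - q - (p + t *: c)) - (b - q - p)).
  by rewrite -![_ *: _]/(_ * _); ring.
rewrite normrM (gtr0_norm t0) expr2 mulrCA ler_pM2l//.
apply: le_trans (ler_normB _ _) _; apply: le_trans (lerD H1 H2) _.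
rewrite -mulrDr -mulrA ler_pM2l// ler_pdivrMl ?mulr_gt0//.
rewrite -[2]/(1 + 1) mulrDl mulrDl !mul1r [C * t]mulrC.
by rewrite lerD// ltW.
Unshelve. all: by end_near. Qed.

Lemma derive_comm_scalar (U : set V) (f : V -> R) x u v :
  open U -> U x -> (forall y, U y -> differentiable f y) ->
  differentiable ('D_u f) x -> differentiable ('D_v f) x ->
  'D_v ('D_u f) x = 'D_u ('D_v f) x.
Proof.
move=> oU Ux df du dv; apply/eqP; rewrite -subr_eq0 -normr_le0.
apply/ler_addgt0Pl => e e0; rewrite addr0.
have e2 : 0 < e / 2 by rewrite divr_gt0.
have H1 := @second_difference U f x u v _ oU Ux df du e2.
have H2 := @second_difference U f x v u _ oU Ux df dv e2.
have [t [[h1 h2] t0]] := filter_ex (filterI (filterI H1 H2) (nbhs_right_gt 0)).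
have t20 : 0 < t ^+ 2 by rewrite exprn_gt0.
rewrite -(ler_pM2l t20) -[X in X * `|_|]gtr0_norm// -normrM.
move: h1 h2; rewrite [x + t *: v + _]addrAC.
set a := f (x + t *: u + t *: v); set b := f (x + t *: u); set c := f (x + t *: v).
set p := 'D_v _ x; set q := 'D_u _ x => h1 h2.
rewrite (_ : _ * (p - q) = (a - c - (b - f x) - t ^+ 2 * q) - (a - b - (c - f x) - t ^+ 2 * p)); last by ring.
apply: le_trans (ler_normB _ _) _; apply: le_trans (lerD h2 h1) _.
by rewrite -mulrDl -splitr mulrC.
Qed.

End LinesScalar.

Section SmoothVector.
Context {R : realType} {V : normedModType R} {m : nat}.
Implicit Types (U : set V) (F : V -> 'rV[R]_m).

Lemma derive_comm U F x u v : open U -> smooth_on U F -> U x ->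
  'D_v ('D_u F) x = 'D_u ('D_v F) x.
Proof.
move=> oU sF Ux.
have dF y : U y -> differentiable F y by exact: smooth_differentiable.
have sw w : smooth_on U ('D_w F) by exact: smooth_derive.
have dk k w : differentiable ('D_w (fun y => F y 0 k)) x.
  have sk := (smooth_coordP F oU).1 sF k.
  by apply: (smooth_differentiable (smooth_derive w sk)).
have E w z k : ('D_w ('D_z F) x) 0 k = 'D_w ('D_z (fun y => F y 0 k)) x.
  rewrite derive_coord; last exact: smooth_differentiable (sw z) Ux.
  by apply: (derive_ext_on _ oU _ Ux) => y Uy; rewrite derive_coord//; exact: dF.
apply/rowP => k.
apply: (etrans (E v u k)).
apply: (etrans _ (esym (E u v k))).
apply: (@derive_comm_scalar _ _ U) => // y Uy.
by have /differentiable_coordP := dF y Uy.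
Qed.

Lemma derive_comm1 U (f : V -> R) x u v : open U -> smooth_on U f -> U x ->
  'D_v ('D_u f) x = 'D_u ('D_v f) x.
Proof.
move=> oU sf Ux; apply: (derive_comm_scalar oU) => // [y Uy||].
- exact: smooth_differentiable Uy.
- exact: smooth_differentiable (smooth_derive u sf) Ux.
- exact: smooth_differentiable (smooth_derive v sf) Ux.
Qed.

Lemma zero_derive_cstv F c (r : R) :
  (forall x, `|x - c| < r -> differentiable F x) ->
  (forall x v, `|x - c| < r -> 'D_v F x = 0) ->
  forall x, `|x - c| < r -> F x = F c.
Proof.
move=> dF F0 x xr; apply/rowP => k.
apply: (@zero_derive_cst _ _ (fun y => F y 0 k) c r) => // y.
  by move/dF => /differentiable_coordP.
by move=> v yr; rewrite -derive_coord ?F0 ?mxE//; exact: dF.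
Qed.

End SmoothVector.

(** * Symmetric forms with one exceptional eigenvalue *)

Section Orthogonality.
Context {R : realType}.

(** A homogeneous linear system with fewer equations than unknowns. *)
Lemma orthogonal_vector n (s : seq 'rV[R]_n) : (size s < n)%N ->
  exists2 v : 'rV[R]_n, v != 0 & forall w, w \in s -> dotp v w = 0.
Proof.
move=> sn; pose A : 'M[R]_(size s, n) := \matrix_i s`_i.
have : kermx A^T != 0.
  rewrite -mxrank_eq0 mxrank_ker subn_eq0 -ltnNge.
  by rewrite (leq_ltn_trans _ sn)// mxrank_tr rank_leq_row.
move=> /rowV0Pn[v /sub_kermxP vA v0]; exists v => // w /(nthP 0)[i si <-].
have /rowP/(_ (Ordinal si)) := vA; rewrite !mxE => <-.
by apply: eq_bigr => k _; rewrite !mxE.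
Qed.

Lemma orthogonal_total m (E : 'I_m -> 'rV[R]_m) (w : 'rV[R]_m) :
  (forall i j, i != j -> dotp (E i) (E j) = 0) -> (forall i, E i != 0) ->
  (forall i, dotp w (E i) = 0) -> w = 0.
Proof.
move=> Eij E0 wE; pose A : 'M[R]_m := \matrix_i E i.
have AA : A *m A^T = diag_mx (\row_i dotp (E i) (E i)).
  apply/matrixP => i j; rewrite !mxE.
  rewrite (_ : \sum_k _ = dotp (E i) (E j)); last first.
    by apply: eq_bigr => k _; rewrite !mxE.
  by have [->|ij] := eqVneq i j; rewrite ?mulr1n// mulr0n Eij.
have uA : A^T \in unitmx.
  rewrite unitmx_tr unitmxE unitfE; apply/eqP => dA.
  have : \det (A *m A^T) == 0 by rewrite det_mulmx dA mul0r.
  rewrite AA det_diag => /prodf_eq0[i _]; rewrite mxE dotp_eq0.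
  by rewrite (negbTE (E0 i)).
rewrite -[w](mulmxK uA) (_ : w *m A^T = 0) ?mul0mx//.
apply/rowP => i; rewrite [RHS]mxE -[RHS](wE i) mxE.
by apply: eq_bigr => k _; rewrite !mxE.
Qed.

Lemma conformal_frame_expansion n (E : 'I_n -> 'rV[R]_n.+1) (nu : 'rV[R]_n.+1)
    (lam : R) (d : 'rV[R]_n.+1) :
  lam != 0 -> (forall i j, dotp (E i) (E j) = lam *+ (i == j)) ->
  dotp nu nu = 1 -> (forall i, dotp (E i) nu = 0) ->
  d = \sum_i (dotp d (E i) / lam) *: E i + dotp d nu *: nu.
Proof.
move=> l0 EE nn En; apply/eqP; rewrite -subr_eq0; apply/eqP.
pose E' (i : 'I_n.+1) := if unlift ord_max i is Some j then E j else nu.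
apply: (@orthogonal_total _ E') => [i j|i|i]; rewrite /E'.
- case: unliftP => [i'|] ->; case: unliftP => [j'|] -> //.
  + by rewrite (inj_eq lift_inj) EE => /negbTE ->.
  + by rewrite dotpC En.
  + by rewrite eqxx.
- case: unliftP => [i'|] _; rewrite -dotp_eq0 ?nn ?oner_eq0//.
  by rewrite EE eqxx.
- case: unliftP => [i'|] _; rewrite dotpBl dotpDl dotp_suml dotpZl.
  + rewrite [dotp nu _]dotpC En mulr0 addr0 (bigD1 i')//= big1 => [|j ji].
      by rewrite dotpZl EE eqxx addr0 mulfVK// subrr.
    by rewrite dotpZl EE (negbTE ji) mulr0.
  + rewrite big1 => [|j _]; first by rewrite nn mulr1 add0r subrr.
    by rewrite dotpZl En mulr0.
Qed.

End Orthogonality.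

Section NormRV.
Context {R : realType} {n : nat}.
Implicit Types x : 'rV[R]_n.

Lemma norm_coord_le x k : `|x 0 k| <= `|x|.
Proof. by rewrite [leRHS]/Num.Def.normr/= mx_normrE (le_bigmax _ _ (0, k)). Qed.

Lemma norm_row_le x r : 0 <= r -> (forall k, `|x 0 k| <= r) -> `|x| <= r.
Proof.
move=> r0 xr; rewrite [leLHS]/Num.Def.normr/= mx_normrE bigmax_le// => -[i k] _.
by rewrite ord1.
Qed.

Lemma sqr_norm_le_dotp x : `|x| ^+ 2 <= dotp x x.
Proof.
rewrite -[leRHS]sqr_sqrtr ?dotp_ge0// ler_sqr ?nnegrE ?sqrtr_ge0//.
apply: norm_row_le; first exact: sqrtr_ge0.
move=> k; rewrite -sqrtr_sqr ler_sqrt ?dotp_ge0// /dotp (bigD1 k)//= -expr2.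
by rewrite lerDl sumr_ge0// => j _; rewrite -expr2 sqr_ge0.
Qed.

Lemma dotp_norm_le x y : `|dotp x y| <= n%:R * (`|x| * `|y|).
Proof.
apply: le_trans (ler_norm_sum _ _ _) _.
rewrite -[X in X%:R]card_ord mulr_natl -sumr_const; apply: ler_sum => k _.
by rewrite normrM ler_pM// norm_coord_le.
Qed.

Lemma continuous_dotp_sqr (c : 'rV[R]_n) : continuous (fun x => dotp (x - c) (x - c)).
Proof.
move=> x; apply/differentiable_continuous/differentiable_dotp;
exact: differentiableB.
Qed.

End NormRV.

Section UmbilicAlgebra.
Context {R : realType} {n : nat}.
Implicit Types (S : 'M[R]_n) (x y z p q : 'rV[R]_n).

Definition bform S x y : R := dotp (x *m S) y.

Lemma bformDl S x y z : bform S (x + y) z = bform S x z + bform S y z.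
Proof. by rewrite /bform mulmxDl dotpDl. Qed.

Lemma bformDr S x y z : bform S z (x + y) = bform S z x + bform S z y.
Proof. by rewrite /bform dotpDr. Qed.

Lemma bformZl S a x y : bform S (a *: x) y = a * bform S x y.
Proof. by rewrite /bform -scalemxAl dotpZl. Qed.

Lemma bformZr S a x y : bform S x (a *: y) = a * bform S x y.
Proof. by rewrite /bform dotpZr. Qed.

Lemma bformNl S x y : bform S (- x) y = - bform S x y.
Proof. by rewrite -scaleN1r bformZl mulN1r. Qed.

Lemma bformNr S x y : bform S x (- y) = - bform S x y.
Proof. by rewrite -scaleN1r bformZr mulN1r. Qed.

Definition bformE := (bformDl, bformDr, bformZl, bformZr, bformNl, bformNr).

Lemma bform_delta S i j : bform S (delta_mx 0 i) (delta_mx 0 j) = S i j.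
Proof. by rewrite /bform dotp_deltar -rowE mxE. Qed.

Lemma bformC S x y : S^T = S -> bform S x y = bform S y x.
Proof.
move=> Ssym; suff : (bform S x y)%:M = (bform S y x)%:M :> 'M[R]_1.
  by move/matrixP/(_ 0 0); rewrite !mxE.
by rewrite -tr_scalar_mx /bform -!dotp_mx 2!trmx_mul trmxK Ssym mulmxA.
Qed.

Lemma continuous_bform S : continuous (fun x => bform S x x).
Proof.
pose L : {linear 'rV[R]_n -> 'rV[R]_n} := mulmxr S.
have dL x : differentiable (fun y : 'rV[R]_n => y *m S) x.
  apply/differentiable_coordP => k.
  under eq_fun do rewrite mxE.
  rewrite (_ : (fun y => _) = \sum_(j < n) (fun y : 'rV_n => y 0 j * S j k)).
    apply: differentiable_sum => j; apply: differentiableM => //.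
    exact: differentiable_coord.
  by apply/funext => y; rewrite fct_sumE.
by move=> x; apply/differentiable_continuous/differentiable_dotp.
Qed.

(** Compactness of the unit sphere; the homogeneous form of the inequality
    avoids normalising vectors later. *)
Lemma sphere_maximum S : (0 < n)%N ->
  exists2 p, dotp p p = 1 & forall x, bform S x x <= bform S p p * dotp x x.
Proof.
move=> n0; pose A : set 'rV[R]_n := [set x | dotp x x = 1].
have cA : compact A.
  apply: bounded_closed_compact.
    exists 1; split=> // r r1 x /= Ax; apply: le_trans (ltW r1).
    by rewrite -ler_sqr ?nnegrE// expr1n -Ax sqr_norm_le_dotp.
  rewrite (_ : A = (fun x => dotp (x - 0) (x - 0)) @^-1` [set 1]); last first.
    by apply/seteqP; split=> x /=; rewrite subr0.
  apply: preimage_closed; first by move=> x _; exact: continuous_dotp_sqr.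
  exact: closed_eq.
have A0 : A !=set0.
  by exists (delta_mx 0 (Ordinal n0)) => /=; rewrite /A/= dotp_deltal mxE !eqxx.
have [|p] := EVT_max_rV A0 cA (f := fun x => bform S x x).
  by apply: continuous_subspaceT => x; exact: continuous_bform.
rewrite inE => Ap pmax; exists p => // x.
have [->|x0] := eqVneq x 0; first by rewrite /bform !dotp0r mulr0.
have xx := dotp_gt0 x0; pose c := (Num.sqrt (dotp x x))^-1.
have cc : c ^+ 2 * dotp x x = 1.
  by rewrite exprVn sqr_sqrtr ?dotp_ge0// mulVf// gt_eqF.
have : bform S (c *: x) (c *: x) <= bform S p p.
  by apply: pmax; rewrite inE /A/= !dotpE mulrA -expr2.
rewrite !bformE mulrA -expr2 -(ler_pM2r xx) mulrAC cc mul1r//.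
Qed.

(** Along [p + t y] the non-negative function [M |x|^2 - S(x, x)] is a
    quadratic polynomial in [t] without constant term, so its linear coefficient
    vanishes. *)
Lemma sphere_maximum_eigen S p : S^T = S ->
  dotp p p = 1 -> (forall x, bform S x x <= bform S p p * dotp x x) ->
  forall y, bform S p y = bform S p p * dotp p y.
Proof.
move=> Ssym pp pmax y; set M := bform S p p in pmax *.
pose b := M * dotp p y - bform S p y; pose c := M * dotp y y - bform S y y.
have H t : 0 <= 2 * t * b + t ^+ 2 * c.
  have := pmax (p + t *: y); rewrite !bformE !dotpE -subr_ge0.
  rewrite (bformC y p)// (dotpC y p) pp -/M /b /c.
  by congr (0 <= _); ring.
suff : b = 0 by move=> /eqP; rewrite subr_eq0 => /eqP.
have c0 : 0 <= c by rewrite subr_ge0.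
apply/eqP; rewrite -sqrf_eq0 eq_le sqr_ge0 andbT.
(* The sign of the polynomial is violated at this [t] unless [b = 0]. *)
pose t := - b / (c + 1).
have c1 : 0 < c + 1 by rewrite ltr_wpDl.
have := H t; rewrite /t.
have -> : 2 * (- b / (c + 1)) * b + (- b / (c + 1)) ^+ 2 * c =
  - (b ^+ 2 * ((c + 2) / (c + 1) ^+ 2)) by field; rewrite gt_eqF.
rewrite oppr_ge0 pmulr_lle0// divr_gt0 ?exprn_gt0//.
by rewrite ltr_wpDl.
Qed.

Lemma sphere_minimum_eigen S : S^T = S -> (0 < n)%N ->
  exists q, [/\ dotp q q = 1, forall x, bform S q q * dotp x x <= bform S x x
    & forall y, bform S q y = bform S q q * dotp q y].
Proof.
move=> Ssym n0.
have N x y : bform (- S) x y = - bform S x y by rewrite /bform mulmxN dotpNl.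
have NSsym : (- S)^T = - S by rewrite linearN/= Ssym.
have [q qq qmax] := sphere_maximum (- S) n0.
exists q; split=> // [x|y].
  by have := qmax x; rewrite !N mulNr lerN2.
by have := sphere_maximum_eigen NSsym qq qmax y; rewrite !N mulNr => /oppr_inj.
Qed.

Definition pairwise_orthogonal4 (v1 v2 v3 v4 : 'rV[R]_n) : Prop :=
  [/\ dotp v1 v2 = 0, dotp v1 v3 = 0 & dotp v1 v4 = 0] /\
  [/\ dotp v2 v3 = 0, dotp v2 v4 = 0 & dotp v3 v4 = 0].

(** Two vectors [x] and [y] of the same length have orthogonal sum and
    difference, so that the form takes the same value at both; the predicate [K]
    stands for a subspace. *)
Lemma bform_scalar_on S (K : 'rV[R]_n -> Prop) (x0 : 'rV[R]_n) : S^T = S ->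
  (forall a x y, K x -> K y -> K (a *: x + y)) -> K x0 -> dotp x0 x0 = 1 ->
  (forall x y, K x -> K y -> dotp x y = 0 -> bform S x y = 0) ->
  forall x y, K x -> K y -> bform S x y = bform S x0 x0 * dotp x y.
Proof.
move=> Ssym KD Kx0 x00 S0; set a := bform S x0 x0.
have diag x : K x -> bform S x x = a * dotp x x.
  move=> Kx.
  have [t [z [Kz x0z ->]]] : exists t z, [/\ K z, dotp x0 z = 0 & x = t *: x0 + z].
    exists (dotp x x0), (- dotp x x0 *: x0 + x); split; first exact: KD.
      by rewrite !dotpE x00 mulr1 (dotpC x0) addNr.
    by rewrite scaleNr addrA subrr add0r.
  have zz : bform S z z = a * dotp z z.
    have [c cc] : exists c, c ^+ 2 = dotp z z.
      by exists (Num.sqrt (dotp z z)); rewrite sqr_sqrtr ?dotp_ge0.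
    have K1 : K (c *: x0 + z) by exact: KD.
    have K0 : K 0 by rewrite -(addNr x0) -scaleN1r; exact: KD.
    have K2 : K (c *: x0 - z).
      by apply: (KD) => //; rewrite -[- z]addr0 -scaleN1r; exact: KD.
    have := S0 _ _ K1 K2; rewrite !bformE !dotpE x00 x0z (dotpC z x0) x0z.
    rewrite (bformC z x0)// (S0 x0 z)// -/a -cc => H.
    have {H} : c * (c * a + - 0) + (c * 0 - bform S z z) = 0 by apply: H; ring.
    by move/eqP; rewrite oppr0 addr0 mulr0 add0r subr_eq0 => /eqP <-; ring.
  rewrite !bformE !dotpE x00 zz (bformC z x0)// (S0 x0 z)// (dotpC z x0) x0z -/a.
  ring.
move=> x y Kx Ky.
have Kxy : K (1 *: x + y) by exact: KD.
have := diag _ Kxy; rewrite scale1r !bformE !dotpE (bformC y x)// (dotpC y x) !diag//.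
lra.
Qed.

(** The algebraic core: the hypothesis on quadruples is what the Gauss equation
    says when the Weyl tensor vanishes, and it forces all eigenvalues but one to
    coincide. With [p] and [q] eigenvectors for the largest and the smallest
    eigenvalue, the quadruple [p + q, p - q, x, y] makes the form scalar on the
    complement of [p] and [q], and [p + x, p - x, q + y, q - y] makes one of the
    two extreme eigenvalues equal to that scalar. Such quadruples exist because
    the complement has dimension at least two. *)
Lemma quasi_umbilic_form S : (4 <= n)%N -> S^T = S ->
  (forall v1 v2 v3 v4, pairwise_orthogonal4 v1 v2 v3 v4 ->
     bform S v1 v2 * bform S v3 v4 = bform S v1 v3 * bform S v2 v4) ->
  exists a b p, dotp p p = 1 /\
    forall x y, bform S x y = a * dotp x y + b * (dotp x p * dotp y p).
Proof.
move=> n4 Ssym quad; have n0 : (0 < n)%N by exact: leq_trans n4.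
have [p pp pmax] := sphere_maximum S n0.
have pe := sphere_maximum_eigen Ssym pp pmax.
have [q [qq qmin qe]] := sphere_minimum_eigen Ssym n0.
set M := bform S p p in pmax pe; set m := bform S q q in qmin qe.
have [Mm|Mm] := eqVneq M m.
  exists M, 0, p; split=> // x y; rewrite mul0r addr0.
  have d z : bform S z z = M * dotp z z.
    by apply/eqP; rewrite eq_le pmax Mm qmin.
  have := d (x + y); rewrite !bformE !dotpE !d (bformC y x)// (dotpC y x).
  lra.
have pq : dotp p q = 0.
  have := pe q; rewrite (bformC p q)// qe (dotpC q p) => /eqP.
  by rewrite -subr_eq0 -mulrBl mulf_eq0 subr_eq0 eq_sym (negbTE Mm) => /eqP.
pose K x := dotp x p = 0 /\ dotp x q = 0.
have KD a x y : K x -> K y -> K (a *: x + y).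
  by move=> [xp xq] [yp yq]; split; rewrite !dotpE ?xp ?xq ?yp ?yq mulr0 addr0.
have unitK s : (size s < n.-2)%N ->
    exists x, [/\ K x, dotp x x = 1 & forall w, w \in s -> dotp x w = 0].
  move=> sn; have [|v v0 vs] := @orthogonal_vector R n [:: p, q & s].
    by move: sn => /=; lia.
  pose c := (Num.sqrt (dotp v v))^-1.
  have vv := dotp_gt0 v0.
  exists (c *: v); split.
  - by split; rewrite dotpZl vs ?mulr0// !inE eqxx ?orbT.
  - by rewrite !dotpE mulrA -expr2 exprVn sqr_sqrtr ?dotp_ge0// mulVf// gt_eqF.
  - by move=> w ws; rewrite dotpZl vs ?mulr0// !inE ws !orbT.
have n2 : (2 <= n.-2)%N by lia.
have [x0 [Kx0 x00 _]] := unitK [::] (leq_trans (isT : 0 < 2)%N n2).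
have [y0 [Ky0 y00 x0y]] := unitK [:: x0] n2.
have {x0y} x0y : dotp x0 y0 = 0 by rewrite dotpC x0y// inE.
have pK x : K x -> bform S p x = 0 by move=> [xp _]; rewrite pe dotpC xp mulr0.
have qK x : K x -> bform S q x = 0 by move=> [_ xq]; rewrite qe dotpC xq mulr0.
have S0 x y : K x -> K y -> dotp x y = 0 -> bform S x y = 0.
  move=> Kx Ky xy; have [xp xq] := Kx; have [yp yq] := Ky.
  have : bform S (p + q) (p - q) * bform S x y = bform S (p + q) x * bform S (p - q) y.
    apply: quad; split; split; rewrite ?dotpE ?(dotpC q p) ?pq ?pp ?qq
      ?(dotpC _ x) ?(dotpC _ y) ?xp ?xq ?yp ?yq ?(dotpC y x) ?xy//; ring.
  rewrite !bformE (bformC q p)// -/M -/m (pK x Kx) (qK x Kx) addr0 mul0r => /eqP.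
  rewrite mulf_eq0 => /orP[|/eqP//].
  by rewrite (_ : _ + _ = M - m) ?subr_eq0 ?(negbTE Mm)//; ring.
have SK := bform_scalar_on Ssym KD Kx0 x00 S0.
set a := bform S x0 x0 in SK.
have aMm : (M - a) * (m - a) = 0.
  have [x0p x0q] := Kx0; have [y0p y0q] := Ky0.
  have : bform S (p + x0) (p - x0) * bform S (q + y0) (q - y0) =
      bform S (p + x0) (q + y0) * bform S (p - x0) (q - y0).
    apply: quad; split; split; rewrite ?dotpE ?(dotpC q p) ?pq ?pp ?qq
      ?(dotpC _ x0) ?(dotpC _ y0) ?x0p ?x0q ?y0p ?y0q ?(dotpC y0 x0) ?x0y ?x00 ?y00//; ring.
  rewrite !bformE ?(bformC x0 p)// ?(bformC y0 q)// ?(bformC x0 q)// ?(pK _ Kx0) ?(pK _ Ky0) ?(qK _ Kx0) ?(qK _ Ky0).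
  rewrite -/M -/m !(SK _ _ Kx0)// !(SK _ _ Ky0)// (pe q) pq x00 y00 x0y => H.
  have {H} := H; rewrite ?mulr1 ?mulr0; lra.
have dec x y : bform S x y = a * dotp x y + (M - a) * (dotp x p * dotp y p)
    + (m - a) * (dotp x q * dotp y q).
  have split_ z : exists2 k, K k & z = dotp z p *: p + dotp z q *: q + k.
    exists (z - dotp z p *: p - dotp z q *: q); last by rewrite addrC (addrC (dotp z p *: p)) addrA !subrK.
    by split; rewrite !dotpE ?pp ?qq ?(dotpC q p) ?pq; ring.
  have [x' Kx' Ex] := split_ x; have [y' Ky' Ey] := split_ y.
  have [xp xq] := Kx'; have [yp yq] := Ky'.
  rewrite {1}Ex {1}Ey [in dotp x y]Ex [in dotp _ y]Ey.
  rewrite !bformE !dotpE (bformC x' p)// (bformC x' q)// (pK _ Kx') (pK _ Ky') (qK _ Kx') (qK _ Ky').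
  rewrite (bformC q p)// (pe q) (SK x' y')// ?pp ?qq ?(dotpC q p) ?pq -/M -/m.
  rewrite ?(dotpC p y') ?(dotpC q y') ?yp ?yq xp xq; ring.
move/eqP: aMm; rewrite mulf_eq0 => /orP[] /eqP E.
  by exists a, (m - a), q; split=> // x y; rewrite dec E mul0r addr0.
by exists a, (M - a), p; split=> // x y; rewrite dec E mul0r addr0.
Qed.

(** Testing on a vector orthogonal to both [s] and [t], which exists in
    dimension three, isolates the first coefficient. *)
Lemma quasi_umbilic_unique (g a b a' b' : R) (s t : 'rV[R]_n) : (3 <= n)%N ->
  g != 0 -> s != 0 -> t != 0 ->
  (forall v, a * (g * dotp v v) + b * dotp v s ^+ 2
           = a' * (g * dotp v v) + b' * dotp v t ^+ 2) ->
  a = a' /\ (b == 0) = (b' == 0).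
Proof.
move=> n3 g0 s0 t0 E.
have aa : a = a'.
  have [//|v v0 vst] := @orthogonal_vector R n [:: s; t].
  have := E v; rewrite (vst s) ?(vst t) ?inE ?eqxx ?orbT// expr0n !mulr0 !addr0.
  by apply: mulIf; rewrite mulf_neq0// gt_eqF// dotp_gt0.
split=> //; have {}E v : b * dotp v s ^+ 2 = b' * dotp v t ^+ 2.
  by have := E v; rewrite aa => /addrI.
apply/eqP/eqP => b0; [have /esym := E t|have := E s]; rewrite b0 mul0r => /eqP;
  by rewrite mulf_eq0 expf_eq0/= dotp_eq0 ?(negbTE s0) ?(negbTE t0) orbF => /eqP.
Qed.

End UmbilicAlgebra.

(** * Rules for the directional derivative *)

(** The directional derivative as an opaque operation: derivatives in different
    directions are to be distinguished by their directions, without comparing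
    the limits that define them, and only the rules below apply to it. *)
HB.lock Definition dd {R : realType} {V W : normedModType R} (v : V)
  (F : V -> W) (x : V) : W := 'D_v F x.

Section DirectionalRules.
Context {R : realType} {V : normedModType R}.
Implicit Types (U : set V) (v w : V).

Lemma ddE (W : normedModType R) v (F : V -> W) x : dd v F x = 'D_v F x.
Proof. by rewrite dd.unlock. Qed.

Lemma ddEf (W : normedModType R) v (F : V -> W) : dd v F = 'D_v F.
Proof. by apply/funext => x; rewrite ddE. Qed.

Lemma smooth_dd (W : normedModType R) U (F : V -> W) v :
  smooth_on U F -> smooth_on U (dd v F).
Proof. by move=> sF; rewrite ddEf; exact: smooth_derive. Qed.

Lemma dd_ext (W : normedModType R) U (F G : V -> W) v x : open U -> U x ->
  (forall y, U y -> F y = G y) -> dd v F x = dd v G x.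
Proof. by move=> oU Ux FG; rewrite !ddE; exact: derive_ext_on oU FG Ux. Qed.

Lemma dd_cst (W : normedModType R) v (c : W) x : dd v (fun=> c) x = 0.
Proof. by rewrite ddE derive_cst. Qed.

Lemma ddD (W : normedModType R) v (F G : V -> W) x :
  differentiable F x -> differentiable G x ->
  dd v (fun y => F y + G y) x = dd v F x + dd v G x.
Proof. by move=> dF dG; rewrite !ddE deriveD//; exact: diff_derivable. Qed.

Lemma ddM v (F G : V -> R) x : differentiable F x -> differentiable G x ->
  dd v (fun y => F y * G y) x = dd v F x * G x + F x * dd v G x.
Proof.
move=> dF dG; rewrite !ddE deriveM; [|exact: diff_derivable..].
by rewrite addrC; congr (_ + _); exact: mulrC.
Qed.

Lemma ddN (W : normedModType R) v (F : V -> W) x : differentiable F x ->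
  dd v (fun y => - F y) x = - dd v F x.
Proof. by move=> dF; rewrite !ddE deriveN//; exact: diff_derivable. Qed.

Lemma ddDl (W : normedModType R) (F : V -> W) x v w : differentiable F x ->
  dd (v + w) F x = dd v F x + dd w F x.
Proof. by move=> dF; rewrite !ddE deriveDl. Qed.

Lemma ddZl (W : normedModType R) (F : V -> W) x a v : differentiable F x ->
  dd (a *: v) F x = a *: dd v F x.
Proof. by move=> dF; rewrite !ddE deriveZl. Qed.

Lemma ddNl (W : normedModType R) (F : V -> W) x v : differentiable F x ->
  dd (- v) F x = - dd v F x.
Proof. by move=> dF; rewrite !ddE deriveNl. Qed.

Lemma dd_comm1 U (F : V -> R) x v w : open U -> smooth_on U F -> U x ->
  dd v (dd w F) x = dd w (dd v F) x.
Proof. by move=> oU sF Ux; rewrite !ddE !ddEf; exact: derive_comm1 oU sF Ux. Qed.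

Context {m : nat}.
Implicit Types (F G : V -> 'rV[R]_m).

Lemma dd_comm U F x v w : open U -> smooth_on U F -> U x ->
  dd v (dd w F) x = dd w (dd v F) x.
Proof. by move=> oU sF Ux; rewrite !ddE !ddEf; exact: derive_comm oU sF Ux. Qed.

Lemma dd_dotp v F G x : differentiable F x -> differentiable G x ->
  dd v (fun y => dotp (F y) (G y)) x = dotp (dd v F x) (G x) + dotp (F x) (dd v G x).
Proof. by move=> dF dG; rewrite !ddE; exact: derive_dotp. Qed.

Lemma dd_scale v (a : V -> R) F x : differentiable a x -> differentiable F x ->
  dd v (fun y => a y *: F y) x = dd v a x *: F x + a x *: dd v F x.
Proof. by move=> da dF; rewrite !ddE; exact: derive_scale. Qed.

Lemma dd_coord F x v k : differentiable F x ->
  (dd v F x) 0 k = dd v (fun y => F y 0 k) x.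
Proof. by move=> dF; rewrite !ddE; exact: derive_coord. Qed.

End DirectionalRules.

Section DirectionalRow.
Context {R : realType} {n : nat} {W : normedModType R}.

Lemma partialE m (F : 'rV[R]_n -> 'rV[R]_m) i u : partial i F u = dd (delta_mx 0 i) F u.
Proof. by rewrite ddE. Qed.

Lemma partialEf m (F : 'rV[R]_n -> 'rV[R]_m) i : partial i F = dd (delta_mx 0 i) F.
Proof. by rewrite ddEf. Qed.

Lemma dd_row_sum (F : 'rV[R]_n -> W) u v : differentiable F u ->
  dd v F u = \sum_i v 0 i *: dd (delta_mx 0 i) F u.
Proof.
move=> dF; rewrite {1}(row_sum_deltaE v) ddE derive_suml//.
by apply: eq_bigr => i _; rewrite deriveZl// ddE.
Qed.

End DirectionalRow.

(** * The Gauss equation in conformal coordinates *)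

Lemma open_preimage_on {R : realType} {V W : normedModType R} (U : set V)
    (F : V -> W) (O : set W) : open U -> (forall x, U x -> differentiable F x) ->
  open O -> open (U `&` F @^-1` O).
Proof.
move=> oU dF oO; rewrite openE => x [Ux Ox]; rewrite /interior.
apply: filterI; first exact: open_nbhs_nbhs.
by apply: (differentiable_continuous (dF x Ux)); exact: open_nbhs_nbhs.
Qed.

Lemma open_neq0 {R : realType} {V : normedModType R} (U : set V) (g : V -> R) :
  open U -> (forall x, U x -> differentiable g x) ->
  open (U `&` [set x | g x != 0]).
Proof.
move=> oU dg; apply: (open_preimage_on (O := [set y : R | y != 0]) oU dg).
exact: open_neq.
Qed.

Lemma open_gt0 {R : realType} {V : normedModType R} (U : set V) (g : V -> R) :
  open U -> (forall x, U x -> differentiable g x) ->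
  open (U `&` [set x | 0 < g x]).
Proof.
move=> oU dg; apply: (open_preimage_on (O := [set y : R | 0 < y]) oU dg).
exact: open_gt.
Qed.

Section ConformalChart.
Context {R : realType} {n : nat}.
Variables (U : set 'rV[R]_n) (f : 'rV[R]_n -> 'rV[R]_n.+1) (lam : 'rV[R]_n -> R).
Hypotheses (oU : open U) (sf : smooth_on U f).
Hypothesis metricE : forall u, U u -> metric f u = (lam u)%:M.
Hypothesis lam0 : forall u, U u -> 0 < lam u.
Implicit Types (u v w x y z : 'rV[R]_n).

Let df u : U u -> differentiable f u.
Proof. exact: smooth_differentiable. Qed.

Let sD v : smooth_on U (dd v f).
Proof. exact: smooth_dd. Qed.

Let dD v u : U u -> differentiable (dd v f) u.
Proof. by move=> Uu; exact: smooth_differentiable (sD v) Uu. Qed.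

Lemma dotp_tangent u v w : U u ->
  dotp (dd v f u) (dd w f u) = lam u * dotp v w.
Proof.
move=> Uu; rewrite !dd_row_sum; try exact: df.
rewrite dotp_suml mulr_sumr; apply: eq_bigr => i _.
rewrite dotpZl dotp_sumr (bigD1 i)//= big1 => [|j ji]; last first.
  have := metricE Uu => /matrixP/(_ i j); rewrite !mxE !partialE eq_sym (negbTE ji) => E.
  by rewrite dotpZr E mulr0.
have := metricE Uu => /matrixP/(_ i i); rewrite !mxE !partialE eqxx mulr1n => E.
by rewrite dotpZr E addr0; ring.
Qed.

Lemma smooth_conformal_factor : (0 < n)%N -> smooth_on U lam.
Proof.
move=> n0; pose e : 'rV[R]_n := delta_mx 0 (Ordinal n0).
apply: (smooth_ext oU _ (smooth_dotp oU (sD e) (sD e))) => u Uu.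
by rewrite dotp_tangent// dotp_deltal mxE !eqxx mulr1.
Qed.

(** Projecting a fixed normal vector at [u0] onto the normal lines gives a
    smooth normal field; conformality makes the projection explicit. *)
Lemma smooth_unit_normal u0 : (0 < n)%N -> U u0 ->
  exists2 U', [/\ open U', U' u0 & U' `<=` U] &
    exists2 nu, smooth_on U' nu & forall u, U' u -> unit_normal f u (nu u).
Proof.
move=> n0 Uu0.
have [|nu0 nu00 nu0P] := @orthogonal_vector R n.+1 [seq partial i f u0 | i : 'I_n].
  by rewrite size_map -cardE card_ord.
have sl := smooth_conformal_factor n0.
pose N u : 'rV[R]_n.+1 :=
  nu0 + - \sum_(i < n) (dotp nu0 (partial i f u) / lam u) *: partial i f u.
have sN : smooth_on U N.
  apply: smoothD => //; first exact: smooth_cst.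
  apply: smooth_oppv => //; apply: smooth_sum => // i.
  apply: smoothZ => //; last by rewrite partialEf; exact: sD.
  apply: smooth_div => // [u Uu|]; first by rewrite gt_eqF// lam0.
  by apply: smooth_dotp => //; [exact: smooth_cst|rewrite partialEf; exact: sD].
have NE u j : U u -> dotp (partial j f u) (N u) = 0.
  move=> Uu; rewrite /N dotpBr dotp_sumr (bigD1 j)//= big1 => [|i ij].
    rewrite dotpZr !partialE dotp_tangent// dotp_deltal mxE !eqxx mulr1 addr0.
    by rewrite mulfVK ?gt_eqF ?lam0// dotpC subrr.
  rewrite dotpZr !partialE dotp_tangent// dotp_deltal mxE eqxx/=.
  by rewrite eq_sym (negbTE ij) !mulr0.
have Nu0 : N u0 = nu0.
  rewrite /N big1 ?subr0// => i _; rewrite nu0P ?mul0r ?scale0r//.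
  by apply/mapP; exists i => //; rewrite mem_enum.
have sNN : smooth_on U (fun u => dotp (N u) (N u)) by exact: smooth_dotp.
pose U' := U `&` [set u | 0 < dotp (N u) (N u)].
have oU' : open U' by apply: open_gt0 => // u Uu; exact: smooth_differentiable sNN Uu.
have U'U : U' `<=` U by move=> u [].
exists U'; first by split=> //; split=> //=; rewrite Nu0 dotp_gt0.
exists (fun u => (Num.sqrt (dotp (N u) (N u)))^-1 *: N u).
  apply: smoothZ => //; last exact: smooth_sub U'U sN.
  apply: smoothV => // [u [_ Nu]|]; first by rewrite gt_eqF// sqrtr_gt0.
  apply: smooth_sqrt => // [u [_ Nu]//|]; exact: smooth_sub U'U sNN.
move=> u [Uu Nu]; split=> [|i]; last by rewrite dotpZr NE// mulr0.
by rewrite dotpZl dotpZr mulrA -expr2 exprVn sqr_sqrtr ?dotp_ge0// mulVf// gt_eqF//.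
Qed.

Section Point.
Variables (u : 'rV[R]_n) (nu : 'rV[R]_n.+1).
Hypotheses (Uu : U u) (nuP : unit_normal f u nu).

Let S := second_form f u nu.

Lemma dotp_tangent_normal v : dotp (dd v f u) nu = 0.
Proof.
rewrite dd_row_sum; last exact: df.
by rewrite dotp_suml big1// => i _; rewrite dotpZl -partialE nuP.2 mulr0.
Qed.

Lemma second_form_sym : S^T = S.
Proof.
apply/matrixP => i j; rewrite mxE /S [LHS]mxE [RHS]mxE !partialEf.
by rewrite (dd_comm (delta_mx 0 i) (delta_mx 0 j) oU sf Uu).
Qed.

Lemma bform_second_form v w : bform S v w = dotp (dd v (dd w f) u) nu.
Proof.
have L v' w' : dotp (dd v' (dd w' f) u) nu
    = \sum_i v' 0 i * dotp (dd (delta_mx 0 i) (dd w' f) u) nu.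
  rewrite dd_row_sum; last exact: dD.
  by rewrite dotp_suml; apply: eq_bigr => i _; rewrite dotpZl.
rewrite L bformC ?second_form_sym// /bform /dotp.
apply: eq_bigr => i _; rewrite mulrC; congr (_ * _).
rewrite -/(dotp _ _) (dd_comm (delta_mx 0 i) w oU sf Uu) L mxE.
by apply: eq_bigr => j _; rewrite mxE !partialEf.
Qed.

Definition tangent_part (d : 'rV[R]_n.+1) : 'rV[R]_n :=
  \row_i (dotp d (partial i f u) / lam u).

(** The frame [partial i f u] is conformal, so that the tangential components
    are scalar products divided by [lam]. *)
Lemma tangent_partP d : d = dd (tangent_part d) f u + dotp d nu *: nu.
Proof.
rewrite dd_row_sum; last exact: df.
rewrite {1}(@conformal_frame_expansion _ _ (fun i => partial i f u) nu (lam u) d).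
- by congr (_ + _); apply: eq_bigr => i _; rewrite mxE partialE.
- by rewrite gt_eqF// lam0.
- move=> i j; rewrite !partialE dotp_tangent// dotp_deltal mxE eqxx/=.
  by rewrite mulr_natr eq_sym.
- exact: nuP.1.
- exact: nuP.2.
Qed.

Lemma dotp_tangent_part d v : dotp d (dd v f u) = lam u * dotp (tangent_part d) v.
Proof.
rewrite {1}(tangent_partP d) dotpDl dotp_tangent// dotpZl dotpC.
by rewrite (dotpC nu) dotp_tangent_normal mulr0 addr0 dotpC.
Qed.

Lemma dotp_tangent_split d e :
  dotp d e = lam u * dotp (tangent_part d) (tangent_part e) + dotp d nu * dotp e nu.
Proof.
rewrite {1}(tangent_partP e) dotpDr dotpZr dotp_tangent_part; ring.
Qed.

(** Koszul's formula: the products [<d_x d_y f, d_z f>] are determined by the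
    derivatives of the metric, which here is [lam] times a constant form. *)
Lemma koszul x y z : (0 < n)%N -> dotp (dd x (dd y f) u) (dd z f u) =
  2^-1 * (dd x lam u * dotp y z + dd y lam u * dotp x z - dd z lam u * dotp x y).
Proof.
move=> n0; have sl := smooth_conformal_factor n0.
have dl : differentiable lam u := smooth_differentiable sl Uu.
have H a b c : dd a lam u * dotp b c =
    dotp (dd a (dd b f) u) (dd c f u) + dotp (dd a (dd c f) u) (dd b f u).
  rewrite (dotpC (dd a (dd c f) u)).
  rewrite -dd_dotp; [|exact: dD..].
  rewrite (dd_ext (F := fun v => dotp (dd b f v) (dd c f v)) (G := fun v => lam v * dotp b c) _ oU Uu) => [|v Uv].
    by rewrite ddM// ?dd_cst ?mulr0 ?addr0.
  exact: dotp_tangent.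
rewrite (H x y z) (H y x z) (H z x y).
rewrite (dd_comm y x oU sf Uu) (dd_comm z x oU sf Uu) (dd_comm z y oU sf Uu).
by field.
Qed.

End Point.

(** Gauss equation: a conformally flat metric has no curvature on orthogonal
    quadruples, and there the curvature is a minor of the second form. The
    vanishing product [<d_2 d_1 f, d_4 f>] is differentiated along [v3], the
    vanishing product [<d_3 d_1 f, d_4 f>] along [v2], and the third derivatives
    of [f] cancel in the difference. *)
Lemma gauss_quadruple u nu v1 v2 v3 v4 : (0 < n)%N -> U u -> unit_normal f u nu ->
  pairwise_orthogonal4 v1 v2 v3 v4 ->
  let S := second_form f u nu in
  bform S v1 v2 * bform S v3 v4 = bform S v1 v3 * bform S v2 v4.
Proof.
move=> n0 Uu nuP [ [h12 h13 h14] [h23 h24 h34]] S.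
have K0 x y z u' : U u' -> dotp x y = 0 -> dotp y z = 0 -> dotp x z = 0 ->
    dotp (dd x (dd y f) u') (dd z f u') = 0.
  by move=> Uu' xy yz xz; rewrite koszul// xy yz xz; ring.
have DK x y z w : dotp x y = 0 -> dotp y z = 0 -> dotp x z = 0 ->
    dotp (dd w (dd x (dd y f)) u) (dd z f u) +
    dotp (dd x (dd y f) u) (dd w (dd z f) u) = 0.
  move=> xy yz xz.
  have dxy := smooth_differentiable (smooth_dd x (sD y)) Uu.
  rewrite -dd_dotp//; last exact: dD.
  by rewrite (dd_ext (F := fun v => dotp (dd x (dd y f) v) (dd z f v)) (G := fun=> 0) _ oU Uu) ?dd_cst// => v Uv; exact: K0.
have E : dotp (dd v2 (dd v1 f) u) (dd v3 (dd v4 f) u) =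
         dotp (dd v3 (dd v1 f) u) (dd v2 (dd v4 f) u).
  have h21 : dotp v2 v1 = 0 by rewrite dotpC.
  have h31 : dotp v3 v1 = 0 by rewrite dotpC.
  have H1 := DK v2 v1 v4 v3 h21 h14 h24.
  have H2 := DK v3 v1 v4 v2 h31 h14 h34.
  move: H1 H2; rewrite (dd_comm v2 v3 oU (sD v1) Uu).
  by move=> H1 H2; apply: (addrI (dotp (dd v3 (dd v2 (dd v1 f)) u) (dd v4 f u))); rewrite H1 H2.
(* The tangential part of a mixed second derivative in orthogonal directions
   is a combination of these directions, hence drops out for a quadruple. *)
have T x y : dotp x y = 0 -> tangent_part u (dd x (dd y f) u) =
    (2 * lam u)^-1 *: (dd x lam u *: y + dd y lam u *: x).
  move=> xy; apply: dotp_inj => z.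
  have l0 := lam0 Uu; apply: (mulfI (lt0r_neq0 l0)).
  rewrite -(dotp_tangent_part Uu nuP) koszul// xy !dotpE.
  by field; rewrite gt_eqF.
have TT x y z w : pairwise_orthogonal4 x y z w ->
  dotp (dd x (dd y f) u) (dd z (dd w f) u) = bform S x y * bform S z w.
  move=> [ [xy xz xw] [yz yw zw]].
  rewrite (dotp_tangent_split Uu nuP) !T// !bform_second_form//.
  by rewrite !dotpE xz xw yz yw; ring.
move: E; rewrite !TT; last 2 first.
- by split; split=> //; rewrite dotpC.
- by split; split=> //; rewrite dotpC.
have SS := second_form_sym nu Uu.
by rewrite (bformC v2 v1 SS) (bformC v3 v1 SS).
Qed.

Lemma quasi_umbilicP u nu a b eta : U u -> unit_normal f u nu ->
  quasi_umbilic f u nu a b eta <->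
  dotp eta eta = lam u /\ forall v w, bform (second_form f u nu) v w =
     a * (lam u * dotp v w) + b * (dotp v eta * dotp w eta).
Proof.
move=> Uu nuP; have l0 : lam u != 0 by rewrite gt_eqF// lam0.
have cov : unit_covector f u eta <-> dotp eta eta = lam u.
  rewrite /unit_covector metricE// invmx_scalar mul_mx_scalar -scalemxAl dotp_mx.
  rewrite scale_scalar_mx; split=> [/matrixP/(_ 0 0)|->]; last by rewrite mulVf.
  by rewrite !mxE !mulr1n => E; rewrite -[LHS](mulVKf l0) E mulr1.
have frm : second_form f u nu = a *: metric f u + b *: (eta^T *m eta) <->
    forall v w, bform (second_form f u nu) v w =
     a * (lam u * dotp v w) + b * (dotp v eta * dotp w eta).
  split=> [-> v w|H].
    rewrite /bform metricE// mulmxDr -!scalemxAr mul_mx_scalar mulmxA dotp_mx.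
    by rewrite mul_scalar_mx !dotpE (dotpC eta).
  apply/matrixP => i j; rewrite -bform_delta H metricE// !dotp_deltal !mxE eqxx/=.
  by rewrite big_ord1 !mxE mulr_natr eq_sym.
by split=> [[_ /cov ? /frm]//|[/cov ? /frm ?]]; split.
Qed.

Lemma quasi_umbilic_exists u nu : (4 <= n)%N -> U u -> unit_normal f u nu ->
  exists a b eta, quasi_umbilic f u nu a b eta.
Proof.
move=> n4 Uu nuP; have n0 : (0 < n)%N by exact: leq_trans n4.
have [a [b [p [pp H]]]] := quasi_umbilic_form n4 (second_form_sym nu Uu)
  (fun v1 v2 v3 v4 => gauss_quadruple n0 Uu nuP).
have l0 := lam0 Uu; have ss : Num.sqrt (lam u) ^+ 2 = lam u by rewrite sqr_sqrtr// ltW.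
exists (a / lam u), (b / lam u), (Num.sqrt (lam u) *: p); apply/quasi_umbilicP => //.
split=> [|v w]; first by rewrite !dotpE pp mulr1 -expr2.
rewrite H !dotpE [X in _ = _ + _ * X]mulrACA -expr2 ss.
by field; rewrite gt_eqF.
Qed.

End ConformalChart.

(** * Smoothness of the two principal curvatures *)

Section SmoothMatrix.
Context {R : realType} {V : normedModType R} {n : nat}.
Variable (U : set V).
Hypothesis oU : open U.

Lemma smooth_mulmx (A B : V -> 'M[R]_n) :
  (forall i j, smooth_on U (fun u => A u i j)) ->
  (forall i j, smooth_on U (fun u => B u i j)) ->
  forall i j, smooth_on U (fun u => (A u *m B u) i j).
Proof.
move=> sA sB i j; under eq_fun do rewrite mxE.
by apply: smooth_sum => // k; exact: smoothM.
Qed.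

Lemma smooth_mxtrace (A : V -> 'M[R]_n) :
  (forall i j, smooth_on U (fun u => A u i j)) -> smooth_on U (fun u => \tr (A u)).
Proof. by move=> sA; apply: smooth_sum => // i; exact: sA. Qed.

End SmoothMatrix.

Section Invariants.
Context {R : realType} {n : nat}.
Implicit Types A : 'M[R]_n.

Definition traceless A : 'M[R]_n := A - (\tr A / n%:R)%:M.

(** For [A = a + b q^T q] with [q] a unit row these two rational expressions
    recover [b] and [a]: the traceless part [T] of [A] satisfies
    [tr T^3 = (1 - 2 / n) b tr T^2]. Being rational in the entries of [A], they
    are smooth functions of a smooth matrix wherever [tr T^2] does not vanish;
    at the other points the quotient is [0], which is the right value. *)
Definition simple_part A : R :=
  \tr (traceless A *m traceless A *m traceless A)
    / \tr (traceless A *m traceless A) / (1 - 2 / n%:R).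

Definition double_part A : R := (\tr A - simple_part A) / n%:R.

Lemma invariant_parts A (a b : R) (q : 'rV[R]_n) : (3 <= n)%N -> dotp q q = 1 ->
  A = a%:M + b *: (q^T *m q) ->
  [/\ double_part A = a, simple_part A = b
    & (\tr (traceless A *m traceless A) == 0) = (b == 0)].
Proof.
move=> n3 qq EA; pose Q := q^T *m q.
have QQ : Q *m Q = Q.
  by rewrite /Q mulmxA -(mulmxA _ q) dotp_mx qq mulmx1.
have trQ : \tr Q = 1 by rewrite /Q mxtrace_mulC dotp_mx qq mxtrace1.
have n0 : n%:R != 0 :> R by rewrite pnatr_eq0; lia.
have n1 : n%:R - 1 != 0 :> R by rewrite subr_eq0 -[X in _ == X]/(1%:R) eqr_nat; lia.
have n2 : n%:R - 2 != 0 :> R by rewrite subr_eq0 eqr_nat; lia.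
have trA : \tr A = n%:R * a + b.
  by rewrite EA mxtraceD mxtraceZ mxtrace_scalar -/Q trQ mulr1 mulr_natl.
pose c : R := n%:R^-1; pose P := Q - c%:M.
have ET : traceless A = b *: P.
  rewrite /traceless trA EA -/Q scalerBr scale_scalar_mx (addrC a%:M) -addrA.
  congr (_ + _); rewrite -raddfB/= -raddfN/=; congr (_ %:M).
  by rewrite /c; field.
have PP : P *m P = (1 - 2 * c) *: Q + (c ^+ 2)%:M.
  rewrite /P mulmxBl !mulmxBr QQ mul_scalar_mx mul_mx_scalar -scalar_mxM.
  apply/matrixP => i j; rewrite !mxE; ring.
have QP : Q *m P = (1 - c) *: Q.
  by rewrite /P mulmxBr QQ mul_mx_scalar scalerBl scale1r.
have nc : n%:R * c = 1 by rewrite /c mulfV.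
have trP : \tr P = 0 by rewrite /P raddfB/= mxtrace_scalar trQ -[_ *+ n]mulr_natl nc subrr.
have trPP : \tr (P *m P) = 1 - c.
  rewrite PP mxtraceD mxtraceZ mxtrace_scalar trQ -[_ *+ n]mulr_natl.
  by rewrite expr2 mulrA nc; ring.
have trPPP : \tr (P *m P *m P) = (1 - 2 * c) * (1 - c).
  rewrite PP mulmxDl mxtraceD -scalemxAl QP mul_scalar_mx !mxtraceZ trQ trP.
  by ring.
have tr2 : \tr (traceless A *m traceless A) = b ^+ 2 * (1 - c).
  by rewrite ET -scalemxAl -scalemxAr !mxtraceZ trPP; ring.
have tr3 : \tr (traceless A *m traceless A *m traceless A)
    = b ^+ 3 * ((1 - 2 * c) * (1 - c)).
  by rewrite ET -!(scalemxAl, scalemxAr) !mxtraceZ trPPP; ring.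
have c1 : 1 - c != 0.
  have E : n%:R * (1 - c) = n%:R - 1 by rewrite mulrBr nc mulr1.
  by apply: contraNneq n1 => c1; rewrite -E c1 mulr0.
have c2 : 1 - 2 * c != 0.
  have E : n%:R * (1 - 2 * c) = n%:R - 2 by rewrite mulrBr mulrCA nc !mulr1.
  by apply: contraNneq n2 => c2; rewrite -E c2 mulr0.
have sp : simple_part A = b.
  rewrite /simple_part tr3 tr2 -/c.
  have [->|b0] := eqVneq b 0; first by rewrite !expr0n/= !mul0r.
  by field; rewrite b0 c1 c2.
split=> //; last by rewrite tr2 mulf_eq0 (negbTE c1) orbF sqrf_eq0.
by rewrite /double_part sp trA addrK; field.
Qed.

End Invariants.

Section Coefficients.
Context {R : realType} {n : nat}.
Variables (U : set 'rV[R]_n) (f : 'rV[R]_n -> 'rV[R]_n.+1) (lam : 'rV[R]_n -> R).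
Variable (nu : 'rV[R]_n -> 'rV[R]_n.+1).
Hypotheses (n4 : (4 <= n)%N) (oU : open U) (sf : smooth_on U f).
Hypothesis metricE : forall u, U u -> metric f u = (lam u)%:M.
Hypothesis lam0 : forall u, U u -> 0 < lam u.
Hypotheses (snu : smooth_on U nu) (nuP : forall u, U u -> unit_normal f u (nu u)).

Let n0 : (0 < n)%N. Proof. exact: leq_trans n4. Qed.
Let sl : smooth_on U lam. Proof. exact: (smooth_conformal_factor oU sf metricE). Qed.

(** The second form in an orthonormal frame: its eigenvalues are the principal
    curvatures, [umbilic_coeff] the multiple one and [ridge_coeff] the excess of
    the simple one. *)
Definition shape u : 'M[R]_n := (lam u)^-1 *: second_form f u (nu u).
Definition umbilic_coeff u : R := double_part (shape u).
Definition ridge_coeff u : R := simple_part (shape u).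

Lemma smooth_shape i j : smooth_on U (fun u => shape u i j).
Proof.
have E u : shape u i j = (lam u)^-1 * dotp (dd (delta_mx 0 i) (dd (delta_mx 0 j) f) u) (nu u).
  by rewrite !mxE !partialEf.
under eq_fun do rewrite E; apply: smoothM => //.
  by apply: smoothV => // u Uu; rewrite gt_eqF// lam0.
by apply: smooth_dotp => //; do 2!apply: smooth_dd.
Qed.

Lemma smooth_traceless i j : smooth_on U (fun u => traceless (shape u) i j).
Proof.
have E u : traceless (shape u) i j = shape u i j + - (n%:R^-1 * (i == j)%:R) * \tr (shape u).
  rewrite !mxE -mulr_natr; ring.
under eq_fun do rewrite E; apply: smoothD => //; first exact: smooth_shape.
apply: smoothM => //; first exact: smooth_cst.
by apply: smooth_mxtrace => //; exact: smooth_shape.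
Qed.

Lemma shape_quasi_umbilic u a b eta : U u -> quasi_umbilic f u (nu u) a b eta ->
  exists q, [/\ dotp q q = 1, eta = Num.sqrt (lam u) *: q
    & shape u = a%:M + b *: (q^T *m q)].
Proof.
move=> Uu /(quasi_umbilicP metricE lam0 _ _ _ Uu (nuP Uu))[ee H].
have l0 := lam0 Uu; have l00 : lam u != 0 by rewrite gt_eqF.
pose s := Num.sqrt (lam u); have ss : s ^+ 2 = lam u by rewrite sqr_sqrtr// ltW.
have s0 : s != 0 by rewrite gt_eqF// sqrtr_gt0.
exists (s^-1 *: eta); split.
- by rewrite !dotpE ee mulrA -expr2 exprVn ss mulVf.
- by rewrite scalerA mulfV// scale1r.
- apply/matrixP => i j; rewrite /shape mxE -(bform_delta (second_form f u (nu u)) i j) H !dotp_deltal !mxE eqxx/=.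
  rewrite big_ord1 !mxE -mulr_natr eq_sym -ss; field.
  by rewrite s0.
Qed.

Lemma quasi_umbilic_coeffs u a b eta : U u -> quasi_umbilic f u (nu u) a b eta ->
  a = umbilic_coeff u /\ b = ridge_coeff u.
Proof.
move=> Uu /(shape_quasi_umbilic Uu)[q [qq _ Eq]].
by have [Ea Eb _] := invariant_parts (ltnW n4) qq Eq; split.
Qed.

(** The left-hand side, unlike [ridge_coeff], is smooth everywhere, which makes
    the set of non-umbilic points open. *)
Lemma ridge_coeff_eq0 u : U u ->
  (\tr (traceless (shape u) *m traceless (shape u)) == 0) = (ridge_coeff u == 0).
Proof.
move=> Uu; have [a [b [eta]]] := quasi_umbilic_exists oU sf metricE lam0 n4 Uu (nuP Uu).
move=> /(shape_quasi_umbilic Uu)[q [qq _ Eq]].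
by have [_ E1 ->] := invariant_parts (ltnW n4) qq Eq; rewrite /ridge_coeff E1.
Qed.

Let tr2 u := \tr (traceless (shape u) *m traceless (shape u)).

Lemma smooth_tr2 : smooth_on U tr2.
Proof.
apply: smooth_mxtrace => //; apply: smooth_mulmx => //; exact: smooth_traceless.
Qed.

Lemma open_ridge : open (U `&` [set u | ridge_coeff u != 0]).
Proof.
rewrite (_ : _ `&` _ = U `&` [set u | tr2 u != 0]).
  by apply: open_neq0 => // u Uu; exact: smooth_differentiable smooth_tr2 Uu.
by apply/seteqP; split=> u [Uu] /=; rewrite ridge_coeff_eq0.
Qed.

Lemma smooth_ridge_coeff U' : open U' -> U' `<=` U ->
  (forall u, U' u -> ridge_coeff u != 0) -> smooth_on U' ridge_coeff.
Proof.
move=> oU' U'U b0; apply: smooth_div => //; last exact: smooth_cst.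
  move=> u _; apply/eqP => /eqP; rewrite subr_eq0 => /eqP.
  have nn : n%:R != 0 :> R by rewrite pnatr_eq0; lia.
  move=> /(congr1 ( *%R n%:R)); rewrite mulr1 mulrCA mulfV// mulr1 => /eqP.
  by rewrite eqr_nat; lia.
apply: smooth_div => //.
- by move=> u U'u; rewrite ridge_coeff_eq0 ?b0//; exact: U'U.
- apply: (smooth_sub U'U); apply: smooth_mxtrace => //; apply: smooth_mulmx => //.
    by apply: smooth_mulmx => //; exact: smooth_traceless.
  exact: smooth_traceless.
- exact: (smooth_sub U'U smooth_tr2).
Qed.

Lemma smooth_umbilic_coeff U' : open U' -> U' `<=` U ->
  smooth_on U' ridge_coeff -> smooth_on U' umbilic_coeff.
Proof.
move=> oU' U'U sb; apply: smoothM => //; last exact: smooth_cst.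
apply: smoothB => //; apply: (smooth_sub U'U).
by apply: smooth_mxtrace => //; exact: smooth_shape.
Qed.

(** The projector on the simple eigendirection is smooth, and any of its
    non-vanishing columns, once normalised, is a smooth unit covector. *)
Lemma quasi_umbilic_on_ridge u0 : U u0 -> ridge_coeff u0 != 0 ->
  exists U' eta, [/\ open U', U' u0, U' `<=` U,
    quasi_umbilic_on U' f nu umbilic_coeff ridge_coeff eta
    & forall u, U' u -> ridge_coeff u != 0].
Proof.
move=> Uu0 b0; pose U1 := U `&` [set u | ridge_coeff u != 0].
have oU1 : open U1 := open_ridge.
have U1U : U1 `<=` U by move=> u [].
have sb : smooth_on U1 ridge_coeff by apply: (smooth_ridge_coeff oU1 U1U) => u [].
have sa : smooth_on U1 umbilic_coeff by exact: smooth_umbilic_coeff.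
pose Q i j u := (shape u i j - (i == j)%:R * umbilic_coeff u) / ridge_coeff u.
have sQ i j : smooth_on U1 (Q i j).
  apply: (smooth_div oU1 _ _ sb) => [u []//|]; apply: (smoothB oU1).
    exact: (smooth_sub U1U (smooth_shape i j)).
  by apply: smoothM => //; exact: smooth_cst.
have ex u : U1 u -> exists q, [/\ dotp q q = 1, forall i j, Q i j u = q 0 i * q 0 j
    & quasi_umbilic f u (nu u) (umbilic_coeff u) (ridge_coeff u) (Num.sqrt (lam u) *: q)].
  move=> [Uu bu]; have [a [b [eta qu]]] := quasi_umbilic_exists oU sf metricE lam0 n4 Uu (nuP Uu).
  have [Ea Eb] := quasi_umbilic_coeffs Uu qu; rewrite Ea Eb in qu.
  have [q [qq Eeta Esh]] := shape_quasi_umbilic Uu qu.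
  exists q; split=> //; last by rewrite -Eeta.
  move=> i j; rewrite /Q Esh !mxE big_ord1 !mxE -mulr_natr.
  by field.
have [q0 [q00 Eq0 _]] := ex u0 (conj Uu0 b0).
have [j qj] : exists j, q0 0 j != 0.
  by apply/rV0Pn; rewrite -dotp_eq0 q00 oner_eq0.
pose U2 := U1 `&` [set u | 0 < Q j j u].
have oU2 : open U2.
  by apply: open_gt0 => // u U1u; exact: smooth_differentiable (sQ j j) U1u.
have U21 : U2 `<=` U1 by move=> u [].
pose eta u : 'rV[R]_n := \row_i (Num.sqrt (lam u) * (Q i j u / Num.sqrt (Q j j u))).
exists U2, eta; split; first exact: oU2.
- by split=> //=; rewrite Eq0 -expr2 exprn_even_gt0.
- by move=> u /U21/U1U.
- split.
  + by apply: smooth_sub snu => u /U21/U1U.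
  + exact: smooth_sub sa.
  + exact: smooth_sub sb.
  + apply/smooth_coordP => // i; under eq_fun do rewrite mxE.
    apply: smoothM => //.
      apply: smooth_sqrt => // [u /U21/U1U/lam0//|].
      by apply: smooth_sub sl => u /U21/U1U.
    apply: smooth_div => // [u [_ Qu]||].
    * by rewrite gt_eqF// sqrtr_gt0.
    * exact: smooth_sub (sQ i j).
    * by apply: smooth_sqrt => // [u []//|]; exact: smooth_sub (sQ j j).
  + move=> u U2u; have U1u := U21 _ U2u; have [_ /= Qu] := U2u.
    have [q [qq Eq qu]] := ex u U1u.
    have Uu := U1U u U1u.
    have q0j : q 0 j != 0.
      by apply: contraTneq Qu => qj0; rewrite Eq qj0 mul0r ltxx.
    have -> : eta u = (q 0 j / `|q 0 j|) *: (Num.sqrt (lam u) *: q).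
      apply/rowP => i; rewrite !mxE !Eq -expr2 sqrtr_sqr; ring.
    have ss : (q 0 j / `|q 0 j|) ^+ 2 = 1.
      by rewrite expr_div_n real_normK ?num_real// mulfV// sqrf_eq0.
    have /(quasi_umbilicP metricE lam0 _ _ _ Uu (nuP Uu))[H1 H2] := qu.
    apply/(quasi_umbilicP metricE lam0 _ _ _ Uu (nuP Uu)); split.
      by rewrite dotpZl dotpZr mulrA -expr2 ss mul1r.
    move=> v w; rewrite H2; congr (_ + _ * _).
    by rewrite [in RHS]dotpZr [in RHS](dotpZr _ w) mulrACA -expr2 ss mul1r.
- by move=> u /U21[].
Qed.

(** At umbilic points any smooth unit covector will do. *)
Lemma quasi_umbilic_on_umbilic U' : open U' -> U' `<=` U ->
  (forall u, U' u -> ridge_coeff u = 0) ->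
  exists eta, quasi_umbilic_on U' f nu umbilic_coeff (fun=> 0) eta.
Proof.
move=> oU' U'U b0.
exists (fun u => Num.sqrt (lam u) *: (delta_mx 0 (Ordinal n0) : 'rV[R]_n)); split.
- exact: smooth_sub snu.
- apply: smooth_umbilic_coeff => //.
  by apply: (smooth_ext oU' _ (smooth_cst (0 : R))) => u /b0 ->.
- exact: smooth_cst.
- apply: smoothZ => //; last exact: smooth_cst.
  apply: smooth_sqrt => // [u /U'U/lam0//|]; exact: smooth_sub sl.
- move=> u U'u; have Uu := U'U u U'u.
  have [a [b [eta qu]]] := quasi_umbilic_exists oU sf metricE lam0 n4 Uu (nuP Uu).
  have [Ea Eb] := quasi_umbilic_coeffs Uu qu; rewrite Ea Eb b0// in qu.
  have /(quasi_umbilicP metricE lam0 _ _ _ Uu (nuP Uu))[H1 H2] := qu.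
  apply/(quasi_umbilicP metricE lam0 _ _ _ Uu (nuP Uu)); split.
    by rewrite !dotpE dotp_deltal mxE !eqxx mulr1 -expr2 sqr_sqrtr// ltW// lam0.
  by move=> v w; rewrite H2 !mul0r.
Qed.

End Coefficients.

(** * Structure equations and the geometry of the leaves *)

Section StructureEquations.
Context {R : realType} {n : nat}.
Variables (U : set 'rV[R]_n) (f nu : 'rV[R]_n -> 'rV[R]_n.+1).
Variables (lam a b : 'rV[R]_n -> R) (eta : 'rV[R]_n -> 'rV[R]_n).
Hypotheses (n3 : (3 <= n)%N) (oU : open U) (sf : smooth_on U f).
Hypothesis metricE : forall u, U u -> metric f u = (lam u)%:M.
Hypothesis lam0 : forall u, U u -> 0 < lam u.
Hypothesis qu : quasi_umbilic_on U f nu a b eta.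
Implicit Types (u v w x y z : 'rV[R]_n).

Let snu : smooth_on U nu. Proof. by case: qu. Qed.
Let sa : smooth_on U a. Proof. by case: qu. Qed.
Let sb : smooth_on U b. Proof. by case: qu. Qed.
Let seta : smooth_on U eta. Proof. by case: qu. Qed.
Let nuP u : U u -> unit_normal f u (nu u).
Proof. by move=> Uu; case: qu => _ _ _ _ /(_ u Uu)[]. Qed.
Let sl : smooth_on U lam.
Proof. by apply: (smooth_conformal_factor oU sf metricE); exact: leq_trans n3. Qed.
Let l0 u : U u -> lam u != 0. Proof. by move=> Uu; rewrite gt_eqF// lam0. Qed.

Let df u : U u -> differentiable f u. Proof. exact: smooth_differentiable. Qed.
Let dnu u : U u -> differentiable nu u. Proof. exact: smooth_differentiable. Qed.
Let da u : U u -> differentiable a u. Proof. exact: smooth_differentiable. Qed.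
Let sD v : smooth_on U (dd v f). Proof. exact: smooth_dd. Qed.
Let dD v u : U u -> differentiable (dd v f) u.
Proof. by move=> Uu; exact: smooth_differentiable (sD v) Uu. Qed.

Let tangentE u v w : U u -> dotp (dd v f u) (dd w f u) = lam u * dotp v w.
Proof. by move=> Uu; exact: (dotp_tangent sf metricE). Qed.

Let normalE u v : U u -> dotp (dd v f u) (nu u) = 0.
Proof. by move=> Uu; exact: (dotp_tangent_normal sf Uu (nuP Uu)). Qed.

Let etaE u : U u -> dotp (eta u) (eta u) = lam u.
Proof.
move=> Uu; case: qu => _ _ _ _ /(_ u Uu).
by move=> /(quasi_umbilicP metricE lam0 _ _ _ Uu (nuP Uu))[].
Qed.

Let secondE u v w : U u -> dotp (dd v (dd w f) u) (nu u) =
  a u * (lam u * dotp v w) + b u * (dotp v (eta u) * dotp w (eta u)).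
Proof.
move=> Uu; case: qu => _ _ _ _ /(_ u Uu).
move=> /(quasi_umbilicP metricE lam0 _ _ _ Uu (nuP Uu))[_ <-].
by rewrite (bform_second_form oU sf _ Uu).
Qed.

Lemma eq_tangent_normal u (d e : 'rV[R]_n.+1) : U u ->
  (forall v, dotp d (dd v f u) = dotp e (dd v f u)) ->
  dotp d (nu u) = dotp e (nu u) -> d = e.
Proof.
move=> Uu T N.
rewrite (tangent_partP sf metricE lam0 Uu (nuP Uu) d).
rewrite (tangent_partP sf metricE lam0 Uu (nuP Uu) e) N.
congr (dd _ f u + _); apply: dotp_inj => v; apply: (mulfI (l0 Uu)).
by rewrite -!(dotp_tangent_part sf metricE lam0 Uu (nuP Uu)).
Qed.

(** The vector field metrically dual to [eta], in parameter space and in the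
    ambient space. The latter is defined by a sum over coordinates and not as the
    derivative of [f] along [dual_dir], a direction depending on the point,
    because its smoothness is then visible. *)
Definition dual_dir u : 'rV[R]_n := (lam u)^-1 *: eta u.
Definition dual_vec u : 'rV[R]_n.+1 :=
  \sum_i ((lam u)^-1 * eta u 0 i) *: dd (delta_mx 0 i) f u.
Local Notation Z := dual_dir.
Local Notation xi := dual_vec.

Lemma dual_vecE u : U u -> xi u = dd (Z u) f u.
Proof.
move=> Uu; rewrite dd_row_sum; last exact: df.
by apply: eq_bigr => i _; rewrite mxE.
Qed.

Lemma smooth_dual_coef i : smooth_on U (fun u => (lam u)^-1 * eta u 0 i).
Proof.
apply: smoothM => //; last by exact: (smooth_coordP eta oU).1.
by apply: smoothV => // u; exact: l0.
Qed.

Lemma smooth_dual_vec : smooth_on U xi.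
Proof.
by apply: smooth_sum => // i; apply: smoothZ => //; exact: smooth_dual_coef.
Qed.

Let dxi u : U u -> differentiable xi u.
Proof. by move=> Uu; exact: smooth_differentiable smooth_dual_vec Uu. Qed.

Lemma dotp_dual_dir u v : U u -> lam u * dotp (Z u) v = dotp v (eta u).
Proof. by move=> Uu; rewrite dotpZl mulrA mulfV ?l0// mul1r dotpC. Qed.

Lemma dual_dir_eta u : U u -> dotp (Z u) (eta u) = 1.
Proof. by move=> Uu; rewrite dotpZl etaE// mulVf// l0. Qed.

Lemma dotp_dual_vec u v : U u -> dotp (xi u) (dd v f u) = dotp v (eta u).
Proof. by move=> Uu; rewrite dual_vecE// tangentE// dotp_dual_dir. Qed.

Lemma dual_vec_unit u : U u -> dotp (xi u) (xi u) = 1.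
Proof. by move=> Uu; rewrite {2}dual_vecE// dotp_dual_vec// dual_dir_eta. Qed.

Lemma dual_vec_normal u : U u -> dotp (xi u) (nu u) = 0.
Proof. by move=> Uu; rewrite dual_vecE// normalE. Qed.

(** Differentiating [<nu, d_w f> = 0] and [<nu, nu> = 1] expresses [d nu] by the
    second form. *)
Lemma weingarten u v : U u ->
  dd v nu u = - a u *: dd v f u + dotp v (eta u) *: (- b u *: xi u).
Proof.
move=> Uu; apply: (eq_tangent_normal Uu) => [w|].
  have : dd v (fun y => dotp (nu y) (dd w f y)) u = 0.
    rewrite (dd_ext (F := fun y => dotp (nu y) (dd w f y)) (G := fun=> 0) _ oU Uu).
      by rewrite dd_cst.
    by move=> y Uy; rewrite dotpC normalE.
  rewrite dd_dotp; [|exact: dnu|exact: dD].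
  rewrite (dotpC (nu u)) secondE// => /eqP; rewrite addr_eq0 => /eqP ->.
  by rewrite dotpDl !dotpZl tangentE// dotp_dual_vec//; ring.
have : dd v (fun y => dotp (nu y) (nu y)) u = 0.
  rewrite (dd_ext (F := fun y => dotp (nu y) (nu y)) (G := fun=> 1) _ oU Uu).
    by rewrite dd_cst.
  by move=> y Uy; exact: (nuP Uy).1.
rewrite dd_dotp; [|exact: dnu..].
rewrite (dotpC (nu u)) dotpDl !dotpZl normalE// dual_vec_normal// => H; lra.
Qed.

(** The equations [dF = k df + theta w] below hold for the normal field and for
    the field dual to [eta]. Their integrability condition, the symmetry of the
    second derivative of [F], replaces the Codazzi equation. *)
Section FirstIntegral.
Variables (theta : 'rV[R]_n -> 'rV[R]_n) (F w : 'rV[R]_n -> 'rV[R]_n.+1).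
Variable k : 'rV[R]_n -> R.
Hypotheses (stheta : smooth_on U theta) (sF : smooth_on U F).
Hypotheses (sw : smooth_on U w) (sk : smooth_on U k).
Hypothesis dF : forall u v, U u ->
  dd v F u = k u *: dd v f u + dotp v (theta u) *: w u.

(** The exterior derivative of [theta]. *)
Definition curl u x y : R := dotp y (dd x theta u) - dotp x (dd y theta u).

Lemma second_derivative_sym u x y : U u ->
  dd x k u *: dd y f u - dd y k u *: dd x f u + curl u x y *: w u
  + (dotp y (theta u) *: dd x w u - dotp x (theta u) *: dd y w u) = 0.
Proof.
move=> Uu.
have dk := smooth_differentiable sk Uu; have dw := smooth_differentiable sw Uu.
have dth := smooth_differentiable stheta Uu.
have dfv v := dD v Uu.
have dthv (v : 'rV[R]_n) : differentiable (fun z => dotp v (theta z)) u.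
  by apply: differentiable_dotp => //; exact: differentiable_cst.
have E v v' : dd v (dd v' F) u = dd v k u *: dd v' f u + k u *: dd v (dd v' f) u
    + (dotp v' (dd v theta u) *: w u + dotp v' (theta u) *: dd v w u).
  rewrite (dd_ext (F := dd v' F) (G := fun z => k z *: dd v' f z + dotp v' (theta z) *: w z) v oU Uu); last first.
    by move=> y' Uy; exact: dF.
  rewrite ddD; [|exact: differentiable_scale|exact: differentiable_scale].
  rewrite dd_scale// dd_scale//.
  by rewrite (@dd_dotp _ _ _ v (fun=> v') theta)// ?dd_cst ?dotp0l ?add0r//; exact: differentiable_cst.
have := dd_comm x y oU sF Uu; rewrite !E => /eqP; rewrite -subr_eq0 => /eqP <-.
rewrite (dd_comm y x oU sf Uu) /curl scalerBl.
apply/rowP => i; rewrite !mxE; ring.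
Qed.

(** For [x] in the kernel of [theta], choose [y] in that kernel orthogonal to
    [x], which needs dimension three, and pair the integrability condition with
    [d_y f]: only [dk(x) |d_y f|^2] remains. *)
Lemma first_integral u : U u ->
  (forall x y, dotp x (theta u) = 0 -> dotp y (theta u) = 0 ->
     curl u x y * dotp (w u) (dd y f u) = 0) ->
  forall x, dotp x (theta u) = 0 -> dd x k u = 0.
Proof.
move=> Uu curl0 x xt.
have [//|y y0 yP] := @orthogonal_vector R n [:: x; theta u].
have yx : dotp y x = 0 by apply: yP; rewrite inE eqxx.
have yt : dotp y (theta u) = 0 by apply: yP; rewrite !inE eqxx orbT.
have /(congr1 (fun d => dotp d (dd y f u))) := second_derivative_sym x y Uu.
rewrite xt yt !scale0r subrr addr0 dotp0l dotpDl dotpBl !dotpZl curl0// addr0.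
rewrite !tangentE// (dotpC x) yx !mulr0 subr0 => /eqP.
by rewrite !mulf_eq0 (negbTE (l0 Uu)) dotp_eq0 (negbTE y0) !orbF => /eqP.
Qed.

End FirstIntegral.

(** At umbilic points [d nu = - a df], so that [first_integral] applies with
    [theta = 0], whose kernel is everything. *)
Lemma umbilic_coeff_constant u v : (forall y, U y -> b y = 0) -> U u -> dd v a u = 0.
Proof.
move=> b0 Uu.
have sNa : smooth_on U (fun y => - a y) by exact: smoothN.
have H := @first_integral (fun=> 0) nu (fun=> 0) (fun y => - a y)
  (smooth_cst _) snu (smooth_cst _) sNa.
have : dd v (fun y => - a y) u = 0.
  apply: H => //; last by rewrite dotp0r.
    by move=> y w Uy; rewrite weingarten// b0// oppr0 scale0r !scaler0.
  by move=> x y _ _; rewrite dotp0l mulr0.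
by rewrite ddN => [/eqP|]; [rewrite oppr_eq0 => /eqP|exact: da].
Qed.

Section Ridge.
Hypothesis b0 : forall u, U u -> b u != 0.

Let k0 u : R := - a u.
Let w0 u : 'rV[R]_n.+1 := - b u *: xi u.
Let sk0 : smooth_on U k0. Proof. exact: smoothN. Qed.
Let sw0 : smooth_on U w0.
Proof. by apply: smoothZ => //; [exact: smoothN|exact: smooth_dual_vec]. Qed.

Let curl_k0 u x y : U u -> dotp y (eta u) = 0 ->
  curl eta u x y * dotp (w0 u) (dd y f u) = 0.
Proof. by move=> Uu ye; rewrite dotpZl dotp_dual_vec// ye !mulr0. Qed.

Let ddk0 u x : U u -> dd x k0 u = - dd x a u.
Proof. by move=> Uu; rewrite ddN//; exact: da. Qed.

(** The field multiplying [eta] in [d nu] is parallel to [dual_vec], hence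
    orthogonal to the leaves, and the curl of [eta] does not interfere. *)
Lemma umbilic_coeff_leafwise u x : U u -> dotp x (eta u) = 0 -> dd x a u = 0.
Proof.
move=> Uu xe; have := first_integral seta snu sw0 sk0 weingarten Uu.
move=> /(_ _ x xe); rewrite ddk0// => H; apply/eqP; rewrite -oppr_eq0; apply/eqP.
by apply: H => y z _ ze; exact: curl_k0.
Qed.

(** Once [a] is known to be constant on leaves, the integrability condition of
    [d nu] reduces on the kernel of [eta] to a multiple of [dual_vec] whose
    coefficient is the curl: the kernel of [eta] is integrable, and its integral
    hypersurfaces are called leaves below. *)
Lemma curl_eta_leafwise u x y : U u -> dotp x (eta u) = 0 -> dotp y (eta u) = 0 ->
  curl eta u x y = 0.
Proof.
move=> Uu xe ye; have := second_derivative_sym seta snu sw0 sk0 weingarten x y Uu.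
rewrite !ddk0// !umbilic_coeff_leafwise// xe ye !oppr0 !scale0r subrr add0r addr0.
move/(congr1 (fun d => dotp d (xi u))); rewrite !dotpZl dual_vec_unit// dotp0l mulr1.
by move/eqP; rewrite mulf_eq0 oppr_eq0 (negbTE (b0 Uu)) orbF => /eqP.
Qed.

(** The curvature of the leaves inside the hypersurface, by
    [dual_vec_leafwise]. *)
Definition leaf_curvature u : R :=
  (\sum_i ((lam u)^-1 * eta u 0 i) * dd (delta_mx 0 i) a u) / b u.
Local Notation kappa := leaf_curvature.

Lemma leaf_curvatureE u : U u -> kappa u = dd (Z u) a u / b u.
Proof.
move=> Uu; rewrite dd_row_sum; last exact: da.
by congr (_ / _); apply: eq_bigr => i _; rewrite mxE.
Qed.

Lemma smooth_leaf_curvature : smooth_on U kappa.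
Proof.
apply: smooth_div => //; apply: smooth_sum => // i.
by apply: smoothM => //; [exact: smooth_dual_coef|exact: smooth_dd].
Qed.

(** The integrability condition of [d nu] for a leaf direction and the dual
    direction, together with [|dual_vec| = 1], shows that the leaves are umbilic
    inside the hypersurface. *)
Lemma dual_vec_leafwise u x : U u -> dotp x (eta u) = 0 ->
  dd x xi u = kappa u *: dd x f u.
Proof.
move=> Uu xe; have := second_derivative_sym seta snu sw0 sk0 weingarten x (Z u) Uu.
rewrite !ddk0// umbilic_coeff_leafwise// xe dual_dir_eta// oppr0 !scale0r subr0 add0r scale1r.
have dNb : differentiable (fun y => - b y) u.
  by apply: smooth_differentiable Uu; exact: smoothN.
rewrite dd_scale//; last exact: dxi.
set m := curl _ _ _ _ => E.
have : dd x (fun y => dotp (xi y) (xi y)) u = 0.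
  rewrite (dd_ext (F := fun y => dotp (xi y) (xi y)) (G := fun=> 1) _ oU Uu).
    by rewrite dd_cst.
  by move=> y Uy; exact: dual_vec_unit.
rewrite dd_dotp; [|exact: dxi..].
rewrite (dotpC (xi u)) => xx; have {}xx : dotp (dd x xi u) (xi u) = 0 by lra.
have m0 : m * - b u + dd x (fun y => - b y) u = 0.
  have := congr1 (fun d => dotp d (xi u)) E.
  rewrite /= /w0 !dotpE.
  rewrite dual_vec_unit// xx (dotpC _ (xi u)) dotp_dual_vec// xe; lra.
have {}E : dd (Z u) a u *: dd x f u - b u *: dd x xi u
    + (m * - b u + dd x (fun y => - b y) u) *: xi u = 0.
  by rewrite -[RHS]E /w0; apply/rowP => i; rewrite !mxE; ring.
move: E; rewrite m0 scale0r addr0 => /eqP; rewrite subr_eq0 => /eqP E.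
by rewrite leaf_curvatureE// mulrC -scalerA E scalerA mulVf ?b0// scale1r.
Qed.

Let w1 u : 'rV[R]_n.+1 :=
  \sum_i ((lam u)^-1 * eta u 0 i) *: dd (delta_mx 0 i) xi u - kappa u *: xi u.

Let sw1 : smooth_on U w1.
Proof.
apply: smoothD => //.
  apply: smooth_sum => // i; apply: smoothZ => //; first exact: smooth_dual_coef.
  exact/smooth_dd/smooth_dual_vec.
apply: smooth_oppv => //; apply: smoothZ => //; first exact: smooth_leaf_curvature.
exact: smooth_dual_vec.
Qed.

Lemma dual_vec_derivative u v : U u ->
  dd v xi u = kappa u *: dd v f u + dotp v (eta u) *: w1 u.
Proof.
move=> Uu; pose x := v - dotp v (eta u) *: Z u.
have xe : dotp x (eta u) = 0 by rewrite dotpBl dotpZl dual_dir_eta// mulr1 subrr.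
have Ev : v = x + dotp v (eta u) *: Z u by rewrite subrK.
have -> : w1 u = dd (Z u) xi u - kappa u *: xi u.
  rewrite dd_row_sum; last exact: dxi.
  by congr (_ - _); apply: eq_bigr => i _; rewrite [in RHS]mxE.
move: x xe Ev => x xe Ev; rewrite {1 2}Ev (ddDl _ _ (dxi Uu)) (ddZl _ (Z u) (dxi Uu)).
rewrite (ddDl _ _ (df Uu)) (ddZl _ (Z u) (df Uu)).
rewrite dual_vec_leafwise// -dual_vecE//.
by apply/rowP => i; rewrite !mxE; ring.
Qed.

(** [dual_vec] satisfies the same kind of equation as the normal field, so the
    same argument applies, integrability of the leaves now removing the curl
    term. *)
Lemma leaf_curvature_leafwise u x : U u -> dotp x (eta u) = 0 -> dd x kappa u = 0.
Proof.
move=> Uu xe.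
apply: (first_integral seta smooth_dual_vec sw1 smooth_leaf_curvature dual_vec_derivative Uu) => //.
by move=> y z ye ze; rewrite curl_eta_leafwise// mul0r.
Qed.

Section Canal.
Hypothesis a0 : forall u, U u -> a u != 0.

(** On a leaf [d nu = - a df] and [d dual_vec = kappa df] with [a] and [kappa]
    constant. Therefore [kappa nu + a dual_vec] is constant there, which puts the
    leaf in a hyperplane, and so is [(a^2 + kappa^2) f + a nu - kappa dual_vec],
    which puts it on a sphere of radius [(a^2 + kappa^2)^(-1/2)]. The normals meet
    at [focal_point], constant on the leaf as well. *)
Definition leaf_invariant u : R := a u ^+ 2 + kappa u ^+ 2.
Definition leaf_radius u : R := (Num.sqrt (leaf_invariant u))^-1.
Definition leaf_centre u : 'rV[R]_n.+1 :=
  f u + (leaf_radius u ^+ 2 *: (a u *: nu u + (- kappa u) *: xi u)).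
Definition leaf_axis u : 'rV[R]_n.+1 :=
  leaf_radius u *: (a u *: xi u + kappa u *: nu u).
Definition focal_point u : 'rV[R]_n.+1 := f u + (a u)^-1 *: nu u.

Let dk u : U u -> differentiable kappa u.
Proof. exact: (smooth_differentiable smooth_leaf_curvature). Qed.

Lemma leaf_invariant_gt0 u : U u -> 0 < leaf_invariant u.
Proof.
by move=> Uu; rewrite ltr_pwDl ?sqr_ge0// exprn_even_gt0//= a0.
Qed.

Lemma smooth_leaf_invariant : smooth_on U leaf_invariant.
Proof.
rewrite /leaf_invariant; under eq_fun do rewrite !expr2.
have sk := smooth_leaf_curvature.
by apply: smoothD => //; exact: smoothM.
Qed.

Lemma leaf_radius_gt0 u : U u -> 0 < leaf_radius u.
Proof. by move=> Uu; rewrite invr_gt0 sqrtr_gt0 leaf_invariant_gt0. Qed.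

Lemma sqr_leaf_radius u : U u -> leaf_radius u ^+ 2 * leaf_invariant u = 1.
Proof.
move=> /leaf_invariant_gt0 h; rewrite exprVn sqr_sqrtr ?mulVf// ?gt_eqF//.
exact: ltW.
Qed.

Lemma smooth_leaf_radius : smooth_on U leaf_radius.
Proof.
have si := smooth_leaf_invariant.
apply: smoothV => // [u /leaf_invariant_gt0 h|]; first by rewrite gt_eqF// sqrtr_gt0.
by apply: smooth_sqrt => // u; exact: leaf_invariant_gt0.
Qed.

Let dr u : U u -> differentiable leaf_radius u.
Proof. exact: (smooth_differentiable smooth_leaf_radius). Qed.

Let sr2 : smooth_on U (fun u => leaf_radius u ^+ 2).
Proof.
under eq_fun do rewrite expr2; have sr := smooth_leaf_radius; exact: smoothM.
Qed.

Lemma smooth_leaf_centre : smooth_on U leaf_centre.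
Proof.
have sk := smooth_leaf_curvature; have sx := smooth_dual_vec.
apply: smoothD => //; apply: smoothZ => //.
by apply: smoothD => //; apply: smoothZ => //; exact: smoothN.
Qed.

Lemma smooth_leaf_axis : smooth_on U leaf_axis.
Proof.
have sk := smooth_leaf_curvature; have sx := smooth_dual_vec.
have sr := smooth_leaf_radius.
by apply: smoothZ => //; apply: smoothD => //; exact: smoothZ.
Qed.

Lemma smooth_focal_point : smooth_on U focal_point.
Proof. by apply: smoothD => //; apply: smoothZ => //; exact: smoothV. Qed.

Lemma leaf_invariant_leafwise u x : U u -> dotp x (eta u) = 0 ->
  dd x leaf_invariant u = 0.
Proof.
move=> Uu xe; rewrite /leaf_invariant; under eq_fun do rewrite !expr2.
rewrite ddD; [|by apply: differentiableM; [exact: da|exact: da]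
  |by apply: differentiableM; [exact: dk|exact: dk]].
rewrite (ddM x (da Uu) (da Uu)) (ddM x (dk Uu) (dk Uu)).
by rewrite umbilic_coeff_leafwise// leaf_curvature_leafwise// !mul0r !mulr0 !addr0.
Qed.

Lemma leaf_radius_leafwise u x : U u -> dotp x (eta u) = 0 -> dd x leaf_radius u = 0.
Proof.
move=> Uu xe; have dru := dr Uu.
have di := smooth_differentiable smooth_leaf_invariant Uu.
have drr : differentiable (fun y => leaf_radius y * leaf_radius y) u.
  exact: differentiableM.
have : dd x (fun y => leaf_radius y * leaf_radius y * leaf_invariant y) u = 0.
  rewrite (dd_ext (F := fun y => leaf_radius y * leaf_radius y * leaf_invariant y)
    (G := fun=> 1) _ oU Uu) ?dd_cst// => y Uy.
  by rewrite -expr2 sqr_leaf_radius.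
rewrite ddM// leaf_invariant_leafwise// mulr0 addr0 ddM//.
have r0 := leaf_radius_gt0 Uu; have i0 := leaf_invariant_gt0 Uu.
move/eqP; rewrite mulf_eq0 (gt_eqF i0) orbF (mulrC (leaf_radius u)) -mulrDr mulf_eq0.
by rewrite (gt_eqF (addr_gt0 r0 r0)) orbF => /eqP.
Qed.

Let weingarten_leaf u x : U u -> dotp x (eta u) = 0 -> dd x nu u = - a u *: dd x f u.
Proof. by move=> Uu xe; rewrite weingarten// xe scale0r addr0. Qed.

Lemma focal_point_leafwise u x : U u -> dotp x (eta u) = 0 -> dd x focal_point u = 0.
Proof.
move=> Uu xe.
have dVa : differentiable (fun y => (a y)^-1) u.
  by apply: smooth_differentiable Uu; exact: smoothV.
have Va : dd x (fun y => (a y)^-1) u = 0.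
  have : dd x (fun y => a y * (a y)^-1) u = 0.
    rewrite (dd_ext (F := fun y => a y * (a y)^-1) (G := fun=> 1) _ oU Uu) ?dd_cst// => y Uy.
    by rewrite mulfV// a0.
  rewrite ddM//; last exact: da.
  rewrite umbilic_coeff_leafwise// mul0r add0r => /eqP.
  by rewrite mulf_eq0 (negbTE (a0 Uu)) => /eqP.
rewrite /focal_point ddD; [|exact: df|by apply: differentiable_scale => //; exact: dnu].
rewrite dd_scale//; last exact: dnu.
by rewrite Va scale0r add0r weingarten_leaf// scalerA mulrN mulVf ?a0// scaleN1r subrr.
Qed.

Lemma leaf_centre_leafwise u x : U u -> dotp x (eta u) = 0 -> dd x leaf_centre u = 0.
Proof.
move=> Uu xe; have du := da Uu; have dku := dk Uu; have dxu := dxi Uu; have dnuu := dnu Uu.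
have dNk : differentiable (fun y => - kappa y) u.
  by apply: smooth_differentiable Uu; apply: smoothN => //; exact: smooth_leaf_curvature.
have d1 : differentiable (fun y => a y *: nu y) u by exact: differentiable_scale.
have d2 : differentiable (fun y => (- kappa y) *: xi y) u by exact: differentiable_scale.
have d3 : differentiable (fun y => a y *: nu y + (- kappa y) *: xi y) u by exact: differentiableD.
have dr2 := smooth_differentiable sr2 Uu.
have r20 : dd x (fun y => leaf_radius y ^+ 2) u = 0.
  under eq_fun do rewrite expr2.
  by rewrite ddM ?leaf_radius_leafwise ?mul0r ?mulr0 ?addr0//; exact: dr.
rewrite /leaf_centre ddD; [|exact: df|exact: differentiable_scale].
rewrite dd_scale// r20 scale0r add0r ddD// !dd_scale// ddN// leaf_curvature_leafwise//.
rewrite umbilic_coeff_leafwise// oppr0 !scale0r !add0r weingarten_leaf//.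
rewrite dual_vec_leafwise// !scalerA -scalerDl scalerA.
rewrite (_ : _ * _ = - (leaf_radius u ^+ 2 * leaf_invariant u)).
  by rewrite sqr_leaf_radius// scaleN1r subrr.
by rewrite /leaf_invariant; ring.
Qed.

Lemma leaf_axis_leafwise u x : U u -> dotp x (eta u) = 0 -> dd x leaf_axis u = 0.
Proof.
move=> Uu xe; have du := da Uu; have dku := dk Uu; have dxu := dxi Uu; have dnuu := dnu Uu.
have d1 : differentiable (fun y => a y *: xi y) u by exact: differentiable_scale.
have d2 : differentiable (fun y => kappa y *: nu y) u by exact: differentiable_scale.
have d3 : differentiable (fun y => a y *: xi y + kappa y *: nu y) u by exact: differentiableD.
rewrite /leaf_axis dd_scale//; last exact: dr.
rewrite leaf_radius_leafwise// scale0r add0r ddD// !dd_scale// leaf_curvature_leafwise//.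
rewrite umbilic_coeff_leafwise// !scale0r !add0r weingarten_leaf// dual_vec_leafwise//.
by rewrite !scalerA -scalerDl mulrN mulrC subrr scale0r scaler0.
Qed.

Lemma dotp_leaf_axis u : U u -> dotp (leaf_axis u) (leaf_axis u) = 1.
Proof.
move=> Uu; rewrite -(sqr_leaf_radius Uu) /leaf_axis /leaf_invariant !dotpE.
rewrite dual_vec_unit// (nuP Uu).1 (dotpC (nu u)) dual_vec_normal//; ring.
Qed.

Lemma leaf_centre_subsphere u : U u ->
  subsphere (leaf_centre u) (leaf_axis u) (leaf_radius u) (f u).
Proof.
move=> Uu; rewrite /subsphere/= /leaf_centre opprD addrA subrr add0r.
split; rewrite /leaf_axis !dotpE dual_vec_unit// (nuP Uu).1 (dotpC (nu u)) dual_vec_normal//.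
  rewrite -[RHS]mulr1 -[X in _ = _ * X](sqr_leaf_radius Uu) /leaf_invariant; ring.
ring.
Qed.

Lemma focal_point_normal u v : U u -> dotp (dd v f u) (focal_point u - f u) = 0.
Proof. by move=> Uu; rewrite /focal_point addrAC subrr add0r dotpZr normalE// mulr0. Qed.

(** The focal point depends on the leaf only and moves with non-zero speed
    across the leaves: one of its coordinates can label them. *)
Lemma focal_point_transverse u : U u ->
  dotp (dd (Z u) focal_point u) (xi u) = - (b u / a u).
Proof.
move=> Uu.
have dVa : differentiable (fun y => (a y)^-1) u.
  by apply: smooth_differentiable Uu; exact: smoothV.
rewrite /focal_point ddD; [|exact: df|by apply: differentiable_scale => //; exact: dnu].
rewrite dd_scale//; last exact: dnu.
rewrite weingarten// -dual_vecE// dual_dir_eta// scale1r !dotpE.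
rewrite dual_vec_unit// (dotpC (nu u)) dual_vec_normal//.
by field; rewrite a0.
Qed.

(** The normal space of a leaf is spanned by [dual_vec] and [nu], and inside it
    the orthogonal complement of the axis is the line of the radius. *)
Lemma leaf_normal u d : U u ->
  (forall x, dotp x (eta u) = 0 -> dotp d (dd x f u) = 0) ->
  dotp d (leaf_axis u) = 0 -> exists t, d = t *: (f u - leaf_centre u).
Proof.
move=> Uu dT dax.
pose A := dotp d (xi u); pose B := dotp d (nu u).
have Ed : d = A *: xi u + B *: nu u.
  apply: (eq_tangent_normal Uu) => [v|]; last first.
    by rewrite dotpDl !dotpZl dual_vec_normal// (nuP Uu).1 mulr0 mulr1 add0r.
  have Ev : v = (v - dotp v (eta u) *: Z u) + dotp v (eta u) *: Z u by rewrite subrK.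
  rewrite [in LHS]Ev (ddDl _ _ (df Uu)) (ddZl _ (Z u) (df Uu)).
  rewrite dotpDr dT; last by rewrite dotpBl dotpZl dual_dir_eta// mulr1 subrr.
  rewrite -dual_vecE// dotpZr -/A dotpDl !dotpZl dotp_dual_vec//.
  by rewrite (dotpC (nu u)) normalE// mulr0 addr0 add0r mulrC.
have r0 := leaf_radius_gt0 Uu.
have AB : a u * A + kappa u * B = 0.
  move/eqP: dax; rewrite /leaf_axis !dotpE -/A -/B mulf_eq0 (gt_eqF r0) => /eqP.
  by [].
exists (- (B / a u / leaf_radius u ^+ 2)).
rewrite /leaf_centre opprD addrA subrr add0r scaleNr scalerN opprK scalerA.
rewrite mulfVK ?expf_neq0 ?gt_eqF// scalerDr !scalerA {1}Ed addrC.
congr (_ *: _ + _ *: _); first by field; rewrite a0.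
apply: (mulfI (a0 Uu)); rewrite (_ : a u * A = - (kappa u * B)); last lra.
by field; rewrite a0.
Qed.

End Canal.
End Ridge.

End StructureEquations.

(** * Level sets of a function increasing in one direction *)

Lemma dd_approx {R : realType} {V W : normedModType R} (F : V -> W) x e :
  differentiable F x -> 0 < e -> exists2 d, 0 < d &
    forall h, `|h| < d -> `|F (x + h) - F x - dd h F x| <= e * `|h|.
Proof.
move=> dF e0; have /nbhs_norm0P[d /= d0 Hd] := differentiable_approxE dF e0.
by exists d => // h hd; have := Hd h hd; rewrite ddE [x + h]addrC.
Qed.

Lemma flat_derivative {R : realType} {V W : normedModType R} (G : V -> W) x :
  (forall e, 0 < e -> exists2 d, 0 < d &
    forall h, `|h| < d -> `|G (x + h) - G x| <= e * `|h|) ->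
  differentiable G x /\ forall v, 'D_v G x = 0.
Proof.
move=> flat; pose L : {linear V -> W} := \0.
have cL : continuous L by move=> y; exact: cst_continuous.
have H : G \o shift x = cst (G x) + L +o_ 0 id.
  apply/eqaddoP => e e0; have [d d0 Hd] := flat e e0.
  apply/nbhs_norm0P; exists d => // h /= hd; have := Hd h hd.
  by rewrite [x + h]addrC -[X in _ - X]addr0.
have dG : differentiable G x by apply/diff_locallyP; rewrite (diff_unique cL H).
by split=> // v; rewrite deriveE// (diff_unique cL H).
Qed.

Section LevelSets.
Context {R : realType} {n : nat}.
Variables (sigma : 'rV[R]_n -> R) (v0 u0 : 'rV[R]_n) (rho m L : R).
Hypotheses (m0 : 0 < m) (L0 : 0 <= L).
Hypothesis dsigma : forall q, `|q - u0| < rho -> differentiable sigma q.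
Hypothesis sigma_incr : forall q, `|q - u0| < rho -> m <= dd v0 sigma q.
Hypothesis sigma_lip : forall q h, `|q - u0| < rho -> `|dd h sigma q| <= L * `|h|.
Implicit Types (p q h x w : 'rV[R]_n).

Let K := L / m.
Let A := 1 + K * `|v0|.
Let K0 : 0 <= K. Proof. by rewrite divr_ge0// ltW. Qed.
Let A0 : 0 < A. Proof. by rewrite ltr_pwDl// mulr_ge0. Qed.

Lemma segment_increment p h : `|p - u0| < rho -> `|p + h - u0| < rho ->
  exists2 q, `|q - u0| < rho & sigma (p + h) - sigma p = dd h sigma q.
Proof.
move=> pr phr; have B s : 0 <= s <= 1 -> `|p + s *: h - u0| < rho.
  by move=> s01; exact: convex_ball_norm.
have [|s /andP[s0 s1] E] := @line_MVT _ _ sigma p h; first by move=> s /B; exact: dsigma.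
by exists (p + s *: h); [apply: B; rewrite !ltW|rewrite ddE].
Qed.

(** The intermediate value theorem along [v0] plays the part of the implicit
    function theorem: a point near a level set is brought back to it by
    a controlled multiple of [v0]. *)
Lemma level_correction p h : `|p - u0| + A * `|h| < rho ->
  exists2 t, `|t| <= K * `|h| & sigma (p + h + t *: v0) = sigma p.
Proof.
move=> ph; have KT : 0 <= K * `|h| by rewrite mulr_ge0.
set T := K * `|h| in KT *.
have B t : `|t| <= T -> `|p + h + t *: v0 - u0| < rho.
  move=> tT; apply: le_lt_trans ph.
  rewrite (_ : p + h + t *: v0 - u0 = (p - u0) + (h + t *: v0)); last first.
    by rewrite -(addrA p) addrAC.
  apply: le_trans (ler_normD _ _) _; rewrite lerD2l.
  apply: le_trans (ler_normD _ _) _; rewrite normrZ /A mulrDl mul1r lerD2l.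
  by rewrite mulrAC ler_wpM2r.
have B0 : `|p + h - u0| < rho.
  by have := B 0; rewrite scale0r addr0 normr0 => /(_ KT).
have Bp : `|p - u0| < rho.
  by apply: le_lt_trans ph; rewrite lerDl mulr_ge0// ltW.
have inc t : `|t| <= T -> exists2 c, m <= c & sigma (p + h + t *: v0) - sigma (p + h) = t * c.
  move=> tT; have [q qr ->] := segment_increment B0 (B t tT).
  exists (dd v0 sigma q); first exact: sigma_incr.
  by rewrite ddZl//; exact: dsigma.
have hL : `|sigma (p + h) - sigma p| <= m * T.
  have [q qr ->] := segment_increment Bp B0; apply: le_trans (sigma_lip _ qr) _.
  by rewrite /T /K mulrCA mulrA mulfVK// gt_eqF.
move: hL; rewrite ler_norml => /andP[hL1 hL2].
have TT : `|T| <= T by rewrite ger0_norm.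
have NTT : `|- T| <= T by rewrite normrN.
have [c mc Ec] := inc T TT; have [c' mc' Ec'] := inc (- T) NTT.
have lo : sigma (p + h + - T *: v0) <= sigma p.
  have : m * T <= c' * T by rewrite ler_wpM2r.
  rewrite mulNr (mulrC T) in Ec'; lra.
have hi : sigma p <= sigma (p + h + T *: v0).
  have : m * T <= c * T by rewrite ler_wpM2r.
  rewrite (mulrC T) in Ec; lra.
have NTT0 : - T <= T by rewrite ge0_cp.
have [||t tT Et] := @IVT R (fun t => sigma (p + h + t *: v0)) (- T) T (sigma p) NTT0.
- apply: derivable_within_continuous => t; rewrite in_itv/= => tT.
  apply/diff_derivable/differentiable_line/dsigma/B.
  by rewrite ler_norml.
- by rewrite ge_min lo le_max hi orbT.
- by exists t => //; move: tT; rewrite in_itv/= ler_norml.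
Qed.

(** Two points of a level set that differ by [s w] up to a multiple of [v0]: the
    multiple is bounded because [sigma] grows along [v0]. With [s = 0] this is
    uniqueness, otherwise Lipschitz continuity, of the correction. *)
Lemma level_correction_lip p q t s w c : `|p - u0| < rho -> `|q - u0| < rho ->
  q = p + (s *: w + t *: v0) -> `|w| <= c -> sigma q = sigma p -> `|t| <= K * c * `|s|.
Proof.
move=> pr qr Eq wc Es; rewrite Eq in qr Es.
have [z zr] := segment_increment pr qr; rewrite Es subrr => /esym.
have dz := dsigma zr.
rewrite ddDl// !ddZl// addrC => /eqP; rewrite addr_eq0 => /eqP E.
have mz := sigma_incr zr; have lz := sigma_lip w zr.
have : `|t| * m <= `|s| * (L * c).
  apply: (@le_trans _ _ `|t * dd v0 sigma z|).
    by rewrite normrM ler_wpM2l// (le_trans mz)// ler_norm.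
  rewrite [t * _]E normrN normrM ler_wpM2l// (le_trans lz)// ler_wpM2l//.
rewrite -ler_pdivlMr// => /le_trans; apply.
by rewrite /K le_eqVlt; apply/orP; left; apply/eqP; ring.
Qed.

(** Moving inside a level set costs nothing at first order in the direction
    [v0]: the [v0]-component of the increment is negligible. *)
Lemma level_increment {W : normedModType R} (F : 'rV[R]_n -> W) p e :
  `|p - u0| < rho -> differentiable F p -> 0 < e ->
  exists2 d, 0 < d & forall h, `|h| < d -> sigma (p + h) = sigma p ->
    exists2 x, dd x sigma p = 0 & exists2 t, h = x + t *: v0 &
      `|t| <= e * `|h| /\ `|F (p + h) - F p - dd x F p| <= e * `|h|.
Proof.
move=> pr dF e0.
have mp := sigma_incr pr; have mp0 : 0 < dd v0 sigma p := lt_le_trans m0 mp.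
pose e1 := Num.min (e * m) (e / 2); have e10 : 0 < e1 by rewrite lt_min mulr_gt0 ?divr_gt0.
pose C := 1 + `|dd v0 F p|; have C0 : 0 < C by rewrite ltr_pwDl.
pose e2 := e1 * m / (2 * C) ; have e20 : 0 < e2 by rewrite !(mulr_gt0, invr_gt0).
pose e3 := Num.min (e * m) (e * m / (2 * C)).
have e30 : 0 < e3 by rewrite lt_min !(mulr_gt0, invr_gt0).
have [d1 d10 H1] := dd_approx (dsigma pr) e30.
have [d2 d20 H2] := dd_approx dF (divr_gt0 e0 (ltr0n R 2)).
exists (Num.min d1 d2); first by rewrite lt_min d10.
move=> h; rewrite lt_min => /andP[hd1 hd2] Eh.
have := H1 h hd1; rewrite Eh subrr sub0r normrN => H1h.
have := H2 h hd2 => H2h.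
pose t := dd h sigma p / dd v0 sigma p; pose x := h - t *: v0.
have tm : `|t| * m <= e3 * `|h|.
  apply: le_trans H1h; rewrite /t normrM normfV (gtr0_norm mp0).
  rewrite -mulrA ler_piMr// mulrC ler_pdivrMr ?mul1r//.
have dp := dsigma pr.
exists x.
  by rewrite ddDl// ddNl// ddZl// /t -[_ *: _]/(_ * _) mulfVK ?gt_eqF// subrr.
exists t; first by rewrite subrK.
split.
  rewrite -(ler_pM2r m0) (le_trans tm)// mulrAC ler_wpM2r//.
  by rewrite ge_min lexx.
have -> : F (p + h) - F p - dd x F p = (F (p + h) - F p - dd h F p) + t *: dd v0 F p.
  rewrite ddDl// ddNl// ddZl// opprD opprK addrA //.
apply: le_trans (ler_normD _ _) _; rewrite normrZ.
apply: le_trans (lerD H2h (_ : _ <= e / 2 * `|h|)) _; last by rewrite -mulrDl -splitr.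
rewrite -(ler_pM2l m0) mulrA (mulrC m).
apply: le_trans (ler_wpM2r _ tm) _ => //.
apply: (@le_trans _ _ (e * m / (2 * C) * `|h| * C)).
  apply: ler_pM => //; first by rewrite mulr_ge0// ltW.
    by rewrite ler_wpM2r// /e3 ge_min lexx orbT.
  by rewrite /C lerDr.
by rewrite le_eqVlt; apply/orP; left; apply/eqP; field; rewrite gt_eqF.
Qed.

(** Lagrange's condition: a direction tangent to the level set is realised, up
    to negligible terms, by the corrected increments of [level_correction]. *)
Lemma level_minimum (N : 'rV[R]_n -> R) p d : `|p - u0| < rho ->
  differentiable N p -> 0 < d ->
  (forall q, `|q - p| < d -> sigma q = sigma p -> N p <= N q) ->
  forall x, dd x sigma p = 0 -> dd x N p = 0.
Proof.
move=> pr dN d0 pmin x0 x0s.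
suff H x : dd x sigma p = 0 -> 0 <= dd x N p.
  apply/eqP; rewrite eq_le H// andbT -oppr_ge0 -ddNl// H//.
  by rewrite ddNl ?x0s ?oppr0//; exact: dsigma.
move=> {x0 x0s} xs; apply/ler_addgt0Pl => e e0.
pose c := A * `|x| + 1; have c0 : 0 < c by rewrite ltr_wpDl// mulr_ge0// ltW.
have [d1 d10 H] := level_increment pr dN (divr_gt0 e0 c0).
pose M := Num.min d (Num.min d1 (rho - `|p - u0|)).
have M0 : 0 < M by rewrite !lt_min d0 d10 subr_gt0.
pose s := M / (2 * c); have s0 : 0 < s by rewrite divr_gt0// mulr_gt0.
have sc : s * c < M.
  rewrite (_ : s * c = M / 2); last by rewrite /s; field; rewrite gt_eqF.
  by rewrite gtr_pMr// invf_lt1// ltr1n.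
have sxc : A * `|s *: x| <= s * c.
  by rewrite normrZ gtr0_norm// mulrCA ler_pM2l// /c lerDl.
have : s * c < M by []. rewrite !lt_min => /and3P[sd sd1 sr].
have [|t tK Et] := @level_correction p (s *: x).
  by rewrite addrC -ltrBrDr (le_lt_trans sxc).
have hs : `|s *: x + t *: v0| <= s * c.
  apply: le_trans sxc; apply: le_trans (ler_normD _ _) _.
  by rewrite /A mulrDl mul1r lerD2l normrZ mulrAC ler_wpM2r.
have := H _ (le_lt_trans hs sd1); rewrite addrA => /(_ Et)[y ys [t' Et' [_ Hy]]].
have dp := dsigma pr.
have tt' : t = t'.
  have := congr1 (fun h => dd h sigma p) Et'.
  rewrite /= !ddDl// !ddZl// xs ys scaler0 !add0r => /eqP.
  rewrite -subr_eq0 -scalerBl scaler_eq0 subr_eq0 => /orP[/eqP//|].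
  by rewrite gt_eqF// (lt_le_trans m0)// sigma_incr.
have xy : y = s *: x by apply/esym/(@addIr _ (t *: v0)); rewrite [in RHS]tt'.
have Nq : N p <= N (p + s *: x + t *: v0).
  apply: pmin => //; rewrite -(addrA p) addrAC subrr add0r.
  exact: le_lt_trans sd.
rewrite -(pmulr_rge0 _ s0).
move: Hy; rewrite xy ddZl// ler_norml => /andP[_ Hy1].
have := ler_wpM2l (ltW (divr_gt0 e0 c0)) hs.
rewrite (_ : e / c * (s * c) = s * e); last by field; rewrite gt_eqF.
move: Hy1 Nq; rewrite -[s *: dd x N p]/(s * dd x N p) mulrDr; lra.
Qed.

(** Slide the segment joining two points of a level set back to it along [v0]:
    the image of the resulting curve has zero derivative. Choosing the
    corrections point by point is enough, as their uniqueness makes the curve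
    Lipschitz continuous. *)
Lemma level_set_constant k (F : 'rV[R]_n -> 'rV[R]_k) r :
  0 < r -> r * (1 + 4 * A) <= rho ->
  (forall q, `|q - u0| < rho -> differentiable F q) ->
  (forall q x, `|q - u0| < rho -> dd x sigma q = 0 -> dd x F q = 0) ->
  forall p p', `|p - u0| < r -> `|p' - u0| < r -> sigma p = sigma p' -> F p = F p'.
Proof.
move=> r0 rr dF F0 p p' pr p'r Ep.
have rrho : r <= rho.
  by apply: le_trans rr; rewrite ler_pMr// lerDl mulr_ge0// ltW.
pose w := p' - p.
have wr : `|w| < 2 * r.
  rewrite /w (_ : p' - p = (p' - u0) - (p - u0)); last by rewrite opprB addrA subrK.
  by apply: le_lt_trans (ler_normB _ _) _; rewrite mulr2n mulrDl mul1r ltrD.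
have B (s : R) : `|s| <= 2 -> `|p - u0| + A * `|s *: w| < rho.
  move=> s2; apply: lt_le_trans rr; rewrite mulrDr mulr1 ltr_leD//.
  rewrite (_ : r * (4 * A) = A * (2 * (2 * r))); last by ring.
  by rewrite ler_pM2l// normrZ ler_pM// ltW.
have tex (s : R) : exists t, `|s| <= 2 ->
    `|t| <= K * `|s *: w| /\ sigma (p + s *: w + t *: v0) = sigma p.
  have [s2|s2] := boolP (`|s| <= 2); last by exists 0.
  by have [t] := level_correction (B s s2); exists t.
have [t tP] := choice tex.
pose pt s := p + s *: w + t s *: v0.
have ptB (s : R) : `|s| <= 2 -> `|pt s - u0| < rho.
  move=> s2; apply: le_lt_trans (B s s2).
  rewrite (_ : pt s - u0 = (p - u0) + (s *: w + t s *: v0)); last first.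
    by rewrite /pt -(addrA p) addrAC.
  apply: le_trans (ler_normD _ _) _; rewrite lerD2l.
  apply: le_trans (ler_normD _ _) _; rewrite /A mulrDl mul1r lerD2l.
  by rewrite (normrZ (t s)) mulrAC ler_wpM2r//; exact: (tP s s2).1.
have pts (s : R) : `|s| <= 2 -> sigma (pt s) = sigma p by move=> s2; exact: (tP s s2).2.
have zero2 : `|0 : R| <= 2 by rewrite normr0.
have one2 : `|1 : R| <= 2 by rewrite normr1 ler1n.
have pt0 : pt 0 = p.
  have [t0 _] := tP 0 zero2; move: t0; rewrite scale0r normr0 mulr0 normr_le0 => /eqP t0.
  by rewrite /pt t0 !scale0r !addr0.
have pt1 : pt 1 = p'.
  have E1 : pt 1 = p' + (0 *: w + t 1 *: v0).
    by rewrite /pt scale0r add0r scale1r /w addrC (addrC p) subrK addrC.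
  have p'rho := lt_le_trans p'r rrho.
  have := level_correction_lip p'rho (ptB 1 one2) E1 (lexx `|w|).
  rewrite (pts 1 one2) => /(_ Ep); rewrite normr0 mulr0 normr_le0 => /eqP t1.
  by rewrite E1 t1 !scale0r !addr0.
pose c := `|w| + 1; have c0 : 0 < c by rewrite ltr_wpDl.
have flat (s : R) : `|s - 0| < 2 -> forall e : R, 0 < e -> exists2 d : R, 0 < d &
    forall h : R, `|h| < d -> `|F (pt (s + h)) - F (pt s)| <= e * `|h|.
  rewrite subr0 => s2 e e0; have s2' := ltW s2.
  have Ac : 0 < A * c by rewrite mulr_gt0.
  have [d d0 H] := level_increment (ptB s s2') (dF _ (ptB s s2')) (divr_gt0 e0 Ac).
  exists (Num.min (d / (A * c)) (2 - `|s|)); first by rewrite lt_min divr_gt0// subr_gt0.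
  move=> h; rewrite lt_min => /andP[hd hs].
  have sh2 : `|s + h| <= 2.
    by apply: le_trans (ler_normD _ _) _; rewrite addrC -lerBrDr ltW.
  have Eh : pt (s + h) = pt s + (h *: w + (t (s + h) - t s) *: v0).
    by rewrite /pt; apply/rowP => i; rewrite !mxE; ring.
  have wc : `|w| <= c by rewrite lerDl.
  have ss : sigma (pt (s + h)) = sigma (pt s) by rewrite !pts.
  have tl := level_correction_lip (ptB s s2') (ptB _ sh2) Eh wc ss.
  have Hle : `|h *: w + (t (s + h) - t s) *: v0| <= A * c * `|h|.
    apply: le_trans (ler_normD _ _) _; rewrite !normrZ.
    rewrite (_ : A * c * `|h| = `|h| * c + K * c * `|h| * `|v0|); last by rewrite /A; ring.
    by apply: lerD; [rewrite ler_wpM2l|rewrite ler_wpM2r].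
  have Hd : `|h *: w + (t (s + h) - t s) *: v0| < d.
    by apply: le_lt_trans Hle _; rewrite mulrC -ltr_pdivlMr.
  have [x xs [t' _ [_]]] := H _ Hd (etrans (congr1 sigma (esym Eh)) ss).
  rewrite F0//; last exact: ptB.
  rewrite subr0 -Eh => /le_trans; apply.
  have := ler_wpM2l (ltW (divr_gt0 e0 Ac)) Hle.
  by rewrite mulrA mulfVK// gt_eqF.
have G0 := @zero_derive_cstv R R k (fun s => F (pt s)) 0 2.
rewrite -pt1 -pt0; apply/esym/G0 => [s s2|s v s2|].
- by have [] := @flat_derivative R R 'rV[R]_k (fun s => F (pt s)) s (flat s s2).
- by have [_] := @flat_derivative R R 'rV[R]_k (fun s => F (pt s)) s (flat s s2).
- by rewrite subr0 normr1 ltr1n.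
Qed.

End LevelSets.

(** * Independence of the chart *)

Lemma sub_telescope (V : zmodType) (x a b c : V) :
  b - c = (x - a) - (x - b) + (a - c).
Proof. by rewrite opprB (addrC (x - a)) !subrKA. Qed.

Lemma sub_telescope2 (V : zmodType) (x a b : V) : (x - b) - (x - a) = a - b.
Proof. by rewrite opprB addrC subrKA. Qed.

Lemma mulmx_norm_le {R : realType} {m n} (B : 'M[R]_(m, n)) :
  exists2 C, 0 < C & forall x : 'rV[R]_m, `|x *m B| <= C * `|x|.
Proof.
have S0 : 0 <= \sum_j \sum_k `|B j k| by apply: sumr_ge0 => j _; exact: sumr_ge0.
exists (\sum_j \sum_k `|B j k| + 1); first by rewrite ltr_wpDl.
move=> x; apply: norm_row_le => [|k]; first by rewrite mulr_ge0// addr_ge0.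
rewrite mxE; apply: le_trans (ler_norm_sum _ _ _) _.
apply: (@le_trans _ _ ((\sum_j \sum_k `|B j k|) * `|x|)); last first.
  by rewrite ler_wpM2r// lerDl.
rewrite mulr_suml; apply: ler_sum => j _.
rewrite normrM mulrC; apply: ler_pM => //; last exact: norm_coord_le.
by rewrite (bigD1 k)//= lerDl sumr_ge0.
Qed.

Lemma bform_norm_le {R : realType} {n} (S : 'M[R]_n) :
  exists2 C, 0 < C & forall x y, `|bform S x y| <= C * (`|x| * `|y|).
Proof.
have [C C0 HC] := mulmx_norm_le S.
exists (n%:R * C + 1); first by rewrite ltr_wpDl// mulr_ge0// ltW.
move=> x y; apply: le_trans (dotp_norm_le _ _) _.
apply: (@le_trans _ _ (n%:R * (C * `|x| * `|y|))).
  by rewrite ler_wpM2l// ler_wpM2r.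
by rewrite -!mulrA mulrA mulrDl mul1r lerDl mulr_ge0.
Qed.

(** Rolle's theorem for [psi (u + s h) - c s^2] between [0] and [1], with [c] the total
    increment, gives [d_h psi (u + s h) = 2 s c] for some [s], and the left-hand
    side is [s d_h d_h psi (u)] up to a negligible error since [u] is critical. *)
Lemma taylor_critical {R : realType} {n} (U : set 'rV[R]_n) (psi : 'rV[R]_n -> R) u e :
  open U -> smooth_on U psi -> U u -> (forall h, dd h psi u = 0) -> 0 < e ->
  exists2 d, 0 < d & forall h, `|h| < d ->
    `|psi (u + h) - psi u - 2^-1 * dd h (dd h psi) u| <= e * `|h| ^+ 2.
Proof.
move=> oU sp Uu crit e0.
pose E i : 'rV[R]_n := delta_mx 0 i.
have dp y : U y -> differentiable psi y by exact: smooth_differentiable.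
have dE i : differentiable (dd (E i) psi) u.
  by apply: smooth_differentiable Uu; exact: smooth_dd.
have nn : 0 < n%:R + 1 :> R by rewrite ltr_wpDl.
have en : 0 < e / (n%:R + 1) by rewrite divr_gt0.
have /choice[d dP] : forall i, exists d, 0 < d /\ forall h, `|h| < d ->
    `|dd (E i) psi (u + h) - dd (E i) psi u - dd h (dd (E i) psi) u| <= e / (n%:R + 1) * `|h|.
  by move=> i; have [d d0 H] := dd_approx (dE i) en; exists d.
have /(nbhs0P U u).1/nbhs_norm0P[r r0 /= Hr] : \near u, U u by exact: open_nbhs_nbhs.
pose D := \big[Num.min/r]_i d i.
have D0 : 0 < D by apply/bigmin_gtP; split=> // i _; exact: (dP i).1.
exists D => // h hD.
have hU s : 0 <= s <= 1 -> `|s *: h| < D.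
  move=> /andP[s0 s1]; apply: le_lt_trans hD; rewrite normrZ ger0_norm//.
  by rewrite ler_piMl.
have inU s : 0 <= s <= 1 -> U (u + s *: h).
  by move=> /hU sh; apply: Hr; apply: lt_le_trans sh _; exact: bigmin_le_id.
pose c := psi (u + h) - psi u.
pose g (s : R) := psi (u + s *: h) - c * s ^+ 2.
have dg (s : R) : 0 <= s <= 1 -> is_derive s 1 g (dd h psi (u + s *: h) - c * (2 * s)).
  move=> s01; apply: is_deriveB.
    by rewrite ddE; apply: is_derive_line; apply: dp; exact: inU.
  by apply: is_derive_eq; rewrite /GRing.scale/= !mulr1; ring.
have [||| s] := @Rolle R g 0 1 ltr01.
- move=> s; rewrite in_itv/= => /andP[s0 s1].
  by have [] := dg s; rewrite ?ltW.
- apply: derivable_within_continuous => s; rewrite in_itv/= => s01.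
  by have [] := dg s s01.
- by rewrite /g scale0r addr0 scale1r expr0n expr1n /c mulr0 mulr1; ring.
rewrite in_itv/= => /andP[s0 s1] ds.
have s01 : 0 <= s <= 1 by rewrite !ltW.
have Es : dd h psi (u + s *: h) = c * (2 * s).
  apply/eqP; rewrite -subr_eq0 -(@derive_val _ _ _ _ _ _ _ (dg s s01)).
  by rewrite (@derive_val _ _ _ _ _ _ _ ds).
have EQ : dd h (dd h psi) u = \sum_i h 0 i * dd h (dd (E i) psi) u.
  rewrite dd_row_sum; last by apply: smooth_differentiable Uu; exact: smooth_dd.
  by apply: eq_bigr => i _; rewrite (dd_comm1 _ _ oU sp Uu).
have H : `|c * (2 * s) - s * dd h (dd h psi) u| <= s * (e * `|h| ^+ 2).
  rewrite -Es EQ dd_row_sum; last exact/dp/inU.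
  rewrite mulr_sumr -sumrB; apply: le_trans (ler_norm_sum _ _ _) _.
  apply: (@le_trans _ _ (\sum_(i < n) (s * (e / (n%:R + 1) * `|h| ^+ 2)))).
    apply: ler_sum => i _.
    have := (dP i).2 _ (lt_le_trans (hU s s01) (bigmin_le _ _ _ : D <= d i)).
    rewrite crit subr0 ddZl// => Hi.
    rewrite -[_ *: dd _ _ _]/(_ * _) mulrCA -mulrBr normrM.
    apply: le_trans (ler_pM _ _ (norm_coord_le h i) Hi) _ => //.
    rewrite normrZ gtr0_norm//.
    by rewrite le_eqVlt; apply/orP; left; apply/eqP; ring.
  rewrite sumr_const card_ord -[X in X <= _]mulr_natl mulrCA ler_pM2l// mulrA ler_wpM2r ?sqr_ge0//.
  by rewrite mulrCA ler_piMr ?(ltW e0)// ler_pdivrMr// mul1r lerDl.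
have : s * `|c - 2^-1 * dd h (dd h psi) u| <= s * (2^-1 * (e * `|h| ^+ 2)).
  rewrite -[X in X * `|_|]gtr0_norm// -normrM.
  have -> : s * (c - 2^-1 * dd h (dd h psi) u) = 2^-1 * (c * (2 * s) - s * dd h (dd h psi) u).
    by field.
  by rewrite normrM [X in X * _]gtr0_norm ?invr_gt0// [leRHS]mulrCA ler_pM2l ?invr_gt0.
rewrite ler_pM2l// => /le_trans; apply.
by rewrite ler_piMl ?mulr_ge0 ?sqr_ge0 ?(ltW e0)// invf_le1// ler1n.
Qed.

Section Comparison.
Context {R : realType} {n : nat}.
Variables (M : set 'rV[R]_n.+1) (U U' : set 'rV[R]_n).
Variables (f f' : 'rV[R]_n -> 'rV[R]_n.+1) (u u' : 'rV[R]_n).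
Hypotheses (fM : local_param M U f) (fM' : local_param M U' f').
Hypotheses (Uu : U u) (Uu' : U' u') (Euu : f u = f' u').

Let sf : smooth_on U f. Proof. by case: fM. Qed.
Let sf' : smooth_on U' f'. Proof. by case: fM'. Qed.
Let oU : open U. Proof. by case: fM. Qed.
Let oU' : open U'. Proof. by case: fM'. Qed.
Let df : differentiable f u. Proof. exact: smooth_differentiable Uu. Qed.
Let df' : differentiable f' u'. Proof. exact: smooth_differentiable Uu'. Qed.

Let P : 'M[R]_(n, n.+1) := \matrix_i partial i f u.
Let P' : 'M[R]_(n, n.+1) := \matrix_i partial i f' u'.

Let ddP v : dd v f u = v *m P.
Proof.
rewrite dd_row_sum// mulmx_sum_row; apply: eq_bigr => i _.
by rewrite rowK partialE.
Qed.

Let ddP' v : dd v f' u' = v *m P'.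
Proof.
rewrite dd_row_sum// mulmx_sum_row; apply: eq_bigr => i _.
by rewrite rowK partialE.
Qed.

(** Both charts are open onto their images in [M], so that nearby points of one
    are nearby points of the other. *)
Let chart_lift d : 0 < d -> exists2 r, 0 < r & forall h, `|h| < r ->
  U (u + h) /\ exists2 w, `|w| < d & U' (u' + w) /\ f' (u' + w) = f (u + h).
Proof.
move=> d0; have [_ _ _ _ fop] := fM; have [_ _ _ _ fop'] := fM'.
pose V' := U' `&` [set x | `|x - u'| < d].
have oV' : open V'.
  apply: openI => //; rewrite (_ : [set x | _] = ball u' d); first exact: ball_open.
  by apply/seteqP; split=> x /=; rewrite -ball_normE /= distrC.
have [W oW EW] := fop' V' oV' (fun x => @proj1 _ _).
have Wq : W (f u).
  suff : (M `&` W) (f u) by case.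
  by rewrite -EW Euu; exists u' => //; split=> //=; rewrite subrr normr0.
have cf := differentiable_continuous df.
have nW : \forall x \near u, U x /\ W (f x).
  apply: filterI; first exact: open_nbhs_nbhs.
  by apply: cf; exact: open_nbhs_nbhs.
have /(nbhs0P _ u).1/nbhs_norm0P[r r0 /= Hr] := nW.
exists r => // h hr; have [Uh Wh] := Hr h hr; split=> //.
have [W0 _ EW0] := fop U oU (fun x => id).
have Mh : M (f (u + h)).
  suff : (M `&` W0) (f (u + h)) by case.
  by rewrite -EW0; exists (u + h).
have : (f' @` V') (f (u + h)) by rewrite EW; split.
move=> [x' [U'x' /= x'd] Ex']; exists (x' - u') => //.
by rewrite addrC subrK.
Qed.

Let left_inverse : exists B : 'M[R]_(n.+1, n), P' *m B = 1%:M.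
Proof. by have [_ _ _ rf _] := fM'; apply/row_freeP; exact: rf. Qed.

(** A left inverse of the frame of [f'], applied to the displacement common to
    both charts, recovers [w] up to [o(t)]. *)
Let lift_expansion B (v : 'rV[R]_n) (e : R) : P' *m B = 1%:M -> 0 < e ->
  exists2 r, 0 < r & forall t : R, 0 < t -> t < r -> U (u + t *: v) /\
    exists w, [/\ U' (u' + w), f' (u' + w) = f (u + t *: v)
       & `|w - t *: (v *m P *m B)| <= e * t].
Proof.
move=> PB e0; set v' := v *m P *m B.
have [C C0 HC] := mulmx_norm_le B.
pose K := 2 * `|v'| + 2 * `|v| + 1.
have K0 : 0 < K by rewrite ltr_wpDl// addr_ge0// mulr_ge0.
pose e1 := Num.min (2^-1 / C) (e / (C * (K + `|v|))).
have Kv : 0 < K + `|v| by rewrite ltr_pwDl.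
have e10 : 0 < e1 by rewrite lt_min !(divr_gt0, mulr_gt0, invr_gt0).
have [d1 d10 H1] := dd_approx df e10.
have [d2 d20 H2] := dd_approx df' e10.
have [r r0 Hr] := chart_lift d20.
pose v1 := `|v| + 1; have v10 : 0 < v1 by rewrite ltr_wpDl.
exists (Num.min r d1 / v1); first by rewrite divr_gt0// lt_min r0.
move=> t t0; rewrite ltr_pdivlMr// => tv1.
have tv : `|t *: v| < Num.min r d1.
  by apply: le_lt_trans tv1; rewrite normrZ gtr0_norm// ler_pM2l// lerDl.
move: tv; rewrite lt_min => /andP[tvr tvd].
have [Utv [w wd [U'w Ew]]] := Hr _ tvr; split=> //.
exists w; split=> //.
have A1 := H1 _ tvd; have A2 := H2 _ wd.
rewrite Ew -Euu in A2.
have Ediff : w - t *: v' = ((f (u + t *: v) - f u - dd (t *: v) f u)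
    - (f (u + t *: v) - f u - dd w f' u')) *m B.
  rewrite ddP ddP' (_ : _ - _ - _ - _ = w *m P' - (t *: v) *m P); last first.
    exact: sub_telescope2.
  by rewrite mulmxBl -(mulmxA w) PB mulmx1 -!scalemxAl.
have A3 : `|w - t *: v'| <= C * (e1 * `|t *: v| + e1 * `|w|).
  rewrite Ediff; apply: le_trans (HC _) _; rewrite ler_pM2l//.
  by apply: le_trans (ler_normB _ _) _; exact: lerD.
rewrite normrZ gtr0_norm// in A3.
have Ce : C * e1 <= 2^-1 by rewrite mulrC -ler_pdivlMr// ge_min lexx.
have wt : `|w| <= t * K.
  have : `|w| <= `|w - t *: v'| + t * `|v'|.
    rewrite -[X in _ + X * _]gtr0_norm// -normrZ.
    by apply: le_trans (ler_normD _ _); rewrite subrK.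
  have : C * (e1 * (t * `|v|) + e1 * `|w|) <= 2^-1 * (t * `|v|) + 2^-1 * `|w|.
    rewrite mulrDr; apply: lerD; rewrite mulrA ler_wpM2r//.
    by rewrite mulr_ge0// ltW.
  rewrite /K; have : 0 <= t * `|v| by rewrite mulr_ge0// ltW.
  lra.
apply: (le_trans A3).
rewrite -mulrDr mulrA.
apply: (@le_trans _ _ (C * (e / (C * (K + `|v|))) * (t * (K + `|v|)))).
  apply: ler_pM => //.
  - by rewrite mulr_ge0// ltW.
  - by rewrite addr_ge0// mulr_ge0// ltW.
  - by rewrite ler_pM2l// ge_min lexx orbT.
  - by rewrite mulrDr addrC lerD2r.
by rewrite le_eqVlt; apply/orP; left; apply/eqP; field; rewrite !gt_eqF.
Qed.

(** The tangent spaces agree because both are read off the same displacement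
    [f (u + t v) - f u]. *)
Let tangent_agree B (v : 'rV[R]_n) : P' *m B = 1%:M -> v *m P = v *m P *m B *m P'.
Proof.
move=> PB; apply/eqP; rewrite -subr_eq0 -normr_le0; apply/ler_addgt0Pl => e e0.
rewrite addr0; set v' := v *m P *m B.
have [C C0 HC] := mulmx_norm_le P'.
pose K := `|v| + `|v'| + 1 + C; have K0 : 0 < K by rewrite ltr_wpDl// !addr_ge0.
pose e1 := Num.min 1 (e / K).
have e10 : 0 < e1 by rewrite lt_min ltr01 divr_gt0.
have [d1 d10 H1] := dd_approx df e10.
have [d2 d20 H2] := dd_approx df' e10.
have [r r0 Hr] := lift_expansion v PB e10.
pose V := `|v| + `|v'| + 1; have V0 : 0 < V by rewrite ltr_wpDl// addr_ge0.
pose t := Num.min r (Num.min d1 d2 / V) / 2.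
have m0 : 0 < Num.min r (Num.min d1 d2 / V) by rewrite lt_min r0 divr_gt0// lt_min d10.
have t0 : 0 < t by rewrite divr_gt0.
have : t < Num.min r (Num.min d1 d2 / V).
  by rewrite gtr_pMr// invf_lt1// ltr1n.
rewrite lt_min ltr_pdivlMr// lt_min => /andP[tr /andP[td1 td2]].
have [Ut [w [U'w Ew wt]]] := Hr t t0 tr.
have nv : `|t *: v| = t * `|v| by rewrite normrZ gtr0_norm.
have nw : `|w| <= t * (`|v'| + 1).
  rewrite -(subrK (t *: v') w); apply: le_trans (ler_normD _ _) _.
  rewrite normrZ gtr0_norm// mulrDr mulr1 addrC lerD2l (le_trans wt)//.
  by rewrite ler_piMl ?(ltW t0)// ge_min lexx.
have A1 : `|f (u + t *: v) - f u - dd (t *: v) f u| <= e1 * `|t *: v|.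
  by apply: H1; rewrite nv; apply: le_lt_trans td1; rewrite ler_pM2l// /V -addrA lerDl addr_ge0.
have A2 : `|f' (u' + w) - f' u' - dd w f' u'| <= e1 * `|w|.
  by apply: H2; apply: le_lt_trans nw _; apply: le_lt_trans td2; rewrite ler_pM2l// /V -addrA lerDr.
rewrite Ew -Euu in A2.
have E : t *: (v *m P - v' *m P') = (f (u + t *: v) - f u - dd w f' u')
    - (f (u + t *: v) - f u - dd (t *: v) f u) + (w - t *: v') *m P'.
  rewrite ddP ddP' mulmxBl -!scalemxAl scalerBr.
  exact: sub_telescope.
rewrite -(ler_pM2l t0) -[X in X * `|_|]gtr0_norm// -normrZ E.
apply: le_trans (ler_normD _ _) _.
apply: le_trans (lerD (ler_normB _ _) (HC _)) _.
apply: le_trans (lerD (lerD A2 A1) (ler_wpM2l (ltW C0) wt)) _.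
rewrite nv; apply: (@le_trans _ _ (e1 * (t * (`|v'| + 1)) + e1 * (t * `|v|) + C * (e1 * t))).
  by rewrite !lerD2r ler_pM2l.
rewrite (_ : _ + _ + _ = t * (e1 * K)); last by rewrite /K; ring.
by rewrite ler_pM2l// -ler_pdivlMr// ge_min lexx orbT.
Qed.

(** The height over the common tangent hyperplane has a critical point at the
    given point in either chart; its second order expansions at the same points
    of [M] are compared. *)
Let second_agree B (v : 'rV[R]_n) nu : P' *m B = 1%:M ->
  (forall h, dotp (dd h f u) nu = 0) -> (forall h, dotp (dd h f' u') nu = 0) ->
  bform (second_form f u nu) v v =
  bform (second_form f' u' nu) (v *m P *m B) (v *m P *m B).
Proof.
move=> PB N N'; set v' := v *m P *m B; set S' := second_form f' u' nu.
apply: (etrans (bform_second_form oU sf nu Uu v v)).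
set Q := dotp (dd v (dd v f) u) nu; pose Q' := bform S' v' v'.
have psiE (X : set 'rV[R]_n) (F : 'rV[R]_n -> 'rV[R]_n.+1) (x : 'rV[R]_n) h :
    open X -> smooth_on X F -> X x ->
    dd h (fun y => dotp (F y) nu) x = dotp (dd h F x) nu.
  move=> oX sF Xx; rewrite (@dd_dotp _ _ _ h F (fun=> nu)).
  - by rewrite dd_cst dotp0r addr0.
  - exact: smooth_differentiable Xx.
  - exact: differentiable_cst.
have psi2E (X : set 'rV[R]_n) (F : 'rV[R]_n -> 'rV[R]_n.+1) (x : 'rV[R]_n) h :
    open X -> smooth_on X F -> X x ->
    dd h (dd h (fun y => dotp (F y) nu)) x = dotp (dd h (dd h F) x) nu.
  move=> oX sF Xx; rewrite -(psiE X (dd h F) x h oX (smooth_dd h sF) Xx).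
  by apply: (dd_ext h oX Xx) => y Xy; exact: (psiE X F y h oX sF Xy).
have [C C0 HC] := bform_norm_le S'.
pose K := 2 * (`|v| ^+ 2) + 2 * (`|v'| + 1) ^+ 2 + C * (2 * `|v'| + 1) + 1.
have K0 : 0 < K.
  by rewrite ltr_wpDl// !addr_ge0 ?mulr_ge0 ?sqr_ge0 ?addr_ge0 ?mulr_ge0// ltW.
apply/eqP; rewrite -subr_eq0 -normr_le0; apply/ler_addgt0Pl => e e0; rewrite addr0.
pose e1 := Num.min 1 (e / K).
have e10 : 0 < e1 by rewrite lt_min ltr01 divr_gt0.
have e11 : e1 <= 1 by rewrite ge_min lexx.
have spsi : smooth_on U (fun y => dotp (f y) nu) by apply: smooth_dotp => //; exact: smooth_cst.
have spsi' : smooth_on U' (fun y => dotp (f' y) nu) by apply: smooth_dotp => //; exact: smooth_cst.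
have [d1 d10 H1] := taylor_critical oU spsi Uu (fun h => etrans (psiE U f u h oU sf Uu) (N h)) e10.
have [d2 d20 H2] := taylor_critical oU' spsi' Uu' (fun h => etrans (psiE U' f' u' h oU' sf' Uu') (N' h)) e10.
have [r r0 Hr] := lift_expansion v PB e10.
pose V := `|v| + `|v'| + 1; have V0 : 0 < V by rewrite ltr_wpDl// addr_ge0.
pose t := Num.min r (Num.min d1 d2 / V) / 2.
have m0 : 0 < Num.min r (Num.min d1 d2 / V) by rewrite lt_min r0 divr_gt0// lt_min d10.
have t0 : 0 < t by rewrite divr_gt0.
have : t < Num.min r (Num.min d1 d2 / V) by rewrite gtr_pMr// invf_lt1// ltr1n.
rewrite lt_min ltr_pdivlMr// lt_min => /andP[tr /andP[td1 td2]].
have [Ut [w [U'w Ew wt]]] := Hr t t0 tr.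
have nv : `|t *: v| = t * `|v| by rewrite normrZ gtr0_norm.
have nw : `|w| <= t * (`|v'| + 1).
  rewrite -(subrK (t *: v') w); apply: le_trans (ler_normD _ _) _.
  rewrite normrZ gtr0_norm// mulrDr mulr1 addrC lerD2l (le_trans wt)//.
  by rewrite ler_piMl ?(ltW t0).
have := H1 (t *: v); rewrite nv (psi2E U f u (t *: v) oU sf Uu) ddZl; last first.
  by apply: smooth_differentiable Uu; exact: smooth_dd.
have -> : dd v (dd (t *: v) f) u = t *: dd v (dd v f) u.
  have E y : U y -> dd (t *: v) f y = t *: dd v f y.
    by move=> Uy; rewrite ddZl//; exact: smooth_differentiable Uy.
  rewrite (dd_ext v oU Uu E) (dd_scale v (a := fun=> t)).
  - by rewrite dd_cst scale0r add0r.
  - exact: differentiable_cst.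
  - by apply: smooth_differentiable Uu; exact: smooth_dd.
rewrite !dotpZl -/Q => A1.
have {}A1 := A1 (le_lt_trans (ler_wpM2l (ltW t0) (_ : _ <= V)) td1).
have {}A1 : `|dotp (f (u + t *: v)) nu - dotp (f u) nu - 2^-1 * (t * (t * Q))| <= e1 * (t * `|v|) ^+ 2.
  by apply: A1; rewrite /V -addrA lerDl addr_ge0.
have A2 : `|dotp (f' (u' + w)) nu - dotp (f' u') nu - 2^-1 * bform S' w w| <= e1 * `|w| ^+ 2.
  have := H2 w; rewrite (psi2E U' f' u' w oU' sf' Uu') -(bform_second_form oU' sf' nu Uu' w w); apply.
  by apply: le_lt_trans nw _; apply: le_lt_trans td2; rewrite ler_pM2l// /V -addrA lerDr.
rewrite Ew -Euu in A2.
have A3 : `|bform S' w w - t ^+ 2 * Q'| <= C * (e1 * t ^+ 2 * (2 * `|v'| + 1)).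
  have [z Ez zt] : exists2 z, w = t *: v' + z & `|z| <= e1 * t.
    by exists (w - t *: v') => //; rewrite addrC subrK.
  have -> : bform S' w w - t ^+ 2 * Q' = bform S' (2 * t *: v' + z) z.
    rewrite Ez !bformE (bformC z v' (second_form_sym oU' sf' nu Uu')) /Q'.
    by ring.
  apply: le_trans (HC _ _) _; rewrite ler_pM2l//.
  have h1 : `|2 * t *: v' + z| <= t * (2 * `|v'| + 1).
    apply: le_trans (ler_normD _ _) _; rewrite normrZ normrM !gtr0_norm//.
    have : e1 * t <= t by rewrite ler_piMl// ltW.
    lra.
  apply: le_trans (ler_pM _ _ h1 zt) _ => //.
  by rewrite le_eqVlt; apply/orP; left; apply/eqP; ring.
have A4 : `|w| ^+ 2 <= t ^+ 2 * (`|v'| + 1) ^+ 2.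
  rewrite -exprMn; apply: lerXn2r => //; rewrite nnegrE//.
  exact: le_trans (normr_ge0 w) nw.
have t20 : 0 < t ^+ 2 by rewrite exprn_gt0.
rewrite -(ler_pM2l t20).
have -> : t ^+ 2 * `|Q - Q'| = `|t ^+ 2 * (Q - Q')| by rewrite normrM (gtr0_norm t20).
have -> : t ^+ 2 * (Q - Q') =
  (bform S' w w - t ^+ 2 * Q')
  + 2 * (dotp (f (u + t *: v)) nu - dotp (f u) nu - 2^-1 * bform S' w w)
  - 2 * (dotp (f (u + t *: v)) nu - dotp (f u) nu - 2^-1 * (t * (t * Q))) by field.
apply: le_trans (ler_normB _ _) _.
apply: le_trans (lerD (ler_normD _ _) (lexx _)) _.
rewrite (normrM 2) (normrM 2 (_ - _ - 2^-1 * (t * _))) (gtr0_norm (ltr0n R 2)).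
apply: (@le_trans _ _ (t ^+ 2 * (e1 * K))).
  have h2 : e1 * `|w| ^+ 2 <= e1 * (t ^+ 2 * (`|v'| + 1) ^+ 2) by rewrite ler_pM2l.
  have h3 : 0 <= t ^+ 2 * e1 by rewrite mulr_ge0// ltW.
  rewrite (_ : t ^+ 2 * (e1 * K) = 2 * (e1 * (t * `|v|) ^+ 2)
    + 2 * (e1 * (t ^+ 2 * (`|v'| + 1) ^+ 2))
    + C * (e1 * t ^+ 2 * (2 * `|v'| + 1)) + t ^+ 2 * e1); last by rewrite /K; ring.
  lra.
by rewrite ler_pM2l// -ler_pdivlMr// ge_min lexx orbT.
Qed.

(** The second forms computed in two charts are intertwined by the linear map
    relating the tangent frames, up to the sign [ep] relating the unit normals,
    and [quasi_umbilic_unique] compares the coefficients. First and second derivatives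
    are compared through the expansions of [f] and [f'] at the points of [M] lying
    over [u + t v]. *)
Lemma umbilic_type_independent (lam : 'rV[R]_n -> R) nu nu' al be et a b th :
  (3 <= n)%N ->
  (forall y, U y -> metric f y = (lam y)%:M) -> (forall y, U y -> 0 < lam y) ->
  quasi_umbilic f u nu al be et -> quasi_umbilic f' u' nu' a b th ->
  (a == 0) = (al == 0) /\ (b == 0) = (be == 0).
Proof.
move=> n3 mE l0 qu qu'; have [nuP _ _] := qu; have [nuP' cov' frm'] := qu'.
have [B PB] := left_inverse; pose J := P *m B.
have PJ v : v *m P *m B = v *m J by rewrite mulmxA.
have TA v : dd v f u = dd (v *m J) f' u'.
  by rewrite ddP ddP' -PJ; exact: tangent_agree.
have N v : dotp (dd v f u) nu = 0 by exact: (dotp_tangent_normal sf Uu nuP).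
have N' v : dotp (dd v f' u') nu' = 0 by exact: (dotp_tangent_normal sf' Uu' nuP').
have lu := l0 u Uu.
have uJ : J \in unitmx.
  rewrite -row_free_unit -kermx_eq0; apply/rowV0P => v /sub_kermxP vJ.
  have := dotp_tangent sf mE v v Uu.
  rewrite TA vJ ddP' mul0mx dotp0l => /esym/eqP; rewrite mulf_eq0 (gt_eqF lu) dotp_eq0.
  by move/eqP.
have NN v : dotp (dd v f u) nu' = 0 by rewrite TA.
have NN' v : dotp (dd v f' u') nu' = 0 by [].
pose ep := dotp nu' nu.
have Enu : nu' = ep *: nu.
  rewrite {1}(tangent_partP sf mE l0 Uu nuP nu').
  rewrite (_ : tangent_part _ _ _ _ = 0) ?ddP ?mul0mx ?add0r//.
  apply/rowP => i; rewrite !mxE partialE dotpC NN mul0r.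
  by [].
have ep2 : ep ^+ 2 = 1.
  by have := nuP'.1; rewrite Enu !dotpE nuP.1 mulr1 -expr2.
have ep0 : ep != 0 by apply: contra_eq_neq ep2 => ->; rewrite expr0n/= eq_sym oner_eq0.
have SA v := second_agree v PB NN NN'.
have th0 : th != 0.
  apply/eqP => th0; move: cov'; rewrite /unit_covector th0 !mul0mx => /matrixP/(_ 0 0).
  by rewrite !mxE => /esym/eqP; rewrite oner_eq0.
have /(quasi_umbilicP mE l0 _ _ _ Uu nuP)[ee H] := qu.
have et0 : et != 0 by rewrite -dotp_eq0 ee gt_eqF.
have thJ : th *m J^T != 0.
  apply: contraNneq th0 => thJ.
  by rewrite -(mulmxK (_ : J^T \in unitmx) th) ?unitmx_tr// thJ mul0mx.
have dotpJ v w : dotp (v *m J) w = dotp v (w *m J^T).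
  suff : (dotp (v *m J) w)%:M = (dotp v (w *m J^T))%:M :> 'M[R]_1.
    by move/matrixP/(_ 0 0); rewrite !mxE.
  by rewrite -!dotp_mx (trmx_mul w) trmxK -(mulmxA v J).
have metJ w : bform (metric f' u') w w = dotp (dd w f' u') (dd w f' u').
  have -> : metric f' u' = P' *m P'^T.
    apply/matrixP => i j; rewrite !mxE; apply: eq_bigr => k _.
    by rewrite !mxE.
  rewrite ddP' /bform mulmxA.
  suff : (dotp (w *m P' *m P'^T) w)%:M = (dotp (w *m P') (w *m P'))%:M :> 'M[R]_1.
    by move/matrixP/(_ 0 0); rewrite !mxE.
  by rewrite -!dotp_mx trmx_mul !mulmxA.
have E v : al * (lam u * dotp v v) + be * dotp v et ^+ 2
    = (ep * a) * (lam u * dotp v v) + (ep * b) * dotp v (th *m J^T) ^+ 2.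
  have h1 := H v v; rewrite -expr2 in h1; rewrite -h1.
  have -> : bform (second_form f u nu) v v = ep * bform (second_form f u nu') v v.
    apply: (etrans (bform_second_form oU sf nu Uu v v)).
    apply: (etrans _ (congr1 ( *%R ep) (esym (bform_second_form oU sf nu' Uu v v)))).
    by rewrite Enu dotpZr mulrA -expr2 ep2 mul1r.
  rewrite SA frm' PJ.
  have -> : bform (a *: metric f' u' + b *: (th^T *m th)) (v *m J) (v *m J)
      = a * (lam u * dotp v v) + b * dotp v (th *m J^T) ^+ 2.
    rewrite /bform mulmxDr -!scalemxAr dotpDl !dotpZl -/(bform _ _ _) metJ -TA.
    rewrite (dotp_tangent sf mE v v Uu); congr (_ + b * _).
    by rewrite mulmxA dotp_mx mul_scalar_mx dotpZl dotpJ (dotpC th) dotpJ expr2.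
  by ring.
have [Ea Eb] := quasi_umbilic_unique n3 (lt0r_neq0 lu) et0 thJ E.
by rewrite Ea Eb !mulf_eq0 !(negbTE ep0).
Qed.

End Comparison.

(** * Feet of perpendiculars *)

Section LocalParam.
Context {R : realType} {n : nat}.
Implicit Types (M : set 'rV[R]_n.+1) (U V : set 'rV[R]_n) (f : 'rV[R]_n -> 'rV[R]_n.+1).

Lemma local_param_sub M U V f : open V -> V `<=` U ->
  local_param M U f -> local_param M V f.
Proof.
move=> oV VU [oU sf fi rf fo]; split=> //.
- exact: smooth_sub VU sf.
- move=> x y /set_mem/VU Ux /set_mem/VU Uy; apply: fi; exact: mem_set.
- by move=> u /VU; exact: rf.
- by move=> V' oV' V'V; apply: fo => // x /V'V/VU.
Qed.

Lemma local_param_image M U f : local_param M U f -> local_param (f @` U) U f.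
Proof.
move=> [oU sf fi rf fo]; split=> // V oV VU.
have [W oW EW] := fo V oV VU; exists W => //.
have [W0 _ EW0] := fo U oU (fun x => id).
apply/seteqP; split=> y fy.
  split; first by case: fy => x /VU Ux <-; exists x.
  by move: fy; rewrite EW => -[].
by case: fy; rewrite EW0 EW => -[My _] Wy; split.
Qed.

Lemma quasi_umbilic_on_sub U V f nu a b eta : V `<=` U ->
  quasi_umbilic_on U f nu a b eta -> quasi_umbilic_on V f nu a b eta.
Proof.
move=> VU [s1 s2 s3 s4 q]; split; try exact: smooth_sub VU _.
by move=> u /VU; exact: q.
Qed.

End LocalParam.

Section Foot.
Context {R : realType} {n : nat}.
Variables (U : set 'rV[R]_n) (f : 'rV[R]_n -> 'rV[R]_n.+1).
Hypotheses (sf : smooth_on U f) (fi : {in U &, injective f}).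
Variables (u0 : 'rV[R]_n) (rho : R).
Hypotheses (rho0 : 0 < rho) (BU : forall x, `|x - u0| <= rho -> U x).

(** Squared distance, smooth in both arguments, for the scalar product; the norm
    of a row is the supremum norm. *)
Definition sqdist (x y : 'rV[R]_n.+1) : R := dotp (x - y) (x - y).

Lemma sqdistC x y : sqdist x y = sqdist y x.
Proof. by rewrite /sqdist -opprB dotpNl dotpNr opprK. Qed.

Lemma sqdist_triangle x y z : sqdist x z <= 2 * sqdist x y + 2 * sqdist y z.
Proof.
rewrite /sqdist; have -> : x - z = (x - y) + (y - z) by rewrite subrKA.
have := dotp_ge0 ((x - y) - (y - z)).
rewrite !(dotpBl (x - y) (y - z)) !(dotpBr (x - y) (y - z)).
rewrite !(dotpDl (x - y) (y - z)) !(dotpDr (x - y) (y - z)).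
rewrite (dotpC (y - z) (x - y)); lra.
Qed.

Let df x : `|x - u0| <= rho -> differentiable f x.
Proof. by move/BU; exact: smooth_differentiable. Qed.

Lemma differentiable_sqdist y x : differentiable f x ->
  differentiable (fun x => sqdist (f x) y) x.
Proof.
have E : (fun x => sqdist (f x) y) = (fun x => dotp (f x + - y) (f x + - y)) by [].
move=> dfx; rewrite E; apply: differentiable_dotp;
  by apply: differentiableD => //; exact: differentiable_cst.
Qed.

Lemma dd_sqdist y x v : differentiable f x ->
  dd v (fun x => sqdist (f x) y) x = 2 * dotp (f x - y) (dd v f x).
Proof.
move=> dfx; have dy : differentiable (fun=> - y : 'rV[R]_n.+1) x by exact: differentiable_cst.
have dfy : differentiable (fun x => f x + - y) x by exact: differentiableD.
rewrite (dd_dotp v dfy dfy) (ddD v dfx dy) dd_cst addr0 (dotpC (dd v f x)).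
by ring.
Qed.

Lemma continuous_norm_sub : continuous (fun x : 'rV[R]_n => `|x - u0|).
Proof.
move=> x; apply: (@continuous_comp _ _ _ (fun x : 'rV[R]_n => x - u0) Num.norm).
  by apply: continuousB => //; exact: cst_continuous.
exact: norm_continuous.
Qed.

Lemma closed_ball_rV : closed [set x : 'rV[R]_n | `|x - u0| <= rho].
Proof.
rewrite (_ : [set x | _] = (fun x : 'rV[R]_n => `|x - u0|) @^-1` [set y : R | y <= rho]) //.
apply: preimage_closed; last exact: closed_le.
by move=> x _; exact: continuous_norm_sub.
Qed.

Lemma bounded_ball_rV : bounded_set [set x : 'rV[R]_n | `|x - u0| <= rho].
Proof.
exists (rho + `|u0|); split=> [|r rr x /= xr]; first exact: num_real.
apply: le_trans (ltW rr); rewrite -{1}(subrK u0 x).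
by apply: le_trans (ler_normD _ _) _; rewrite lerD2r.
Qed.

(** Compactness gives a point nearest to [y] among those of the closed ball on
    the level set of [x1]. As [f] is injective, the boundary sphere is mapped away
    from [f u0], so that the nearest point is interior when [y] and [f x1] are
    close to [f u0]. The bound [kap] does not depend on the level set. *)
Lemma near_minimum : exists2 kap, 0 < kap &
  forall (sigma : 'rV[R]_n -> R) y x1,
    (forall x, `|x - u0| <= rho -> {for x, continuous sigma}) ->
    `|x1 - u0| <= rho -> sqdist (f x1) (f u0) < kap -> sqdist y (f u0) < kap ->
    exists x, [/\ `|x - u0| < rho, sigma x = sigma x1, sqdist (f x) y <= sqdist (f x1) y
      & forall x', `|x' - u0| <= rho -> sigma x' = sigma x1 -> sqdist (f x) y <= sqdist (f x') y].
Proof.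
pose D := [set x : 'rV[R]_n | `|x - u0| <= rho].
have cN y A : A `<=` D -> {within A, continuous (fun x => sqdist (f x) y)}.
  move=> AD; apply: continuous_in_subspaceT => x /set_mem/AD Dx.
  exact/differentiable_continuous/differentiable_sqdist/df.
have [mu mu0 Hmu] : exists2 mu, 0 < mu & forall x, `|x - u0| = rho -> mu <= sqdist (f x) (f u0).
  pose S := [set x : 'rV[R]_n | `|x - u0| = rho].
  have [Sne|/set0P/negP/negPn/eqP S0] := pselect (S !=set0); last first.
    by exists 1 => // x xS; have : S x by []; rewrite S0.
  have cS : compact S.
    apply: bounded_closed_compact.
      have [r [rr Hr]] := bounded_ball_rV; exists r; split=> // r' rr' x /= xS.
      by apply: Hr => //=; rewrite xS.
    rewrite (_ : S = (fun x : 'rV[R]_n => `|x - u0|) @^-1` [set y : R | y = rho]) //.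
    apply: preimage_closed; last exact: closed_eq.
    by move=> x _; exact: continuous_norm_sub.
  have [|c /set_mem Sc cmin] := EVT_min_rV Sne cS (f := fun x => sqdist (f x) (f u0)).
    by apply: cN => x Sx; rewrite /D/= Sx.
  exists (sqdist (f c) (f u0)).
    apply: dotp_gt0; rewrite subr_eq0; apply/eqP => /fi; rewrite !inE => /(_ _ _) Ec.
    have : c = u0 by apply: Ec; apply: BU; rewrite ?subrr ?normr0 ?Sc// ltW.
    move=> cu0; move: Sc; rewrite /S/= cu0 subrr normr0 => /esym r0.
    by have := rho0; rewrite r0 ltxx.
  by move=> x Sx; apply: cmin; exact: mem_set.
(* For a nearest point on the boundary, the two triangle inequalities would
   give [mu <= 2 (2 kap + 2 kap) + 2 kap]. *)
exists (mu / 10); first by rewrite divr_gt0.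
move=> sigma y x1 cs x1B x1k yk.
pose A := [set x | `|x - u0| <= rho /\ sigma x = sigma x1].
have cA : compact A.
  apply: bounded_closed_compact.
    have [r [rr Hr]] := bounded_ball_rV; exists r; split=> // r' rr' x [xB _].
    exact: Hr.
  move=> x clx.
  have xB : `|x - u0| <= rho by apply: closed_ball_rV => B /clx [z [[zB _] Bz]]; exists z.
  split=> //; apply/eqP; apply: contrapT => /negP sx.
  have nb : \forall z \near x, sigma z != sigma x1.
    have : open [set t : R | t != sigma x1] by exact: open_neq.
    by rewrite openE => /(_ _ sx); exact: (cs x xB).
  by have [z [[_ Ez] /= ]] := clx _ nb; rewrite Ez eqxx.
have [|x /set_mem[xB Ex] xmin] := EVT_min_rV (ex_intro _ x1 (conj x1B erefl)) cA (f := fun x => sqdist (f x) y).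
  by apply: cN => x [].
have xx1 : sqdist (f x) y <= sqdist (f x1) y by apply: xmin; apply: mem_set.
exists x; split=> //; last by move=> x' x'B Ex'; apply: xmin; apply: mem_set.
rewrite lt_neqAle xB andbT; apply/eqP => xS.
have h1 := Hmu x xS.
have h2 := sqdist_triangle (f x) y (f u0).
have h3 := sqdist_triangle (f x1) (f u0) y.
rewrite (sqdistC (f u0)) in h3.
lra.
Qed.

End Foot.

(** * Totally umbilic pieces *)

Lemma interior_minimum {R : realType} {V : normedModType R} (N : V -> R) x d v :
  differentiable N x -> 0 < d -> (forall y, `|y - x| < d -> N x <= N y) ->
  dd v N x = 0.
Proof.
move=> dN d0 Nmin.
suff H w : 0 <= dd w N x.
  by apply/eqP; rewrite eq_le H andbT -oppr_ge0 -ddNl.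
apply/ler_addgt0Pl => e e0.
pose c := `|w| + 1; have c0 : 0 < c by rewrite ltr_wpDl.
have [d1 d10 H1] := dd_approx dN (divr_gt0 e0 c0).
pose t := Num.min d d1 / (2 * c).
have m0 : 0 < Num.min d d1 by rewrite lt_min d0.
have t0 : 0 < t by rewrite divr_gt0// mulr_gt0.
have tc : t * c < Num.min d d1.
  rewrite (_ : t * c = Num.min d d1 / 2); last by rewrite /t; field; rewrite gt_eqF.
  by rewrite gtr_pMr// invf_lt1// ltr1n.
have twc : `|t *: w| <= t * c by rewrite normrZ gtr0_norm// ler_pM2l// lerDl.
move: tc; rewrite lt_min => /andP[td td1].
have := H1 _ (le_lt_trans twc td1); rewrite ler_norml ddZl// => /andP[_ h1].
have h2 : N x <= N (x + t *: w).
  by apply: Nmin; rewrite addrAC subrr add0r (le_lt_trans twc).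
have := ler_wpM2l (ltW (divr_gt0 e0 c0)) twc.
rewrite (_ : e / c * (t * c) = t * e); last by field; rewrite gt_eqF.
rewrite -(pmulr_rge0 _ t0) mulrDr; move: h1 h2.
rewrite -[t *: dd w N x]/(t * dd w N x); lra.
Qed.

Lemma open_norm_ball {R : realType} {V : normedModType R} (u0 : V) r :
  open [set x | `|x - u0| < r].
Proof.
rewrite (_ : [set x | _] = ball u0 r); first exact: ball_open.
by apply/seteqP; split=> x /=; rewrite -ball_normE /= distrC.
Qed.

Lemma open_subset_ball {R : realType} {V : normedModType R} (U : set V) u0 :
  open U -> U u0 -> exists2 r, 0 < r & forall x, `|x - u0| < r -> U x.
Proof.
move=> oU Uu0; have /(nbhs0P U u0).1/nbhs_norm0P[r r0 /= Hr] : \near u0, U u0.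
  exact: open_nbhs_nbhs.
by exists r => // x xr; have := Hr _ xr; rewrite addrC subrK.
Qed.

Lemma open_sqdist {R : realType} {n : nat} (q : 'rV[R]_n.+1) k :
  open [set y | sqdist y q < k].
Proof.
rewrite (_ : [set y | _] = (fun y => dotp (y - q) (y - q)) @^-1` [set t | t < k]) //.
by apply: open_comp => [y _|]; [exact: continuous_dotp_sqr|exact: open_lt].
Qed.

Section UmbilicPieces.
Context {R : realType} {n : nat}.
Variables (U : set 'rV[R]_n) (f nu : 'rV[R]_n -> 'rV[R]_n.+1).
Variables (lam a : 'rV[R]_n -> R) (eta : 'rV[R]_n -> 'rV[R]_n).
Hypotheses (n3 : (3 <= n)%N) (oU : open U) (sf : smooth_on U f).
Hypothesis fi : {in U &, injective f}.
Hypothesis metricE : forall u, U u -> metric f u = (lam u)%:M.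
Hypothesis lam0 : forall u, U u -> 0 < lam u.
Hypothesis qu : quasi_umbilic_on U f nu a (fun=> 0) eta.
Variable u0 : 'rV[R]_n.
Hypothesis Uu0 : U u0.

Let df u : U u -> differentiable f u. Proof. exact: smooth_differentiable. Qed.
Let nuP u : U u -> unit_normal f u (nu u).
Proof. by move=> Uu; case: qu => _ _ _ _ /(_ u Uu)[]. Qed.
Let dnu u : U u -> differentiable nu u.
Proof. by case: qu => snu *; exact: smooth_differentiable snu _. Qed.
Let da u : U u -> differentiable a u.
Proof. by case: qu => _ sa *; exact: smooth_differentiable sa _. Qed.
Let normalE u v : U u -> dotp (dd v f u) (nu u) = 0.
Proof. by move=> Uu; exact: (dotp_tangent_normal sf Uu (nuP Uu)). Qed.

(** That the image is open in the model hypersurface [S], and not merely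
    contained in it, follows from the existence of interior feet: at the foot the
    displacement is normal to the piece, and [foot] says that it vanishes. *)
Lemma open_piece rho k (S : set 'rV[R]_n.+1) : 0 < rho -> 0 < k ->
  (forall x, `|x - u0| <= rho -> U x) ->
  (forall x, `|x - u0| <= rho -> S (f x)) ->
  (forall x y, `|x - u0| <= rho -> S y -> (forall v, dotp (f x - y) (dd v f x) = 0) ->
     sqdist (f x) y < k -> f x = y) ->
  exists2 V, [/\ open V, V u0 & V `<=` U] & open_part (f @` V) S.
Proof.
move=> rho0 k0 BU BS foot.
have [kap kap0 Hkap] := near_minimum sf fi rho0 BU.
pose k' := Num.min kap k; have k'0 : 0 < k' by rewrite lt_min kap0.
pose W := [set y | sqdist y (f u0) < k'].
have oW : open W by exact: open_sqdist.
pose V := [set x | `|x - u0| < rho] `&` f @^-1` W.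
have Bf0 : sqdist (f u0) (f u0) = 0 by rewrite /sqdist subrr dotp0l.
exists V; first split.
- apply: open_preimage_on => // [|x /= /ltW /BU]; last exact: df.
  exact: open_norm_ball.
- by split=> /=; rewrite ?subrr ?normr0// /W/= Bf0.
- by move=> x [/ltW /BU].
exists W => //; apply/seteqP; split=> [_ [x [xB Wx] <-]|y [Wy Sy]].
  by split=> //; apply: BS; exact: ltW.
have yk : sqdist y (f u0) < kap by apply: lt_le_trans Wy _; rewrite ge_min lexx.
have [|||x [xB _ xle xmin]] := Hkap (fun=> 0) y u0 _ _ _ yk.
- by move=> x _; exact: cst_continuous.
- by rewrite subrr normr0 ltW.
- by rewrite Bf0.
have Ux : U x by apply: BU; exact: ltW.
have Ex : f x = y.
  apply: foot => // [|v|]; first exact: ltW.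
    have : dd v (fun x => sqdist (f x) y) x = 0.
      apply: (@interior_minimum _ _ _ _ (rho - `|x - u0|)).
      - exact/differentiable_sqdist/df.
      - by rewrite subr_gt0.
      - move=> z; rewrite ltrBrDr => zx; apply: xmin => //; apply: ltW.
        apply: le_lt_trans zx; rewrite -(subrKA x z (- u0)).
        exact: ler_normD.
    rewrite dd_sqdist; last exact: df.
    by move/eqP; rewrite mulf_eq0 pnatr_eq0 => /eqP.
  apply: le_lt_trans xle _; rewrite sqdistC.
  by apply: lt_le_trans Wy _; rewrite ge_min lexx orbT.
by exists x => //; split=> //; rewrite /preimage/= Ex.
Qed.

Let half_ball : exists2 rho, 0 < rho & forall x, `|x - u0| <= rho -> `|x - u0| < 2 * rho /\ 
   (forall y, `|y - u0| < 2 * rho -> U y).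
Proof.
have [r r0 Hr] := open_subset_ball oU Uu0.
exists (r / 2) => [|x xr]; first by rewrite divr_gt0.
rewrite mulrC divfK; last by rewrite pnatr_eq0.
by split=> //; apply: le_lt_trans xr _; rewrite gtr_pMr// invf_lt1// ltr1n.
Qed.

(** With [a = b = 0] the normal is constant. *)
Lemma hyperplane_piece : (forall u, U u -> a u = 0) ->
  exists2 V, [/\ open V, V u0 & V `<=` U] & exists2 S, hyperplane S & open_part (f @` V) S.
Proof.
move=> a0; have [rho rho0 B] := half_ball.
have [B2 BU] : `|u0 - u0| < 2 * rho /\ (forall y, `|y - u0| < 2 * rho -> U y).
  by apply: B; rewrite subrr normr0 ltW.
have nuc x : `|x - u0| <= rho -> nu x = nu u0.
  move=> /B[xr _]; apply: (zero_derive_cstv (r := 2 * rho)) => // [y /BU/dnu//|y v /BU Uy].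
  rewrite -ddE (weingarten oU sf metricE lam0 qu v Uy) a0//= !oppr0 !scale0r.
  by rewrite scaler0 addr0.
have nuc2 x : `|x - u0| < 2 * rho -> nu x = nu u0.
  move=> xr; apply: (zero_derive_cstv (r := 2 * rho)) => // [y /BU/dnu//|y v /BU Uy].
  rewrite -ddE (weingarten oU sf metricE lam0 qu v Uy) a0//= !oppr0 !scale0r.
  by rewrite scaler0 addr0.
pose S := [set y | dotp y (nu u0) = dotp (f u0) (nu u0)].
have [|x xr|x y xr Sy T _|V HV HS] := @open_piece rho 1 S rho0 ltr01.
- by move=> x /B[xr]; apply.
- have [x2 _] := B x xr; rewrite /S/=.
  apply: (@zero_derive_cst _ _ (fun y => dotp (f y) (nu u0)) u0 (2 * rho)) => // [y /BU Uy|y v yr].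
    by apply: differentiable_dotp; [exact: df|exact: differentiable_cst].
  have Uy := BU y yr; have dc : differentiable (fun=> nu u0) y by exact: differentiable_cst.
  by rewrite -ddE (dd_dotp v (df Uy) dc) dd_cst dotp0r addr0 -(nuc2 y yr) normalE.
- have [x2 /(_ x x2) Ux] := B x xr; apply/eqP; rewrite -subr_eq0; apply/eqP.
  apply: (eq_tangent_normal sf metricE lam0 qu Ux) => [v|]; first by rewrite T dotp0l.
  rewrite dotp0l nuc2// dotpBl Sy; apply/eqP; rewrite subr_eq0; apply/eqP.
  apply: (@zero_derive_cst _ _ (fun y => dotp (f y) (nu u0)) u0 (2 * rho)) => // [z /BU Uz|z v zr].
    by apply: differentiable_dotp; [exact: df|exact: differentiable_cst].
  have Uz := BU z zr; have dc : differentiable (fun=> nu u0) z by exact: differentiable_cst.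
  by rewrite -ddE (dd_dotp v (df Uz) dc) dd_cst dotp0r addr0 -(nuc2 z zr) normalE.
- exists V => //; exists S => //; exists (nu u0), (dotp (f u0) (nu u0)); split=> //.
  by rewrite -dotp_eq0 (nuP Uu0).1 oner_eq0.
Qed.

(** With [b = 0] and [a] constant, [f + nu / a] is constant. A foot determines
    the point of the sphere up to the antipode, which is too far away. *)
Lemma hypersphere_piece : (forall u, U u -> a u != 0) ->
  exists2 V, [/\ open V, V u0 & V `<=` U] & exists2 S, hypersphere S & open_part (f @` V) S.
Proof.
move=> a0; have [rho rho0 B] := half_ball.
have [B2 BU] : `|u0 - u0| < 2 * rho /\ (forall y, `|y - u0| < 2 * rho -> U y).
  by apply: B; rewrite subrr normr0 ltW.
have ac x : `|x - u0| < 2 * rho -> a x = a u0.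
  move=> xr; apply: (zero_derive_cst (r := 2 * rho)) => // [y /BU/da//|y v /BU Uy].
  by rewrite -ddE; exact: (umbilic_coeff_constant n3 oU sf metricE lam0 qu).
pose q := (a u0)^-1; have q0 : q != 0 by rewrite invr_eq0 a0.
pose c := f u0 + q *: nu u0.
have cc x : `|x - u0| < 2 * rho -> f x + q *: nu x = c.
  move=> xr; apply: (zero_derive_cstv (F := fun x => f x + q *: nu x) (r := 2 * rho)) => //.
    by move=> y /BU Uy; apply: differentiableD; [exact: df|exact/differentiableZ/dnu].
  move=> y v yr; have Uy := BU y yr; have dc : differentiable (fun=> q) y by exact: differentiable_cst.
  rewrite -ddE (ddD v (df Uy) (differentiable_scale dc (dnu Uy))).
  rewrite (dd_scale v dc (dnu Uy)) dd_cst scale0r add0r.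
  rewrite (weingarten oU sf metricE lam0 qu v Uy)/= oppr0 scale0r scaler0 addr0 ac//.
  by rewrite scalerA mulrN mulVf ?a0// scaleN1r subrr.
pose S := [set y | dotp (y - c) (y - c) = `|q| ^+ 2].
have fc x : `|x - u0| < 2 * rho -> f x - c = - q *: nu x.
  by move=> xr; rewrite -(cc x xr) opprD addrA subrr add0r scaleNr.
have k0 : 0 < 4 * q ^+ 2 by rewrite mulr_gt0// exprn_even_gt0.
have [|x xr|x y xr Sy T xy|V HV HS] := @open_piece rho (4 * q ^+ 2) S rho0 k0.
- by move=> x /B[xr]; apply.
- have [x2 /(_ x x2) Ux] := B x xr; rewrite /S/= fc// !dotpE (nuP Ux).1.
  by rewrite real_normK ?num_real//; ring.
- have [x2 /(_ x x2) Ux] := B x xr.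
  pose t := dotp (f x - y) (nu x).
  have Et : f x - y = t *: nu x.
    apply: (eq_tangent_normal sf metricE lam0 qu Ux) => [v|].
      by rewrite T dotpZl dotpC normalE// mulr0.
    by rewrite dotpZl (nuP Ux).1 mulr1.
  have Ey : y - c = - (q + t) *: nu x.
    rewrite -(subrKA (f x) y (- c)) fc// -opprB Et addrC -scaleNr -scalerDl.
    by congr (_ *: _); ring.
  have : t * (2 * q + t) = 0.
    move: Sy; rewrite /S/= Ey !dotpE (nuP Ux).1 real_normK ?num_real// => H.
    have : (q + t) ^+ 2 = q ^+ 2 by rewrite -H; ring.
    by move/eqP; rewrite -subr_eq0 => /eqP <-; ring.
  move/eqP; rewrite mulf_eq0 => /orP[/eqP t0|].
    by apply/eqP; rewrite -subr_eq0 Et t0 scale0r.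
  rewrite addrC addr_eq0 => /eqP t2; move: xy.
  rewrite /sqdist Et !dotpE (nuP Ux).1 t2.
  by rewrite (_ : - (2 * q) * (- (2 * q) * 1) = 4 * q ^+ 2) ?ltxx//; ring.
- exists V => //; exists S => //; exists c, `|q|; split=> //.
  by rewrite normr_gt0.
Qed.

End UmbilicPieces.

(** * Canal pieces *)

Lemma level_bounds {R : realType} {n} (U : set 'rV[R]_n) (sigma : 'rV[R]_n -> R) u0 v0 :
  open U -> smooth_on U sigma -> U u0 -> 0 < dd v0 sigma u0 ->
  exists rho m L, [/\ 0 < rho, 0 < m, 0 <= L, forall q, `|q - u0| < rho -> U q &
    forall q, `|q - u0| < rho -> m <= dd v0 sigma q /\ forall h, `|dd h sigma q| <= L * `|h|].
Proof.
move=> oU ss Uu0 pos; pose E i : 'rV[R]_n := delta_mx 0 i.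
have cD v : {for u0, continuous (dd v sigma)}.
  exact/differentiable_continuous/(smooth_differentiable (smooth_dd v ss) Uu0).
have nE : \forall q \near u0, forall i, `|dd (E i) sigma q| < `|dd (E i) sigma u0| + 1.
  apply: (@filter_forall _ _ _ _ (nbhs_filter u0)) => i.
  have c : {for u0, continuous (fun q => `|dd (E i) sigma q|)}.
    by apply: (@continuous_comp _ _ _ (dd (E i) sigma) Num.norm); [exact: cD|exact: norm_continuous].
  have : open [set t : R | t < `|dd (E i) sigma u0| + 1] by exact: open_lt.
  have lt1 : `|dd (E i) sigma u0| < `|dd (E i) sigma u0| + 1 by rewrite ltrDl.
  rewrite openE => /(_ _ lt1); exact: c.
pose m := dd v0 sigma u0 / 2.
have m0 : 0 < m by rewrite divr_gt0.
have nm : \forall q \near u0, m < dd v0 sigma q.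
  have : open [set t : R | m < t] by exact: open_gt.
  have lt1 : m < dd v0 sigma u0 by rewrite /m gtr_pMr// invf_lt1// ltr1n.
  rewrite openE => /(_ _ lt1); exact: cD.
have nU : \near u0, U u0 by exact: open_nbhs_nbhs.
have nA : \forall q \near u0, ((forall i, `|dd (E i) sigma q| < `|dd (E i) sigma u0| + 1) /\
    m < dd v0 sigma q) /\ U q by exact: (filterI (filterI nE nm) nU).
have /(nbhs0P _ u0).1/nbhs_norm0P[r r0 /= Hr] := nA.
have H q : `|q - u0| < r -> ((forall i, `|dd (E i) sigma q| < `|dd (E i) sigma u0| + 1) /\
    m < dd v0 sigma q) /\ U q.
  by move=> qr; have := Hr _ qr; rewrite addrC subrK.
exists r, m, (\sum_i (`|dd (E i) sigma u0| + 1)); split=> //.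
- by apply: sumr_ge0 => i _; rewrite addr_ge0.
- by move=> q /H[].
move=> q /H[[Eq mq] Uq]; split=> [|h]; first exact: ltW.
rewrite dd_row_sum; last exact: smooth_differentiable ss Uq.
apply: le_trans (ler_norm_sum _ _ _) _; rewrite mulr_suml; apply: ler_sum => i _.
by rewrite normrZ mulrC ler_pM ?norm_coord_le// ltW.
Qed.

(** Two points within squared distance [r / 4] of a third one are less than the
    squared distance [r] apart; [s] stands for the squared diameter of a sphere
    on which they would be antipodal. *)
Lemma near_antipode {R : realType} (d1 d2 r s : R) :
  s <= 2 * d1 + 2 * d2 -> d1 < r / 4 -> d2 < r / 4 -> r < s -> False.
Proof. by lra. Qed.

Section CanalPiece.
Context {R : realType} {n : nat}.
Variables (U : set 'rV[R]_n) (f nu : 'rV[R]_n -> 'rV[R]_n.+1).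
Variables (lam a b : 'rV[R]_n -> R) (eta : 'rV[R]_n -> 'rV[R]_n).
Hypotheses (n3 : (3 <= n)%N) (fU : local_param (f @` U) U f).
Hypothesis metricE : forall u, U u -> metric f u = (lam u)%:M.
Hypothesis lam0 : forall u, U u -> 0 < lam u.
Hypothesis qu : quasi_umbilic_on U f nu a b eta.
Hypotheses (a0 : forall u, U u -> a u != 0) (b0 : forall u, U u -> b u != 0).
Variable u0 : 'rV[R]_n.
Hypothesis Uu0 : U u0.

Let oU : open U. Proof. by case: fU. Qed.
Let sf : smooth_on U f. Proof. by case: fU. Qed.
Let fi : {in U &, injective f}. Proof. by case: fU. Qed.
Let df u : U u -> differentiable f u. Proof. exact: smooth_differentiable. Qed.

Let ctr := leaf_centre f nu lam a b eta.
Let rad := leaf_radius lam a b eta.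
Let axs := leaf_axis f nu lam a b eta.
Let foc := focal_point f nu a.
Let Z := dual_dir lam eta.

Let v0 : 'rV[R]_n := - (a u0 / b u0) *: Z u0.

(** The leaves near [u0] are the level sets of this coordinate of the focal
    point. The vector [v0] is scaled so that [sigma] grows with unit speed. *)
Let sigma u := dotp (foc u) (dual_vec f lam eta u0).

Let sfoc : smooth_on U foc.
Proof. exact: (smooth_focal_point oU sf qu). Qed.
Let ssigma : smooth_on U sigma.
Proof. by apply: smooth_dotp => //; exact: smooth_cst. Qed.
Let dfoc u : U u -> differentiable foc u. Proof. exact: smooth_differentiable. Qed.
Let dsig u : U u -> differentiable sigma u. Proof. exact: smooth_differentiable. Qed.

Let dd_sigma u v : U u -> dd v sigma u = dotp (dd v foc u) (dual_vec f lam eta u0).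
Proof.
move=> Uu; have dc : differentiable (fun=> dual_vec f lam eta u0) u by exact: differentiable_cst.
by rewrite (dd_dotp v (dfoc Uu) dc) dd_cst dotp0r addr0.
Qed.

Let sigma_v0 : dd v0 sigma u0 = 1.
Proof.
rewrite (ddZl _ (Z u0) (dsig Uu0)) dd_sigma//.
rewrite (focal_point_transverse oU sf metricE lam0 qu a0 Uu0) -[_ *: _]/(_ * _).
by field; rewrite a0 ?b0.
Qed.

Let sigma_leafwise u x : U u -> dotp x (eta u) = 0 -> dd x sigma u = 0.
Proof.
by move=> Uu xe; rewrite dd_sigma// (focal_point_leafwise n3 oU sf metricE lam0 qu a0) ?dotp0l.
Qed.

Let sigma_kernel u x : U u -> 0 < dd v0 sigma u -> dd x sigma u = 0 -> dotp x (eta u) = 0.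
Proof.
move=> Uu pos xs; have du := dsig Uu.
have dec v : dd v sigma u = dotp v (eta u) * dd (Z u) sigma u.
  have {1}-> : v = (v - dotp v (eta u) *: Z u) + dotp v (eta u) *: Z u by rewrite subrK.
  rewrite ddDl// (ddZl _ (Z u) du) sigma_leafwise ?add0r//.
  by rewrite dotpBl dotpZl (dual_dir_eta metricE lam0 qu Uu) mulr1 subrr.
move: xs pos; rewrite (dec x) (dec v0) => /eqP; rewrite mulf_eq0 => /orP[/eqP //|/eqP ->].
by rewrite mulr0 ltxx.
Qed.

(** The curve [u0 + s v0] meets the leaves one by one, which gives the
    one-parameter family of spheres. Conversely let [y] lie on one of these
    spheres, near [f u0]. Its foot [f x] on the corresponding leaf differs from
    [y] by a vector normal to the leaf inside the hyperplane of the sphere, thus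
    radial; so [y] is [f x] or its antipode, and the latter is too far away. *)
Lemma canal_piece :
  exists2 V, [/\ open V, V u0 & V `<=` U] & canal_part (f @` V).
Proof.
have pos : 0 < dd v0 sigma u0 by rewrite sigma_v0.
have [rho [m [L [rho0 m0 L0 BU bnd]]]] := level_bounds oU ssigma Uu0 pos.
have incr q : `|q - u0| < rho -> m <= dd v0 sigma q by move/bnd => [].
have lip q h : `|q - u0| < rho -> `|dd h sigma q| <= L * `|h| by move/bnd => [_]; apply.
have dsB q : `|q - u0| < rho -> differentiable sigma q by move/BU; exact: dsig.
have ker q x : `|q - u0| < rho -> dd x sigma q = 0 -> dotp x (eta q) = 0.
  by move=> qr; apply: sigma_kernel (BU q qr) (lt_le_trans m0 (incr q qr)).
pose A := 1 + L / m * `|v0|.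
have A0 : 0 < A by rewrite ltr_pwDl// mulr_ge0// divr_ge0// ltW.
have A40 : 0 < 1 + 4 * A by rewrite ltr_wpDl// mulr_gt0.
pose r2 := rho / (1 + 4 * A).
have r20 : 0 < r2 by rewrite divr_gt0.
have r2A : r2 * (1 + 4 * A) <= rho by rewrite divfK// gt_eqF.
have r2rho : r2 <= rho.
  by rewrite ler_pdivrMr// ler_pMr// lerDl mulr_ge0// ltW.
have lsc k (F : 'rV[R]_n -> 'rV[R]_k) := @level_set_constant R n sigma v0 u0 rho m L
  m0 L0 dsB incr lip k F r2 r20 r2A.
have ctrE p p' : `|p - u0| < r2 -> `|p' - u0| < r2 -> sigma p = sigma p' -> ctr p = ctr p'.
  apply: lsc => [q qr|q x qr xs].
    exact: smooth_differentiable (smooth_leaf_centre n3 oU sf metricE lam0 qu b0 a0) (BU q qr).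
  exact: (leaf_centre_leafwise n3 oU sf metricE lam0 qu b0 a0 (BU q qr) (ker q x qr xs)).
have axsE p p' : `|p - u0| < r2 -> `|p' - u0| < r2 -> sigma p = sigma p' -> axs p = axs p'.
  apply: lsc => [q qr|q x qr xs].
    exact: smooth_differentiable (smooth_leaf_axis n3 oU sf metricE lam0 qu b0 a0) (BU q qr).
  exact: (leaf_axis_leafwise n3 oU sf metricE lam0 qu b0 a0 (BU q qr) (ker q x qr xs)).
have focE p p' : `|p - u0| < r2 -> `|p' - u0| < r2 -> sigma p = sigma p' -> foc p = foc p'.
  apply: lsc => [q qr|q x qr xs]; first exact/dfoc/BU.
  exact: (focal_point_leafwise n3 oU sf metricE lam0 qu a0 (BU q qr) (ker q x qr xs)).
have srad : smooth_on U rad := smooth_leaf_radius n3 oU sf metricE lam0 qu b0 a0.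
have drad q : U q -> differentiable rad q by exact: smooth_differentiable.
have radE p p' : `|p - u0| < r2 -> `|p' - u0| < r2 -> sigma p = sigma p' -> rad p = rad p'.
  move=> pr p'r Ep.
  have dF q : U q -> differentiable (fun x => const_mx (rad x) : 'rV[R]_1) q.
    move=> Uq; apply/differentiable_coordP => k.
    by under eq_fun do rewrite mxE; exact: drad.
  have : const_mx (rad p) = const_mx (rad p') :> 'rV[R]_1.
    apply: (lsc 1%N (fun x => const_mx (rad x))) => // [q qr|q x qr xs]; first exact/dF/BU.
    apply/rowP => k; rewrite dd_coord ?mxE; last exact/dF/BU.
    under [X in dd x X]eq_fun do rewrite mxE.
    exact: (leaf_radius_leafwise n3 oU sf metricE lam0 qu b0 a0 (BU q qr) (ker q x qr xs)).
  by move/rowP/(_ 0); rewrite !mxE.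
have rad0 q : U q -> 0 < rad q by exact: (leaf_radius_gt0 lam b eta a0).
have [r5 r50 Hr5] : exists2 r5, 0 < r5 & forall x, `|x - u0| < r5 ->
    U x /\ 0 < rad x - rad u0 / 2.
  have oG : open (U `&` [set x | 0 < rad x - rad u0 / 2]).
    apply: open_gt0 => // x Ux; apply: differentiableB; first exact: drad.
    exact: differentiable_cst.
  have := open_subset_ball (u0 := u0) oG; apply; split=> //=.
  by rewrite subr_gt0 gtr_pMr ?rad0// invf_lt1// ltr1n.
pose r3 := Num.min r2 r5 / 2.
have r30 : 0 < r3 by rewrite divr_gt0// lt_min r20.
have r3lt x : `|x - u0| <= r3 -> `|x - u0| < r2 /\ `|x - u0| < r5.
  move=> xr; have : `|x - u0| < Num.min r2 r5.
    by apply: le_lt_trans xr _; rewrite gtr_pMr ?lt_min ?r20// invf_lt1// ltr1n.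
  by rewrite lt_min => /andP[].
have r2U x : `|x - u0| < r2 -> U x by move=> xr; apply: BU; exact: lt_le_trans xr r2rho.
have B3U x : `|x - u0| <= r3 -> U x by move/r3lt => [/r2U].
have [kap kap0 Hkap] := near_minimum sf fi r30 B3U.
(* The first bound provides feet, the second one excludes antipodes. *)
pose k := Num.min kap (rad u0 ^+ 2 / 4).
have k0 : 0 < k by rewrite lt_min kap0 divr_gt0// exprn_gt0// rad0.
pose W := [set y | sqdist y (f u0) < k].
have oW : open W by exact: open_sqdist.
have Wf0 : W (f u0) by rewrite /W/= /sqdist subrr dotp0l.
have [r4 r40 Hr4] : exists2 r4, 0 < r4 & forall x, `|x - u0| < r4 -> U x /\ W (f x).
  have := open_subset_ball (u0 := u0) (open_preimage_on oU df oW); exact.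
pose eps := Num.min r3 r4 / (2 * (`|v0| + 1)).
have v10 : 0 < `|v0| + 1 by rewrite ltr_wpDl.
have eps0 : 0 < eps by rewrite divr_gt0 ?mulr_gt0// lt_min r30.
pose us (s : R) := u0 + s *: v0.
have usB (s : R) : - eps <= s <= eps -> `|us s - u0| < r3 /\ `|us s - u0| < r4.
  rewrite -ler_norml => se; apply/andP; rewrite -lt_min /us addrAC subrr add0r normrZ.
  apply: (@le_lt_trans _ _ (eps * (`|v0| + 1))); first by rewrite ler_pM// lerDl.
  rewrite (_ : eps * _ = Num.min r3 r4 / 2); last by rewrite /eps; field; rewrite gt_eqF.
  by rewrite gtr_pMr ?lt_min ?r30// invf_lt1// ltr1n.
have us2 (s : R) : - eps <= s <= eps -> `|us s - u0| < r2.
  by move/usB => [/ltW/r3lt[]].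
have mono (s s' : R) : - eps <= s <= eps -> - eps <= s' <= eps -> s < s' ->
    sigma (us s) < sigma (us s').
  move=> sI s'I ss'; have Es : us s' = us s + (s' - s) *: v0.
    by rewrite /us -addrA -scalerDl (addrC s) subrK.
  have s1 := lt_le_trans (us2 s sI) r2rho; have s2 := lt_le_trans (us2 s' s'I) r2rho.
  rewrite Es in s2 *.
  have [z zr Ez] := segment_increment dsB s1 s2.
  rewrite -subr_gt0 Ez (ddZl _ _ (dsB z zr)) -[_ *: _]/(_ * _) mulr_gt0 ?subr_gt0//.
  exact: lt_le_trans m0 (incr z zr).
pose I := [set s : R | - eps < s < eps].
have II s : I s -> - eps <= s <= eps by move=> /andP[s1 s2]; rewrite !ltW.
have endl : - eps <= - eps <= eps by rewrite lexx ge0_cp// ltW.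
have endr : - eps <= eps <= eps by rewrite lexx andbT ge0_cp// ltW.
have oI : open I.
  rewrite (_ : I = `]- eps, eps[%classic); first exact: interval_open.
  by apply/seteqP; split=> s /=; rewrite in_itv.
have IU s : I s -> U (us s) by move=> /II/us2/r2U.
pose V := ([set x | `|x - u0| < r3] `&` f @^-1` W)
  `&` [set x | sigma (us (- eps)) < sigma x < sigma (us eps)].
have VU : V `<=` U by move=> x [[/ltW/B3U]].
have oV : open V.
  have o1 : open ([set x | `|x - u0| < r3] `&` f @^-1` W).
    apply: open_preimage_on => // [|x /ltW/B3U/df//]; exact: open_norm_ball.
  rewrite (_ : V = ([set x | `|x - u0| < r3] `&` f @^-1` W)
    `&` sigma @^-1` `]sigma (us (- eps)), sigma (us eps)[%classic).
    apply: open_preimage_on; [exact: o1|by move=> x [/ltW/B3U/dsig]|exact: interval_open].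
  by apply/seteqP; split=> x [h1 h2]; split=> //; move: h2; rewrite /= in_itv.
have us0 : us 0 = u0 by rewrite /us scale0r addr0.
have I0 : I 0 by rewrite /I/= oppr_lt0 eps0.
have Vu0 : V u0.
  split; first by split=> //=; rewrite subrr normr0.
  rewrite /= -us0; have [h1 h2] : - eps < 0 /\ 0 < eps by rewrite oppr_lt0.
  by rewrite !mono//; exact: II.
(* The spherical cap of parameter [s] is covered by its leaf. *)
have cap s y : I s -> W y -> subsphere (ctr (us s)) (axs (us s)) (rad (us s)) y ->
    exists x, [/\ V x, f x = y & sigma x = sigma (us s)].
  move=> Is Wy [y1 y2]; have sI := II s Is; have [s3 s4] := usB s sI.
  have Wk z : W z -> sqdist z (f u0) < kap by move=> Wz; apply: lt_le_trans Wz _; rewrite ge_min lexx.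
  have Ws : W (f (us s)) by have [] := Hr4 _ s4.
  have cs x : `|x - u0| <= r3 -> {for x, continuous sigma}.
    by move/B3U/dsig; exact: differentiable_continuous.
  have [x [xB Ex xle xmin]] := Hkap sigma y (us s) cs (ltW s3) (Wk _ Ws) (Wk _ Wy).
  have [x2 x5] := r3lt x (ltW xB); have Ux := r2U x x2.
  have xrho := lt_le_trans x2 r2rho.
  have Ec := ctrE x (us s) x2 (us2 s sI) Ex.
  have Ea := axsE x (us s) x2 (us2 s sI) Ex.
  have Er := radE x (us s) x2 (us2 s sI) Ex.
  have [f1 f2] := leaf_centre_subsphere sf metricE lam0 qu a0 Ux.
  rewrite -/ctr -/axs -/rad in f1 f2.
  have dN := differentiable_sqdist y (df Ux).
  have T z : dotp z (eta x) = 0 -> dotp (f x - y) (dd z f x) = 0.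
    move=> ze; have d0 : 0 < r3 - `|x - u0| by rewrite subr_gt0.
    have : dd z (fun x => sqdist (f x) y) x = 0.
      apply: (level_minimum m0 L0 dsB incr lip xrho dN d0).
        move=> w; rewrite ltrBrDr => wx Ew; apply: xmin; last by rewrite Ew.
        apply/ltW/(le_lt_trans _ wx); rewrite -(subrKA x w (- u0)).
        exact: ler_normD.
      exact: sigma_leafwise.
    rewrite dd_sqdist; last exact: df.
    by move/eqP; rewrite mulf_eq0 pnatr_eq0 => /eqP.
  have Tax : dotp (f x - y) (axs x) = 0.
    by rewrite -(subrKA (ctr x) (f x) (- y)) dotpDl f2 add0r -opprB dotpNl Ec Ea y2 oppr0.
  have [t Et] := leaf_normal sf metricE lam0 qu a0 Ux T Tax.
  rewrite -/ctr in Et.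
  have Ey : y - ctr x = (1 - t) *: (f x - ctr x).
    rewrite scalerBl scale1r -Et; apply/eqP; rewrite -subr_eq0.
    by apply/eqP/rowP => i; rewrite !mxE; ring.
  have rx0 := rad0 x Ux.
  have t2 : t * (t - 2) = 0.
    have := y1; rewrite -Ec -Er Ey dotpZl dotpZr f1 => H.
    have : (t * (t - 2)) * rad x ^+ 2 = 0 by rewrite -[RHS](subrr (rad x ^+ 2)) -{2}H; ring.
    by move/eqP; rewrite mulf_eq0 expf_eq0/= (gt_eqF rx0) orbF => /eqP.
  have Efx : f x = y.
    move/eqP: t2; rewrite mulf_eq0 subr_eq0 => /orP[|] /eqP t0.
      by apply/eqP; rewrite -subr_eq0 Et t0 scale0r.
    have far : sqdist (f x) y = 4 * rad x ^+ 2.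
      by rewrite /sqdist Et t0 dotpZl dotpZr f1; ring.
    have h1 := sqdist_triangle (f (us s)) (f u0) y.
    have h2 : sqdist (f (us s)) (f u0) < rad u0 ^+ 2 / 4.
      by apply: lt_le_trans Ws _; rewrite ge_min lexx orbT.
    have h3 : sqdist (f u0) y < rad u0 ^+ 2 / 4.
      by rewrite sqdistC; apply: lt_le_trans Wy _; rewrite ge_min lexx orbT.
    have [_ h4] := Hr5 x x5.
    have h5 : rad u0 ^+ 2 < 4 * rad x ^+ 2.
      have : rad u0 < 2 * rad x by rewrite mulrC -ltr_pdivrMr// -subr_gt0.
      rewrite (_ : 4 * rad x ^+ 2 = (2 * rad x) ^+ 2); last by ring.
      by move=> h; rewrite !expr2 ltr_pM// ltW// rad0.
    have xl : 4 * rad x ^+ 2 <= sqdist (f (us s)) y by rewrite -far; exact: xle.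
    by have := near_antipode (le_trans xl h1) h2 h3 h5.
  exists x; split=> //; split; first by split=> //; rewrite /preimage/= Efx.
  have /andP[s1 s2] := Is.
  by rewrite /= Ex !mono.
exists V => //.
exists (- eps), eps, (ctr \o us), (axs \o us), (foc \o us), (rad \o us) => /=.
have sl (F : normedModType R) (G : 'rV[R]_n -> F) : smooth_on U G -> smooth_on I (G \o us).
  by move=> sG; exact: (smooth_line oI IU sG).
split.
- split; first by rewrite gtrN.
  + exact: sl (smooth_leaf_centre n3 oU sf metricE lam0 qu b0 a0).
  + exact: sl (smooth_leaf_axis n3 oU sf metricE lam0 qu b0 a0).
  + exact: sl srad.
- move=> s Is; split; first exact/rad0/IU.
  exact: (dotp_leaf_axis sf metricE lam0 qu a0 (IU s Is)).
- exists W => //; apply/seteqP; split=> [_ [x [[xB Wx] /andP[x1 x2]] <-]|y [Wy [s Is yS]]].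
    split=> //; have Ux := B3U x (ltW xB); have [xr2 _] := r3lt x (ltW xB).
    have cont : {within `[- eps, eps], continuous (fun s => sigma (us s))}.
      apply: derivable_within_continuous => s; rewrite in_itv/= => sI.
      exact/diff_derivable/differentiable_line/dsig/r2U/us2.
    have [||s] := @IVT R (fun s => sigma (us s)) (- eps) eps (sigma x) _ cont.
    + by rewrite ge0_cp// ltW.
    + by rewrite ge_min (ltW x1) le_max (ltW x2) orbT.
    rewrite in_itv/= => sI Es.
    have Is : I s.
      move/andP: sI => [s1 s2]; rewrite /I/= !lt_neqAle s1 s2 !andbT; apply/andP; split.
        by apply: contraTneq x1 => ->; rewrite -Es ltxx.
      by apply: contraTneq x2 => <-; rewrite -Es ltxx.
    exists s => //=; rewrite -(ctrE x)// -?(axsE x)// -?(radE x)//; try exact: us2.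
    exact: (leaf_centre_subsphere sf metricE lam0 qu a0 Ux).
  by have [x [Vx <- _]] := cap s y Is Wy yS; exists x.
- move=> s y Is [[x' [[_ Wx'] _] Ex'] yS].
  have Wy : W y by rewrite -Ex'.
  have [x [Vx Ex Es]] := cap s y Is Wy yS.
  exists V, f, x; split=> //.
    apply: local_param_image; exact: local_param_sub fU.
  move=> i; have Ux := VU x Vx; have [[xB _] _] := Vx; have [x2 _] := r3lt x (ltW xB).
  rewrite -Ex -(focE x (us s) x2 (us2 s (II s Is)) Es) partialE.
  exact: (focal_point_normal sf qu).
Qed.

End CanalPiece.

(** * The classification *)

Lemma constant_vanishing {R : realType} {V : normedModType R} (U : set V) (g : V -> R) :
  open U -> U !=set0 -> open (U `&` [set x | g x != 0]) ->
  exists U' z, [/\ open U', U' !=set0, U' `<=` U & forall x, U' x -> (g x == 0) = z].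
Proof.
move=> oU U0 oG.
have [G0|/set0P/negP/negPn/eqP G0] := pselect ((U `&` [set x | g x != 0]) !=set0).
  exists (U `&` [set x | g x != 0]), false.
  by split=> // x [_ /negbTE].
exists U, true; split=> // x Ux; apply/eqP; apply: contrapT => /eqP gx.
by have : set0 x by rewrite -G0.
Qed.

Section ConformalChart.
Context {R : realType} {n : nat}.
Variables (M : set 'rV[R]_n.+1) (U : set 'rV[R]_n) (f nu : 'rV[R]_n -> 'rV[R]_n.+1).
Variable lam : 'rV[R]_n -> R.
Hypotheses (n4 : (4 <= n)%N) (fM : local_param M U f).
Hypothesis metricE : forall u, U u -> metric f u = (lam u)%:M.
Hypothesis lam0 : forall u, U u -> 0 < lam u.
Hypothesis snu : smooth_on U nu.
Hypothesis nuP : forall u, U u -> unit_normal f u (nu u).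

Let oU : open U. Proof. by case: fM. Qed.
Let sf : smooth_on U f. Proof. by case: fM. Qed.
Let fi : {in U &, injective f}. Proof. by case: fM. Qed.
Let df u : U u -> differentiable f u. Proof. exact: smooth_differentiable. Qed.

Let alpha := umbilic_coeff f lam nu.
Let beta := ridge_coeff f lam nu.

Lemma quasi_umbilic_chart u : U u ->
  exists eta, quasi_umbilic f u (nu u) (alpha u) (beta u) eta.
Proof.
move=> Uu; have [a [b [eta qu]]] := quasi_umbilic_exists oU sf metricE lam0 n4 Uu (nuP Uu).
have [Ea Eb] := quasi_umbilic_coeffs n4 metricE lam0 nuP Uu qu.
by exists eta; rewrite /alpha /beta -Ea -Eb.
Qed.

(** Where [beta] vanishes identically, and where it vanishes nowhere, [alpha] is
    smooth; so the open set of non-zeros of [alpha] can be used in its turn. *)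
Lemma constant_pattern U1 : open U1 -> U1 `<=` U -> U1 !=set0 ->
  exists U2 za zb, [/\ open U2, U2 !=set0, U2 `<=` U1 &
    forall u, U2 u -> (alpha u == 0) = za /\ (beta u == 0) = zb].
Proof.
move=> oU1 U1U U10.
have oB : open (U1 `&` [set u | beta u != 0]).
  rewrite (_ : _ `&` _ = U1 `&` (U `&` [set u | beta u != 0])).
    apply: openI => //; exact: (open_ridge n4 oU sf metricE lam0 snu nuP).
  by apply/seteqP; split=> [u [U1u bu]|u [U1u [_ bu]]]; do ?split=> //; exact: U1U.
have [U2 [zb [oU2 U20 U21 Ezb]]] := constant_vanishing oU1 U10 oB.
have U2U : U2 `<=` U by move=> u /U21/U1U.
have sb : smooth_on U2 beta.
  case: zb Ezb => Ezb.
    by apply: (smooth_ext oU2 _ (smooth_cst (0 : R))) => u /Ezb/eqP ->.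
  by apply: (smooth_ridge_coeff n4 oU sf metricE lam0 snu nuP oU2 U2U) => u /Ezb/negbT.
have sa : smooth_on U2 alpha.
  exact: (smooth_umbilic_coeff n4 oU sf metricE lam0 snu oU2 U2U sb).
have oA : open (U2 `&` [set u | alpha u != 0]).
  by apply: open_neq0 => // u U2u; exact: smooth_differentiable sa U2u.
have [U3 [za [oU3 U30 U32 Eza]]] := constant_vanishing oU2 U20 oA.
by exists U3, za, zb; split=> // [u /U32/U21//|u U3u]; split; [exact: Eza|exact/Ezb/U32].
Qed.

(** Any neighbourhood contains an open set on which the vanishing of [alpha] and
    [beta] does not change, and [f] maps it to a relatively open subset of [M]. *)
Lemma constant_type_dense u : U u -> closure (constant_type M) (f u).
Proof.
move=> Uu B Bfu.
have /differentiable_continuous/(_ B Bfu) nB := df Uu.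
have : \forall x \near u, U x /\ B (f x).
  by apply: filterI => //; exact: open_nbhs_nbhs.
move=> /nbhs_interior nU1.
pose U1 := interior [set x | U x /\ B (f x)].
have U1P : U1 `<=` [set x | U x /\ B (f x)] by exact: interior_subset.
have U1u : U1 u by exact: nbhs_singleton nU1.
have [U2 [za [zb [oU2 [v U2v] U21 E]]]] := constant_pattern (open_interior _)
  (fun x U1x => (U1P x U1x).1) (ex_intro _ u U1u).
have [Uv Bv] := U1P v (U21 v U2v).
have U2U : U2 `<=` U by move=> x /U21/U1P[].
have [_ _ _ _ fo] := fM; have [W oW EW] := fo U2 oU2 U2U.
have MW x : U2 x -> (M `&` W) (f x) by move=> U2x; rewrite -EW; exists x.
exists (f v); split=> //; split; first exact: (MW v U2v).1.
exists W, za, zb; split=> //; first exact: (MW v U2v).2.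
move=> q; rewrite -EW => -[x U2x <-].
have [Ea Eb] := E x U2x; have Ux := U2U x U2x.
have [eta qu] := quasi_umbilic_chart Ux.
by exists (alpha x), (beta x); split=> //; exists U, f, x, (nu x), eta.
Qed.

(** The four combinations of [za] and [zb] give the four kinds. The developable
    kind is immediate from its definition; the others require the point sets to
    be identified. *)
Lemma constant_type_piece U1 u0 za zb : open U1 -> U1 `<=` U -> U1 u0 ->
  (forall u, U1 u -> (alpha u == 0) = za /\ (beta u == 0) = zb) ->
  exists V b eta, [/\ open V, V u0, V `<=` U, quasi_umbilic_on V f nu alpha b eta
    & [\/ (forall u, V u -> alpha u = 0 /\ b u = 0) /\
          exists2 S, hyperplane S & open_part (f @` V) S,
          (forall u, V u -> alpha u != 0 /\ b u = 0) /\
          exists2 S, hypersphere S & open_part (f @` V) S,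
          (forall u, V u -> alpha u = 0 /\ b u != 0) /\
          developable (f @` V)
        | (forall u, V u -> alpha u != 0 /\ b u != 0) /\
          canal_part (f @` V)]].
Proof.
move=> oU1 U1U U1u0; have Uu0 := U1U u0 U1u0.
have n3 : (3 <= n)%N by exact: ltnW.
case: zb => E; last first.
  have b0 u : U1 u -> beta u != 0 by move=> /E[_ /negbT].
  have [U' [eta [oU' U'u0 U'U quU' _]]] :=
    quasi_umbilic_on_ridge n4 oU sf metricE lam0 snu nuP Uu0 (b0 u0 U1u0).
  pose U2 := U1 `&` U'.
  have oU2 : open U2 by exact: openI.
  have U2u0 : U2 u0 by [].
  have U21 : U2 `<=` U1 by move=> u [].
  have U2U : U2 `<=` U by move=> u /U21/U1U.
  have qu : quasi_umbilic_on U2 f nu alpha beta eta.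
    by apply: quasi_umbilic_on_sub quU' => u [].
  have fU2 := local_param_sub oU2 U2U fM.
  case: za E => E.
    have a0 u : U1 u -> alpha u = 0 by move=> /E[/eqP].
    exists U2, beta, eta; split=> //; apply: Or43; split=> [u /U21 U1u|].
      by rewrite a0 ?b0.
    move=> p fp; exists U2, f, nu, beta, eta; split=> //.
    - exact: local_param_image fU2.
    - have [s1 s2 s3 s4 q] := qu; split=> // [|u U2u]; first exact: smooth_cst.
      by rewrite -(a0 u (U21 u U2u)); exact: q.
    - by move=> u /U21/b0.
  have a0 u : U1 u -> alpha u != 0 by move=> /E[/negbT].
  have [V [oV Vu0 VU2] HV] := @canal_piece R n U2 f nu lam alpha beta eta n3
    (local_param_image fU2) (fun u h => metricE (U2U u h)) (fun u h => lam0 (U2U u h))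
    qu (fun u h => a0 u (U21 u h)) (fun u h => b0 u (U21 u h)) u0 U2u0.
  exists V, beta, eta; split=> // [u /VU2/U2U//||].
    exact: quasi_umbilic_on_sub VU2 qu.
  by apply: Or44; split=> // u /VU2/U21 U1u; split; [exact: a0|exact: b0].
have [|eta qu] := quasi_umbilic_on_umbilic n4 oU sf metricE lam0 snu nuP oU1 U1U.
  by move=> u /E[_ /eqP].
have fU1 := local_param_sub oU1 U1U fM.
have [_ sf1 fi1 _ _] := fU1.
have mE1 u (h : U1 u) := metricE (U1U u h).
have l01 u (h : U1 u) := lam0 (U1U u h).
case: za E => E.
  have a0 u : U1 u -> alpha u = 0 by move=> /E[/eqP].
  have [V [oV Vu0 VU1] HV] := hyperplane_piece oU1 sf1 fi1 mE1 l01 qu U1u0 a0.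
  exists V, (fun=> 0), eta; split=> // [u /VU1/U1U//||].
    exact: quasi_umbilic_on_sub VU1 qu.
  by apply: Or41; split=> // u /VU1/a0.
have a0 u : U1 u -> alpha u != 0 by move=> /E[/negbT].
have [V [oV Vu0 VU1] HV] := hypersphere_piece n3 oU1 sf1 fi1 mE1 l01 qu U1u0 a0.
exists V, (fun=> 0), eta; split=> // [u /VU1/U1U//||].
  exact: quasi_umbilic_on_sub VU1 qu.
by apply: Or42; split=> // u /VU1/a0.
Qed.

End ConformalChart.

Lemma conformal_chart {R : realType} {n : nat} (M : set 'rV[R]_n.+1) p :
  (0 < n)%N -> conformally_flat M -> M p ->
  exists U f lam nu u0, [/\ local_param M U f, U u0 /\ f u0 = p,
    forall u, U u -> metric f u = (lam u)%:M /\ 0 < lam u,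
    smooth_on U nu & forall u, U u -> unit_normal f u (nu u)].
Proof.
move=> n0 flat Mp; have [U [f [phi [fM [u0 Uu0 fp] sphi mE]]]] := flat p Mp.
pose lam u := expR (2 * phi u).
have lam0 u : U u -> 0 < lam u by move=> _; exact: expR_gt0.
have [oU sf _ _ _] := fM.
have [U' [oU' U'u0 U'U] [nu snu nuP]] := smooth_unit_normal oU sf mE lam0 n0 Uu0.
exists U', f, lam, nu, u0; split=> //; first exact: local_param_sub fM.
by move=> u /U'U Uu; split; [exact: mE|exact: lam0].
Qed.

Theorem theorem5p4 (R : realType) (n : nat) (hn : (4 <= n)%N)
    (M : set 'rV[R]_n.+1)
    (hM : hypersurface M) (hflat : conformally_flat M) :
  [/\ forall p, M p -> exists a b, quasi_umbilic_at M p a b,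
      M `<=` closure (constant_type M)
    & forall p, constant_type M p ->
      exists (U : set 'rV[R]_n) (f nu : 'rV[R]_n -> 'rV[R]_n.+1)
        (alpha beta : 'rV[R]_n -> R) (eta : 'rV[R]_n -> 'rV[R]_n),
        [/\ local_param M U f, (f @` U) p,
            quasi_umbilic_on U f nu alpha beta eta
          & [\/ (forall u, U u -> alpha u = 0 /\ beta u = 0) /\
                exists2 S, hyperplane S & open_part (f @` U) S,
                (forall u, U u -> alpha u != 0 /\ beta u = 0) /\
                exists2 S, hypersphere S & open_part (f @` U) S,
                (forall u, U u -> alpha u = 0 /\ beta u != 0) /\
                developable (f @` U)
              | (forall u, U u -> alpha u != 0 /\ beta u != 0) /\
                canal_part (f @` U)]]].
Proof.
have n0 : (0 < n)%N by exact: leq_trans hn.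
split.
- move=> p Mp; have [U [f [lam [nu [u0 [fM [Uu0 fp] mE _ nuP]]]]]] := conformal_chart n0 hflat Mp.
  have [eta qu] := quasi_umbilic_chart hn fM (fun u h => (mE u h).1) (fun u h => (mE u h).2) nuP Uu0.
  exists (umbilic_coeff f lam nu u0), (ridge_coeff f lam nu u0).
  by exists U, f, u0, (nu u0), eta; split.
- move=> p Mp; have [U [f [lam [nu [u0 [fM [Uu0 <-] mE snu nuP]]]]]] := conformal_chart n0 hflat Mp.
  exact: constant_type_dense hn fM (fun u h => (mE u h).1) (fun u h => (mE u h).2) snu nuP u0 Uu0.
(* The type is given by charts that vary with the point and need not be
   conformal; it is transferred to one conformal chart. *)
- move=> p [Mp [W [za [zb [oW Wp HW]]]]].
  have [U [f [lam [nu [u0 [fM [Uu0 fp] mE snu nuP]]]]]] := conformal_chart n0 hflat Mp.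
  have mE1 u (h : U u) := (mE u h).1; have l0 u (h : U u) := (mE u h).2.
  have [oU sf _ _ fo] := fM.
  pose U1 := U `&` f @^-1` W.
  have oU1 : open U1.
    by apply: open_preimage_on => // u Uu; exact: smooth_differentiable sf Uu.
  have MU u : U u -> M (f u).
    by move=> Uu; have [W' _ EW'] := fo U oU (fun x => id);
       have : (f @` U) (f u) by [exists u]; rewrite EW' => -[].
  have U1u0 : U1 u0 by split=> //=; rewrite fp.
  have [u [Uu Wu]|V [b [eta [oV Vu0 VU qu K]]]] :=
    constant_type_piece hn fM mE1 l0 snu nuP (U1 := U1) (za := za) (zb := zb) oU1 (fun u h => h.1) U1u0.
    have [a [b [[U' [f' [u' [nu' [th [fM' U'u' Ef qu']]]]]] <- <-]]] := HW (f u) (conj (MU u Uu) Wu).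
    have [eta qu] := quasi_umbilic_chart hn fM mE1 l0 nuP Uu.
    have [-> ->] := umbilic_type_independent fM fM' Uu U'u' (esym Ef) (ltnW hn) mE1 l0 qu qu'.
    by [].
  exists V, f, nu, (umbilic_coeff f lam nu), b, eta; split=> //.
    exact: local_param_sub fM.
  by exists u0.
Qed.
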